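(* Let $n\ge m\ge 1$ be integers, and let $d=(A,b,c)$ with $A\in\mathbb{R}^{m\times n}$, $b\in\mathbb{R}^m$, $c\in\mathbb{R}^n$ be Gaussian, i.e. all entries of $A,b,c$ are i.i.d. standard normal (written $d\sim N(0,\mathrm{Id})$). Let $\mathcal{U}$ be the set of triples having a unique optimal basis and let $\mathcal{K}(d)$ be the condition number defined with respect to the norm $\|\cdot\|_{12}$. Then $$\mathbb{E}_{d\sim N(0,\mathrm{Id})}\big(\ln\mathcal{K}(d)\,\big|\, d\in\mathcal{U}\big)\;\le\;\frac54\ln(m+1)+\frac32\ln(n+1)+\ln(12).$$
   Context: Let $n\ge m\ge1$. A data triple $d=(A,b,c)\in\mathbb{R}^{mn+m+n}$ encodes the linear program $\min c^{T}x$ s.t. $Ax=b,\ x\ge0$, with dual $\max b^{T}y$ s.t. $A^{T}y\le c$. For $B\subset\{1,\dots,n\}$, $A_B$ is the submatrix of $A$ formed by the columns with index in $B$, and $x_B$ (for $x\in\mathbb{R}^n$) is defined analogously. $B$ is a basis for $A$ if $|B|=m$ and $A_B$ is invertible. For a basis $B$, the primal basic solution $x^*$ is given by $x^*_j=0$ for $j\notin B$ and $x^*_B=A_B^{-1}b$; it is feasible if $x^*\ge0$. The dual basic solution is the $y^*$ with $A_B^{T}y^*=c_B$; it is feasible if $A^{T}y^*\le c$. $B$ is an optimal basis for $d$ if both the primal and dual basic solutions are feasible. $\mathcal{U}=\{d : d \text{ has a unique optimal basis}\}$. Norm: for $d=(A,b,c)$ let $M_d=\begin{pmatrix} c^{T}&0\\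 A&b\end{pmatrix}\in\mathbb{R}^{(m+1)\times(n+1)}$. $\|d\|=\|d\|_{12}:=\|M_d\|_{12}$ is the operator norm of $M_d$ as a linear map from $\mathbb{R}^{n+1}$ with the $\ell_1$ norm to $\mathbb{R}^{m+1}$ with the $\ell_2$ norm. Condition number: let $\Sigma_U$ be the boundary of $\mathcal{U}$ in $\mathbb{R}^{mn+m+n}$. For $d\in\mathcal{U}$, $\varrho(d)=\min\{\|\delta d\| : d+\delta d\in\Sigma_U\}$ and $\mathcal{K}(d)=\|d\|/\varrho(d)$. *)

(* Defs.v *)
From HB Require Import structures.
From mathcomp Require Import all_boot all_order all_algebra.
From mathcomp Require Import all_classical all_reals all_analysis.

Set Implicit Arguments.
Unset Strict Implicit.
Unset Printing Implicit Defensive.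

Import Order.TTheory GRing.Theory Num.Theory.
Import numFieldNormedType.Exports.

Local Open Scope classical_set_scope.
Local Open Scope ring_scope.

(* A data triple d = (A, b, c); its topology is the product topology, i.e. the
   usual one of R^(mn+m+n). *)
Definition lp_data (R : realType) (m n : nat) : Type :=
  ('M[R]_(m, n) * 'cV[R]_m * 'cV[R]_n)%type.

Definition lpA (R : realType) m n (d : lp_data R m n) : 'M[R]_(m, n) := d.1.1.
Definition lpb (R : realType) m n (d : lp_data R m n) : 'cV[R]_m := d.1.2.
Definition lpc (R : realType) m n (d : lp_data R m n) : 'cV[R]_n := d.2.

Section Bases.
Context {R : realType} {m n : nat}.

(* The increasing enumeration of a set of m column indices. *)
Definition basis_idx (B : {set 'I_n}) (hB : #|B| = m) (k : 'I_m) : 'I_n :=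
  enum_val (cast_ord (esym hB) k).

Definition basis_mx (A : 'M[R]_(m, n)) (B : {set 'I_n}) (hB : #|B| = m) :
  'M[R]_m := colsub (basis_idx hB) A.

Definition basis_cV (x : 'cV[R]_n) (B : {set 'I_n}) (hB : #|B| = m) :
  'cV[R]_m := rowsub (basis_idx hB) x.

Definition primal_basic_solution (d : lp_data R m n) (B : {set 'I_n})
    (hB : #|B| = m) (x : 'cV[R]_n) : Prop :=
  (forall j, j \notin B -> x j 0 = 0) /\
  basis_cV x hB = invmx (basis_mx (lpA d) hB) *m lpb d.

Definition dual_basic_solution (d : lp_data R m n) (B : {set 'I_n})
    (hB : #|B| = m) (y : 'cV[R]_m) : Prop :=
  (basis_mx (lpA d) hB)^T *m y = basis_cV (lpc d) hB.

(* When A_B is invertible both basic solutions exist and are unique, so the two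
   existentials below only name them. *)
Definition optimal_basis (d : lp_data R m n) (B : {set 'I_n}) : Prop :=
  exists hB : #|B| = m,
  [/\ basis_mx (lpA d) hB \in unitmx,
      exists2 x : 'cV[R]_n, primal_basic_solution d hB x
        & forall j, 0 <= x j 0
    & exists2 y : 'cV[R]_m, dual_basic_solution d hB y
        & forall j, ((lpA d)^T *m y) j 0 <= lpc d j 0].

Definition has_unique_optimal_basis : set (lp_data R m n) :=
  [set d | exists! B : {set 'I_n}, optimal_basis d B].

End Bases.

Section Condition.
Context {R : realType}.

Definition l1norm k (x : 'cV[R]_k) : R := \sum_i `|x i 0|.

Definition l2norm k (x : 'cV[R]_k) : R := Num.sqrt (\sum_i x i 0 ^+ 2).

Definition opnorm12 p q (M : 'M[R]_(p, q)) : R :=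
  sup [set l2norm (M *m x) | x in [set x : 'cV[R]_q | l1norm x <= 1]].

Context {m n : nat}.

Definition lp_mx (d : lp_data R m n) : 'M[R]_(1 + m, n + 1) :=
  block_mx (lpc d)^T 0 (lpA d) (lpb d).

Definition lp_norm (d : lp_data R m n) : R := opnorm12 (lp_mx d).

Definition boundary (T : topologicalType) (S : set T) : set T :=
  closure S `\` S°.

Definition Sigma_U : set (lp_data R m n) := boundary has_unique_optimal_basis.

(* For 1 <= m <= n the set is nonempty (delta = - d is in it) and, Sigma_U
   being closed, its infimum is attained. *)
Definition rho (d : lp_data R m n) : R :=
  inf [set lp_norm delta | delta in [set delta | Sigma_U (d + delta)]].

(* Extended-real valued: a degenerate d in the set of triples with a unique
   optimal basis may have rho d = 0 (e.g. m = n and a vanishing entry of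
   A^-1 b), in which case this is +oo. *)
Definition cond_number (d : lp_data R m n) : \bar R :=
  ((lp_norm d)%:E / (rho d)%:E)%E.

End Condition.

Section Probability.
Context {dsp : measure_display} {Omega : measurableType dsp} {R : realType}.

Definition mutually_independent (P : probability Omega R) (I : finType)
    (X : I -> Omega -> R) : Prop :=
  forall (J : {set I}) (E : I -> set R), (forall i, measurable (E i)) ->
    P (\bigcap_(i in [set` J]) (X i @^-1` E i)) =
    (\prod_(i in J) P (X i @^-1` E i))%E.

Definition standard_normal (P : probability Omega R) (X : Omega -> R) : Prop :=
  measurable_fun setT X /\
  forall E : set R, measurable E -> P (X @^-1` E) = normal_prob 0 1 E.

Definition lp_entry m n (d : lp_data R m n)
    (k : ('I_m * 'I_n) + ('I_m + 'I_n)) : R :=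
  match k with
  | inl (i, j) => lpA d i j
  | inr (inl i) => lpb d i 0
  | inr (inr j) => lpc d j 0
  end.

Definition gaussian_data (P : probability Omega R) m n
    (D : Omega -> lp_data R m n) : Prop :=
  mutually_independent P (fun k w => lp_entry (D w) k) /\
  forall k, standard_normal P (fun w => lp_entry (D w) k).

(* E(f | E), for an event E of positive probability. *)
Definition cond_expectation (P : probability Omega R) (f : Omega -> \bar R)
    (E : set Omega) : \bar R :=
  ((\int[P]_(w in E) f w) / P E)%E.

End Probability.

(* Main.v *)
Require Import Defs.
From HB Require Import structures.
From mathcomp Require Import all_boot all_order all_algebra.
From mathcomp Require Import all_classical all_reals all_analysis.
From mathcomp Require Import measurable_realfun ring lra zify.
Set Implicit Arguments.
Unset Strict Implicit.
Unset Printing Implicit Defensive.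
Import Order.TTheory GRing.Theory Num.Theory.
Import numFieldNormedType.Exports.
Local Open Scope classical_set_scope.
Local Open Scope ring_scope.

(** For a basis [B], let the family of minors consist of [A_B], the Cramer
    numerators of the basic solution [x_B], and the bordered matrices
    [(c_j, c_B; a_j, A_B)] whose determinants are [det A_B] times the reduced
    costs. A strictly optimal [d] can only leave [U] along a segment on which
    one of these [n + 1] matrices [S] becomes singular. If a perturbation of
    columnwise size [e] makes the [k x k] matrix [S] singular, there is a unit
    vector [p] with [|p . h| <= e sqrt k |S^-1 h|] for all [h]; averaging over a
    Gaussian [h], for which [p . h] is standard normal, bounds [ln (1 / e)] by
    [2 E_h ln^+ (tau |S^-1 h|)] up to a constant. For Gaussian [S], rotation
    invariance and conditioning on all rows but the first show that
    [|S^-1 h|] is distributed as [|h| / |x|] with [x] standard normal, whose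
    logarithmic moment is elementary. Finally [ln |d|] is bounded by the fourth
    moment of the entries.

    Conditioning on strict optimality costs nothing: changing the sign of the
    column [(a_j, c_j)] preserves all these bounds and the Gaussian law, and
    flips the sign of the [j]-th basic variable or reduced cost, so the strictly
    optimal event has probability [2^-n] and is independent of the bound. *)

(** * Families of independent standard normal variables *)

(** The vector [p] depends on the data and on the perturbation, so a fixed [h] would give no lower
    bound on [|p . h|]. The average over an independent [h] is a function of [S] alone and bounds
    all perturbations at once. Which minor becomes singular also depends on the perturbation, hence
    the sum over all [n + 1] minors.

    With a scale [A], [ln (1 / e) <= ln A + ln^+ (1 / (A e))]; the positive part keeps all
    integrands nonnegative, so that Tonelli applies without integrability. [A], of order
    [(n + 1) (m + 1)], makes each minor contribute at most [1 / (n + 1)], so the distance costs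
    [ln A + 1]. The norm costs a quarter of [ln (7/2 (m + 1)^2 (n + 1))]. This gives the
    coefficients [3/2] for [ln (m + 1)] and [5/4] for [ln (n + 1)], which [m <= n] trades for the
    stated ones.

    The bound is a measurable function of all data, inside [U] or not, invariant under the sign
    changes. The condition number itself is only compared with it pointwise. *)

Definition cylinders (R : realType) (I : finType) : set (set (I -> R)) :=
  [set A | exists2 E : I -> set R, (forall i, measurable (E i)) &
     A = [set x | forall i, E i (x i)]].

(** Generated by boxes because these are stable under intersection and are the sets on which
    [iid_normal] prescribes the law. *)
Definition coord_space (R : realType) (I : finType) :=
  g_sigma_algebraType (@cylinders R I).

Section CoordSpace.
Context {R : realType} {I : finType}.

Lemma measurable_coord (i : I) :
  measurable_fun setT (fun x : coord_space R I => x i).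
Proof.
move=> _ E mE; rewrite setTI; apply: sub_sigma_algebra.
exists (fun j => if j == i then E else setT).
  by move=> j; case: ifP.
apply/seteqP; split=> x /= Ex; last by have := Ex i; rewrite eqxx.
by move=> j; case: eqP => // ->.
Qed.

Context {d : measure_display} {T : measurableType d}.

Lemma measurable_forall (A : I -> set T) :
  (forall i, measurable (A i)) -> measurable [set w | forall i, A i w].
Proof.
move=> mA; rewrite (_ : mkset _ = \big[setI/setT]_(i : I) A i).
  by apply: bigsetI_measurable => i _.
rewrite -classical_sets.bigcap_seq; apply/seteqP; split=> w /= Ew i.
  by move=> _; exact: Ew.
exact: Ew (mem_index_enum _).
Qed.

Lemma measurable_family (X : I -> T -> R) :
  (forall i, measurable_fun setT (X i)) ->
  measurable_fun setT (fun w => (fun i => X i w) : coord_space R I).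
Proof.
move=> mX; apply: (@measurability _ _ T (coord_space R I) setT _ (@cylinders R I) erefl).
move=> _ [_ [E mE ->] <-]; rewrite setTI.
apply: (measurable_forall (A := fun i => X i @^-1` E i)) => i.
by rewrite -[X in measurable X]setTI; exact: mX.
Qed.

End CoordSpace.

(** The product formula is imposed on the full family only; [E i = setT] recovers every
    subfamily. *)
Definition iid_normal {d} {T : measurableType d} {R : realType}
    (P : probability T R) (I : finType) (X : I -> T -> R) : Prop :=
  (forall i, measurable_fun setT (X i)) /\
  forall E : I -> set R, (forall i, measurable (E i)) ->
    P [set w | forall i, E i (X i w)] = (\prod_i normal_prob 0 1 (E i))%E.

Section IidNormal.
Context {R : realType}.
Local Open Scope ereal_scope.

(** The two image measures agree on boxes, a generating pi-system, so they coincide. *)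
Lemma iid_normal_law d (T : measurableType d) (P : probability T R)
    d' (T' : measurableType d') (P' : probability T' R) (I : finType)
    (X : I -> T -> R) (X' : I -> T' -> R) (A : set (coord_space R I)) :
  iid_normal P X -> iid_normal P' X' -> measurable A ->
  P [set w | A (fun i => X i w)] = P' [set w | A (fun i => X' i w)].
Proof.
move=> [mX PX] [mX' PX'] mA.
pose F := fun w => (fun i => X i w) : coord_space R I.
pose F' := fun w => (fun i => X' i w) : coord_space R I.
have mF : measurable_fun setT F by exact: measurable_family.
have mF' : measurable_fun setT F' by exact: measurable_family.
pose F_ : {mfun T >-> coord_space R I} := HB.pack F (isMeasurableFun.Build _ _ _ _ _ mF).
pose F'_ : {mfun T' >-> coord_space R I} := HB.pack F' (isMeasurableFun.Build _ _ _ _ _ mF').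
apply: (@measure_unique _ R (coord_space R I) (@cylinders R I) (fun=> setT) _ _ _ _
  (pushforward P F_) (pushforward P' F'_)).
- by [].
- move=> _ _ [E mE ->] [E' mE' ->]; exists (fun i => E i `&` E' i).
    by move=> i; exact: measurableI.
  apply/seteqP; split=> x /=; first by move=> [H H'] i; split.
  by move=> H; split=> i; have [] := H i.
- by move=> _; exists (fun=> setT) => //; apply/seteqP; split.
- by apply/seteqP; split=> // x _; exists 0%N.
- move=> _ [E mE ->]; transitivity (\prod_i normal_prob 0 1 (E i)).
    exact: PX.
  by symmetry; exact: PX'.
- by move=> _; change (P (F @^-1` setT) < +oo); rewrite preimage_setT probability_setT ltry.
- exact: mA.
Qed.

(** The tool that replaces a family under an integral by a rotated, sign-changed or product
    realization of it. *)
Lemma iid_normal_transfer d (T : measurableType d) (P : probability T R)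
    d' (T' : measurableType d') (P' : probability T' R) (I : finType)
    (X : I -> T -> R) (X' : I -> T' -> R) (F : coord_space R I -> \bar R) :
  iid_normal P X -> iid_normal P' X' -> measurable_fun setT F ->
  (forall x, 0 <= F x) ->
  \int[P]_w F (fun i => X i w) = \int[P']_w F (fun i => X' i w).
Proof.
move=> HX HX' mF F0; have [mX _] := HX; have [mX' _] := HX'.
pose G := fun w => (fun i => X i w) : coord_space R I.
pose G' := fun w => (fun i => X' i w) : coord_space R I.
have mG : measurable_fun setT G by exact: measurable_family.
have mG' : measurable_fun setT G' by exact: measurable_family.
have H1 := @ge0_integral_pushforward _ _ _ _ R _ mG P setT F measurableT mF (fun x _ => F0 x).
have H2 := @ge0_integral_pushforward _ _ _ _ R _ mG' P' setT F measurableT mF (fun x _ => F0 x).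
rewrite !preimage_setT in H1 H2; rewrite -[LHS]H1 -[RHS]H2.
apply: eq_measure_integral => A mA _.
exact: iid_normal_law.
Qed.

Lemma prod_normal_reindex (I J : finType) (f : J -> I) (E : J -> set R) :
  injective f ->
  \prod_i normal_prob 0 1 [set y : R | forall j, f j = i -> E j y] =
  \prod_j normal_prob 0 1 (E j).
Proof.
move=> f_inj; rewrite (bigID (mem (codom f)))/= [X in _ * X]big1 ?mule1; last first.
  move=> i iNf; rewrite (_ : mkset _ = setT) ?probability_setT//.
  by apply/seteqP; split=> // y _ j fji; rewrite -fji codom_f in iNf.
rewrite -big_uniq /=; last by rewrite map_inj_uniq// enum_uniq.
rewrite big_image /=; apply: eq_bigr => j _; congr normal_prob.
apply/seteqP; split=> y /= Ey; first exact: (Ey j).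
by move=> j' /f_inj ->.
Qed.

Lemma measurable_forall_eq (I J : finType) (f : J -> I) (E : J -> set R) i :
  (forall j, measurable (E j)) -> measurable [set y : R | forall j, f j = i -> E j y].
Proof.
move=> mE; rewrite (_ : mkset _ =
    [set y | forall j, (if f j == i then E j else setT) y]).
  by apply: measurable_forall => j; case: ifP.
apply/seteqP; split=> y /= Ey j; first by case: eqP => // /Ey.
by move=> fji; have := Ey j; rewrite fji eqxx.
Qed.

Lemma iid_normal_comp d (T : measurableType d) (P : probability T R)
    (I J : finType) (f : J -> I) (X : I -> T -> R) : injective f ->
  iid_normal P X -> iid_normal P (fun j => X (f j)).
Proof.
move=> f_inj [mX PX]; split=> [j|E mE]; first exact: mX.
rewrite -(prod_normal_reindex E f_inj) -PX.
  congr (P _); apply/seteqP; split=> w /=; first by move=> H i j <-.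
  by move=> H j; exact: H.
by move=> i; exact: measurable_forall_eq.
Qed.

Section Product.
Context {d d' : measure_display} {T : measurableType d} {T' : measurableType d'}.
Variables (P : probability T R) (P' : probability T' R).

Definition prod_prob : set (T * T')%type -> \bar R := (P \x P')%E.

HB.instance Definition _ := Measure.on prod_prob.

Let prod_probT : prod_prob setT = 1.
Proof.
transitivity (P setT * P' setT); last by rewrite !probability_setT mule1.
by rewrite -product_measure1E// setXTT.
Qed.

HB.instance Definition _ :=
  @Measure_isProbability.Build _ _ R prod_prob prod_probT.

(** Source of independent copies: composed with an injection by [iid_normal_comp], it places chosen
    coordinates on a separate factor. *)
Lemma iid_normal_prod (I J : finType) (X : I -> T -> R) (Y : J -> T' -> R) :
  iid_normal P X -> iid_normal P' Y ->
  iid_normal prod_prob (fun k w =>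
    match k : I + J with inl i => X i w.1 | inr j => Y j w.2 end).
Proof.
move=> [mX PX] [mY PY]; split.
  case=> [i|j]; exact: measurableT_comp.
move=> E mE; rewrite big_sumType /= -PX// -PY// -product_measure1E//.
- congr (_ _); apply/seteqP; split=> -[w w'] /=; first by move=> H; split=> k; [exact: (H (inl k))|exact: (H (inr k))].
  by move=> [H H'] [].
- rewrite (_ : mkset _ = (fun w => (fun i => X i w) : coord_space R I) @^-1`
      [set x | forall i, E (inl i) (x i)])//.
  rewrite -[X in measurable X]setTI; apply: (measurable_family mX) => //.
  by apply: sub_sigma_algebra; exists (fun i => E (inl i)).
- rewrite (_ : mkset _ = (fun w => (fun i => Y i w) : coord_space R J) @^-1`
      [set x | forall i, E (inr i) (x i)])//.
  rewrite -[X in measurable X]setTI; apply: (measurable_family mY) => //.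
  by apply: sub_sigma_algebra; exists (fun i => E (inr i)).
Qed.

End Product.

End IidNormal.

(** * Rotation invariance *)

Section NormalDensity.
Context {R : realType}.
Local Notation mu := (@lebesgue_measure R).
Local Notation N := (@normal_prob R 0 1).
Local Open Scope ereal_scope.

Lemma measurable_normal_pdf_EFin :
  measurable_fun [set: measurableTypeR R] (fun x => (@normal_pdf R 0 1 x)%:E).
Proof. by apply/measurable_EFinP; exact: measurable_normal_pdf. Qed.

(** The Radon-Nikodym derivative of [normal_prob] has the same integral as the explicit density over
    every measurable set, so the two agree almost everywhere. *)
Lemma integral_normal_prob (f : R -> \bar R) :
  measurable_fun [set: measurableTypeR R] f -> (forall x, 0 <= f x) ->
  \int[N]_x f x = \int[mu]_x (f x * (normal_pdf 0 1 x)%:E).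
Proof.
move=> mf f0.
pose g := Radon_Nikodym_SigmaFinite.f N mu.
have dom : N `<< mu by exact: normal_prob_dominates.
have ig : mu.-integrable setT g by exact: Radon_Nikodym_SigmaFinite.f_integrable.
have g0 : forall x, 0 <= g x by move=> x; exact: Radon_Nikodym_SigmaFinite.f_ge0.
have mg : measurable_fun setT g by exact: measurable_int ig.
rewrite -(Radon_Nikodym_SigmaFinite.change_of_variables dom f0 measurableT mf).
have ae : ae_eq mu setT g (fun x => (normal_pdf 0 1 x)%:E).
  apply: (integral_ae_eq measurableT ig measurable_normal_pdf_EFin).
  by move=> A _ mA; rewrite -[LHS](Radon_Nikodym_SigmaFinite.f_integral dom).
apply: ge0_ae_eq_integral.
- exact: measurableT.
- exact: emeasurable_funM.
- apply: emeasurable_funM; [exact: mf|exact: measurable_normal_pdf_EFin].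
- by move=> x _; apply: mule_ge0; [exact: f0|exact: g0].
- by move=> x _; apply: mule_ge0; [exact: f0|rewrite lee_fin; exact: normal_pdf_ge0].
- exact: ae_eqe_mul2l ae.
Qed.

(** The image of Lebesgue measure under [x -> a x + b], multiplied by [a], gives half-open intervals
    their length; uniqueness identifies it with Lebesgue measure. *)
Lemma ge0_integral_affine (a b : R) (f : R -> \bar R) : (0 < a)%R ->
  measurable_fun [set: measurableTypeR R] f -> (forall x, 0 <= f x) ->
  a%:E * \int[mu]_x f (a * x + b)%R = \int[mu]_x f x.
Proof.
move=> a0 mf f0.
pose phi := (fun x => a * x + b)%R : measurableTypeR R -> measurableTypeR R.
have mphi : measurable_fun setT phi.
  by apply: measurable_funD => //; exact: measurable_funM.
have a0' : (0 <= a)%R by exact: ltW.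
pose pm : {measure set (measurableTypeR R) -> \bar R} :=
  measure_function_pushforward__canonical__measure_function_Measure mu mphi.
pose nu := mscale (NngNum a0') pm.
have E A : measurable A -> mu A = nu A.
  apply: lebesgue_measure_unique => _ [[x y]] _ <- /=.
  rewrite /nu /mscale /pm /= /pushforward.
  rewrite (_ : _ @^-1` _ = `](x - b) / a, (y - b) / a]%classic)%R; last first.
    apply/seteqP; split=> z /=; rewrite !in_itv /= /phi ltr_pdivrMr// ler_pdivlMr//.
      by rewrite ltrBlDr lerBrDr [(z * a)%R]mulrC.
    by rewrite ltrBlDr lerBrDr [(z * a)%R]mulrC.
  rewrite !lebesgue_measure_itv /= !lte_fin ltr_pM2r ?invr_gt0// ltrD2r.
  case: ifP => _; last by rewrite mule0.
  by rewrite -!EFinD -EFinM; congr (_%:E); field; rewrite gt_eqF.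
rewrite [RHS](eq_measure_integral nu); last by move=> A mA _; exact: E.
rewrite ge0_integral_mscale//; congr (_ * _).
have := @ge0_integral_pushforward _ _ _ _ R _ mphi mu setT f measurableT mf (fun x _ => f0 x).
by rewrite preimage_setT => <-.
Qed.

End NormalDensity.

Section NormalRotation.
Context {R : realType}.
Local Notation TR := (measurableTypeR R).
Local Notation mu := (@lebesgue_measure R).
Local Notation N := (@normal_prob R 0 1).
Local Notation phi := (fun x : R => (@normal_pdf R 0 1 x)%:E).
Local Open Scope ereal_scope.

(** Cancels the Jacobian even when both integrals are infinite. *)
Lemma EFin_mul_inj (c : R) (x y : \bar R) : c != 0%R ->
  c%:E * x = c%:E * y -> x = y.
Proof.
move=> c0 /(congr1 (fun z => c^-1%:E * z)).
by rewrite !muleA -!EFinM mulVf// !mul1e.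
Qed.

Lemma normal_pdf_EFin_ge0 (x : R) : 0 <= phi x.
Proof. by rewrite lee_fin; exact: normal_pdf_ge0. Qed.

Lemma integral_normal_prob2 (f : TR * TR -> \bar R) :
  measurable_fun setT f -> (forall z, 0 <= f z) ->
  \int[N]_y \int[N]_x f (x, y) =
  \int[mu]_y \int[mu]_x (f (x, y) * phi x * phi y).
Proof.
move=> mf f0.
have mphi := @measurable_normal_pdf_EFin R.
have mfy y : measurable_fun [set: TR] (fun x => f (x, y)).
  exact: measurable_fun_pair1.
rewrite integral_normal_prob; first last.
- by move=> y; apply: integral_ge0 => x _; exact: f0.
- exact: (measurable_fun_fubini_tonelli_G (m1 := N) f mf f0).
apply: eq_integral => y _.
rewrite integral_normal_prob; first last.
- by move=> x; exact: f0.
- exact: mfy.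
rewrite -ge0_integralZr; first by [].
- exact: measurableT.
- apply: emeasurable_funM; [exact: mfy|exact: mphi].
- by move=> x _; apply: mule_ge0; [exact: f0|exact: normal_pdf_EFin_ge0].
- exact: normal_pdf_EFin_ge0.
Qed.

Lemma normal_pdfM (x y u v : R) : (x ^+ 2 + y ^+ 2 = u ^+ 2 + v ^+ 2)%R ->
  phi x * phi y = phi u * phi v.
Proof.
move=> xyuv; rewrite !normal_pdfE ?oner_neq0// -!EFinM; congr (_%:E).
rewrite mulrACA [RHS]mulrACA; congr (_ * _)%R; rewrite /normal_fun -!expRD; congr expR.
by rewrite !subr0 -!mulrDl -!opprD xyuv.
Qed.

(* Two substitutions: [u = c x + s y] in [x], then [y = c v + s u] in [y]; hence [0 < c]. *)
Lemma normal_rotate2 (c s : R) (f : TR * TR -> \bar R) :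
  (0 < c)%R -> (c ^+ 2 + s ^+ 2 = 1)%R ->
  measurable_fun setT f -> (forall z, 0 <= f z) ->
  \int[N]_y \int[N]_x f (c * x + s * y, - s * x + c * y)%R =
  \int[N]_y \int[N]_x f (x, y).
Proof.
move=> c0 cs1 mf f0.
have mphi := @measurable_normal_pdf_EFin R.
have m1 : measurable_fun [set: TR * TR] fst by exact: measurable_fst.
have m2 : measurable_fun [set: TR * TR] snd by exact: measurable_snd.
have mlin (a b : R) : measurable_fun [set: TR * TR] (fun z => (a * z.1 + b * z.2)%R : TR).
  by apply: measurable_funD; apply: measurable_funM => //; exact: measurable_cst.
rewrite (@integral_normal_prob2 (fun z => f (c * z.1 + s * z.2, - s * z.1 + c * z.2)%R)) /=; first last.
- by move=> z; exact: f0.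
- apply: (measurableT_comp mf).
  exact: measurable_fun_pair (mlin _ _) (mlin _ _).
rewrite (integral_normal_prob2 mf f0).
(* The integrand after the first substitution, in the variables [(u, y)]: the second rotated
   coordinate is then [v = (y - s u) / c]. Each of the two substitutions produces one factor [c]. *)
pose H (z : TR * TR) : \bar R :=
  let v := (c^-1 * z.2 + - (s / c) * z.1)%R in f (z.1, v) * phi z.1 * phi v.
have mv : measurable_fun [set: TR * TR] (fun z => (c^-1 * z.2 + - (s / c) * z.1)%R : TR).
  by apply: measurable_funD; apply: measurable_funM => //; exact: measurable_cst.
have mH : measurable_fun setT H.
  apply: emeasurable_funM.
    apply: emeasurable_funM.
      apply: (measurableT_comp mf).
      exact: measurable_fun_pair m1 mv.
    exact: measurableT_comp mphi m1.
  exact: measurableT_comp mphi mv.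
have H0 z : 0 <= H z.
  by rewrite /H; apply: mule_ge0; [apply: mule_ge0|]; rewrite ?f0 ?normal_pdf_EFin_ge0.
have c0' : c != 0%R by rewrite gt_eqF.
have E1 : c%:E * \int[mu]_y \int[mu]_x (f (c * x + s * y, - s * x + c * y)%R * phi x * phi y)
   = \int[mu]_y \int[mu]_u H (u, y).
  rewrite -ge0_integralZl; first last.
  - by rewrite lee_fin ltW.
  - move=> y _; apply: integral_ge0 => x _.
    by apply: mule_ge0; [apply: mule_ge0|]; rewrite ?f0 ?normal_pdf_EFin_ge0.
  - apply: (measurable_fun_fubini_tonelli_G (m1 := mu)
      (fun z : TR * TR => f (c * z.1 + s * z.2, - s * z.1 + c * z.2)%R * phi z.1 * phi z.2) _ _); last first.
      by move=> z; apply: mule_ge0; [apply: mule_ge0|]; rewrite ?f0 ?normal_pdf_EFin_ge0.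
    apply: emeasurable_funM; [apply: emeasurable_funM|].
    + apply: (measurableT_comp mf).
      exact: measurable_fun_pair (mlin _ _) (mlin _ _).
    + exact: measurableT_comp mphi m1.
    + exact: measurableT_comp mphi m2.
  - exact: measurableT.
  apply: eq_integral => y _.
  rewrite -(@ge0_integral_affine _ c (s * y) (fun u => H (u, y))); first last.
  - by move=> ?; exact: H0.
  - exact: measurable_fun_pair1 mH.
  - exact: c0.
  apply: (congr1 (fun z => c%:E * z)); apply: eq_integral => x _; rewrite /H /=.
  have -> : (c^-1 * y + - (s / c) * (c * x + s * y) = - s * x + c * y)%R.
    by rewrite -[X in (c^-1 * X)%R]mul1r -cs1; field.
  rewrite -!muleA; congr (_ * _); apply: normal_pdfM.
  by rewrite -[LHS]mul1r -cs1; ring.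
have E2 : \int[mu]_y \int[mu]_u H (u, y) =
   c%:E * \int[mu]_y \int[mu]_x (f (x, y) * phi x * phi y).
  transitivity (\int[mu]_u \int[mu]_y H (u, y)).
    exact: esym (@fubini_tonelli _ _ _ _ _ mu mu H mH H0).
  transitivity (c%:E * \int[mu]_u \int[mu]_v (f (u, v) * phi u * phi v)); last first.
    apply: (congr1 (fun z => c%:E * z)).
    refine (@fubini_tonelli _ _ _ _ _ mu mu (fun z => f z * phi z.1 * phi z.2) _ _).
    + apply: emeasurable_funM; [apply: emeasurable_funM|].
      * exact: mf.
      * exact: measurableT_comp mphi m1.
      * exact: measurableT_comp mphi m2.
    + by move=> z; apply: mule_ge0; [apply: mule_ge0|]; rewrite ?f0 ?normal_pdf_EFin_ge0.
  rewrite -ge0_integralZl; first last.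
  - by rewrite lee_fin ltW.
  - move=> u _; apply: integral_ge0 => x _.
    by apply: mule_ge0; [apply: mule_ge0|]; rewrite ?f0 ?normal_pdf_EFin_ge0.
  - apply: (measurable_fun_fubini_tonelli_F (m2 := mu)
      (fun z : TR * TR => f z * phi z.1 * phi z.2) _ _); last first.
      by move=> z; apply: mule_ge0; [apply: mule_ge0|]; rewrite ?f0 ?normal_pdf_EFin_ge0.
    apply: emeasurable_funM; [apply: emeasurable_funM|].
    + exact: mf.
    + exact: measurableT_comp mphi m1.
    + exact: measurableT_comp mphi m2.
  - exact: measurableT.
  apply: eq_integral => u _.
  rewrite -(@ge0_integral_affine _ c (s * u) (fun y => H (u, y))); first last.
  - by move=> ?; exact: H0.
  - exact: measurable_fun_pair2 mH.
  - exact: c0.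
  apply: (congr1 (fun z => c%:E * z)); apply: eq_integral => v _; rewrite /H /=.
  by have -> : (c^-1 * (c * v + s * u) + - (s / c) * u = v)%R by field.
exact: (EFin_mul_inj c0' (etrans E1 E2)).
Qed.

End NormalRotation.

Section Rotation.
Context {R : realType}.
Local Notation TR := (measurableTypeR R).
Local Notation N := (@normal_prob R 0 1).

(** The Givens rotation with cosine [c] and sine [s] in the plane of the coordinates [i] and [j]. *)
Definition rotate (I : finType) (i j : I) (c s : R) (x : I -> R) : I -> R :=
  fun k => if k == i then c * x i + s * x j
           else if k == j then - s * x i + c * x j else x k.

Local Open Scope ereal_scope.

Lemma normal_rotate_rect (c s : R) (A B : set TR) :
  (0 < c)%R -> (c ^+ 2 + s ^+ 2 = 1)%R -> measurable A -> measurable B ->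
  (N \x N) [set z | A (c * z.1 + s * z.2)%R /\ B (- s * z.1 + c * z.2)%R] = N A * N B.
Proof.
move=> c0 cs1 mA mB.
have m1 : measurable_fun [set: TR * TR] fst by exact: measurable_fst.
have m2 : measurable_fun [set: TR * TR] snd by exact: measurable_snd.
have mlin (a b : R) : measurable_fun [set: TR * TR] (fun z => (a * z.1 + b * z.2)%R : TR).
  by apply: measurable_funD; apply: measurable_funM => //; exact: measurable_cst.
pose rot (z : TR * TR) : TR * TR := (c * z.1 + s * z.2, - s * z.1 + c * z.2)%R.
have mrot : measurable_fun setT rot by exact: measurable_fun_pair (mlin _ _) (mlin _ _).
have mAB : measurable (A `*` B) by exact: measurableX.
set S := mkset _; have SE : S = rot @^-1` (A `*` B) by [].
have mS : measurable S by rewrite SE -[X in measurable X]setTI; exact: mrot.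
have m1AB : measurable_fun [set: TR * TR] (fun z => (\1_(A `*` B) z)%:E : \bar R).
  by apply/measurable_EFinP; exact: measurable_indic.
have m1S : measurable_fun [set: TR * TR] (fun z => (\1_S z)%:E : \bar R).
  by apply/measurable_EFinP; exact: measurable_indic.
have ind0 (C : set (TR * TR)) z : 0 <= (\1_C z)%:E :> \bar R by rewrite lee_fin.
have H := normal_rotate2 c0 cs1 m1AB (ind0 _).
have I1 := @fubini_tonelli2 _ _ _ _ R N N _ m1S (ind0 _).
have I2 := @fubini_tonelli2 _ _ _ _ R N N _ m1AB (ind0 _).
transitivity ((N \x N) (A `*` B)); last exact: product_measure1E.
transitivity (\int[N \x N]_z (\1_S z)%:E).
  by rewrite [RHS]integral_indic ?setIT; [|exact: measurableT|exact: mS].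
rewrite I1; transitivity (\int[N \x N]_z (\1_(A `*` B) z)%:E); last first.
  by rewrite [LHS]integral_indic ?setIT; [|exact: measurableT|exact: mAB].
rewrite I2 -[RHS]H; apply: eq_integral => y _; apply: eq_integral => x _.
by rewrite SE.
Qed.

Lemma iid_normal_id : iid_normal N (fun (_ : unit) (x : TR) => x).
Proof.
split=> [u|E mE]; first exact: measurable_id.
rewrite (big_pred1 tt) /=; last by case.
by congr (N _); apply/seteqP; split=> x /= Ex; [exact: Ex|case].
Qed.

(* As the law of [X] is unique, the two rotated coordinates may be realized on a
   separate product factor. *)
Lemma iid_normal_rotate d (T : measurableType d) (P : probability T R)
    (I : finType) (X : I -> T -> R) (i j : I) (c s : R) : i != j ->
  (0 < c)%R -> (c ^+ 2 + s ^+ 2 = 1)%R -> iid_normal P X ->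
  iid_normal P (fun k w => rotate i j c s (fun l => X l w) k).
Proof.
move=> ij c0 cs1 HX; have [mX PX] := HX.
have mrot d' (T' : measurableType d') (Y : I -> T' -> R) k :
    (forall k, measurable_fun setT (Y k)) ->
    measurable_fun setT (fun w => rotate i j c s (fun l => Y l w) k).
  move=> mY; rewrite /rotate; case: (k == i); last case: (k == j); last exact: mY;
  by apply: measurable_funD; apply: measurable_funM => //; exact: measurable_cst.
split=> [k|E mE]; first exact: mrot.
(* Coordinates [i] and [j] live on two separate copies of [N], all others on the original space. *)
pose f k : (unit + unit) + I :=
  if k == i then inl (inl tt) else if k == j then inl (inr tt) else inr k.
have f_inj : injective f.
  move=> k l; rewrite /f.
  by case: (k =P i) => [->|_]; last case: (k =P j) => [->|_];
    (case: (l =P i) => [->|_]; last case: (l =P j) => [->|_]) => // -[].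
pose A := [set x : coord_space R I | forall k, E k (rotate i j c s x k)].
have mA : measurable A.
  apply: (@measurable_forall I _ (coord_space R I) (fun k x => E k (rotate i j c s x k))) => k.
  rewrite -[X in measurable X]setTI.
  exact: (mrot _ _ (fun k (x : coord_space R I) => x k) k (@measurable_coord R I)).
have HZ := iid_normal_comp f_inj (iid_normal_prod (iid_normal_prod iid_normal_id iid_normal_id) HX).
rewrite [LHS](iid_normal_law HX HZ mA) /A.
(* Dropping the constraints at [i] and [j] turns the event into a rectangle: a planar event in the
   two separate copies times an event in [X]. *)
pose E' k := if (k == i) || (k == j) then setT else E k.
have mE' k : measurable (E' k) by rewrite /E'; case: ifP.
pose S := [set z : TR * TR | E i (c * z.1 + s * z.2)%R /\ E j (- s * z.1 + c * z.2)%R].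
have mS : measurable S.
  have mlin (a b : R) : measurable_fun [set: TR * TR] (fun z => (a * z.1 + b * z.2)%R : TR).
    have m1 : measurable_fun [set: TR * TR] fst by exact: measurable_fst.
    have m2 : measurable_fun [set: TR * TR] snd by exact: measurable_snd.
    by apply: measurable_funD; apply: measurable_funM => //; exact: measurable_cst.
  apply: measurableI; rewrite -[X in measurable X]setTI.
  - exact: (mlin c s measurableT _ (mE i)).
  - exact: (mlin (- s)%R c measurableT _ (mE j)).
have mSE' : measurable [set w | forall k, E' k (X k w)].
  apply: (measurable_forall (A := fun k w => E' k (X k w))) => k.
  by rewrite -[X in measurable X]setTI; exact: mX.
rewrite (_ : mkset _ = S `*` [set w | forall k, E' k (X k w)]); last first.
  apply/seteqP; split=> -[[x y] w] /=; rewrite /rotate /f /E' /S /=.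
    move=> H; have := H i; have := H j; rewrite !eqxx eq_sym (negbTE ij).
    move=> Hj Hi; split; first by split.
    move=> k; have := H k.
    by case: (altP (k =P i)) => [//|ki]; case: (altP (k =P j)).
  move=> [[Hi Hj] H] k; have := H k; rewrite !eqxx (eq_sym j) (negbTE ij).
  by case: (k =P i) => [->|_]; last case: (k =P j) => [->|_].
rewrite [LHS](@product_measure1E _ _ _ _ R (prod_prob N N) P S _ mS mSE').
transitivity ((N (E i) * N (E j)) * \prod_k N (E' k)).
  rewrite -(normal_rotate_rect c0 cs1 (mE i) (mE j)) -(PX _ mE').
  reflexivity.
rewrite (bigD1 i)//= (bigD1 j)//=; last by rewrite eq_sym.
rewrite [in RHS](bigD1 i)//= [in RHS](bigD1 j)/=; last by rewrite eq_sym.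
rewrite /E' !eqxx orbT /= !probability_setT !mul1e muleA; congr (_ * _).
by apply: eq_bigr => k /andP[/negbTE-> /negbTE->].
Qed.

Lemma normal_probN (A : set TR) : measurable A -> N (-%R @^-1` A) = N A.
Proof.
move=> mA.
have mN : measurable_fun setT (-%R : TR -> TR) by exact: oppr_measurable.
have m1A : measurable_fun [set: TR] (fun x => (\1_A x)%:E : \bar R).
  by apply/measurable_EFinP; exact: measurable_indic.
have mA' : measurable (-%R @^-1` A : set TR) by rewrite -[X in measurable X]setTI; exact: mN.
have mg : measurable_fun [set: TR] (fun x => (\1_A x)%:E * (normal_pdf 0 1 x)%:E : \bar R).
  by apply: emeasurable_funM => //; exact: measurable_normal_pdf_EFin.
have g0 x : 0 <= (\1_A x)%:E * (normal_pdf 0 1 x)%:E :> \bar R.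
  by apply: mule_ge0; rewrite lee_fin// normal_pdf_ge0.
have E (B : set TR) : measurable B ->
    N B = \int[lebesgue_measure]_x ((\1_B x)%:E * (normal_pdf 0 1 x)%:E).
  move=> mB; rewrite -integral_normal_prob.
  - by rewrite [RHS]integral_indic ?setIT; [|exact: measurableT|exact: mB].
  - by apply/measurable_EFinP; exact: measurable_indic.
  - by move=> x; rewrite lee_fin.
rewrite !E //.
have H := @ge0_integral_pushforward _ _ _ _ R _ mN lebesgue_measure setT _ measurableT mg (fun x _ => g0 x).
rewrite preimage_setT in H.
transitivity (\int[pushforward lebesgue_measure (-%R : TR -> TR)]_x ((\1_A x)%:E * (normal_pdf 0 1 x)%:E)).
  rewrite [RHS]H; apply: eq_integral => x _ /=; congr (_ * _).
  by rewrite !normal_pdfE ?oner_neq0// /normal_fun !subr0 sqrrN.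
by apply: eq_measure_integral => B mB _; exact: lebesgue_measureN.
Qed.

Lemma iid_normal_sign d (T : measurableType d) (P : probability T R)
    (I : finType) (X : I -> T -> R) (e : I -> bool) : iid_normal P X ->
  iid_normal P (fun k w => (-1) ^+ e k * X k w)%R.
Proof.
move=> [mX PX]; split=> [k|E mE].
  by apply: measurable_funM => //; exact: measurable_cst.
pose E' k := if e k then -%R @^-1` E k else E k.
have mE' k : measurable (E' k).
  rewrite /E'; case: (e k) => //; rewrite -[X in measurable X]setTI.
  exact: (@oppr_measurable R setT).
transitivity (P [set w | forall k, E' k (X k w)]).
  congr (P _); apply/seteqP; split=> w /= H k; have := H k;
  by rewrite /E'; case: (e k); rewrite ?expr1 ?expr0 ?mulN1r ?mul1r.
rewrite PX//; apply: eq_bigr => k _; rewrite /E'; case: (e k); last by [].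
exact: (normal_probN (mE k)).
Qed.

End Rotation.

(** * Reduction of a vector to one coordinate by Givens rotations *)

Section Givens.
Context {R : realType} {I : finType}.
Implicit Types (v : I -> R) (i j : I) (c s : R).

Lemma bigD2 i j (F : I -> R) : i != j ->
  \sum_k F k = F i + (F j + \sum_(k | (k != i) && (k != j)) F k).
Proof. by move=> ij; rewrite (bigD1 i)//= (bigD1 j)//= eq_sym. Qed.

(** The transpose of a rotation is the rotation by the opposite angle. *)
Lemma sum_rotate i j c s v (w : I -> R) : i != j ->
  \sum_k rotate i j c s v k * w k = \sum_k v k * rotate i j c (- s) w k.
Proof.
move=> ij; rewrite !(bigD2 _ ij) /rotate !eqxx (eq_sym j i) (negbTE ij) !addrA.
congr (_ + _); first by ring.
by apply: eq_bigr => k /andP[/negbTE-> /negbTE->].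
Qed.

Lemma rotateK i j c s v : i != j -> c ^+ 2 + s ^+ 2 = 1 ->
  rotate i j c (- s) (rotate i j c s v) = v.
Proof.
move=> ij cs1; apply/funext => k; rewrite /rotate !eqxx (eq_sym j i) (negbTE ij).
case: (k =P i) => [->|_]; first by rewrite -[RHS]mul1r -cs1; ring.
by case: (k =P j) => [->|//]; rewrite -[RHS]mul1r -cs1; ring.
Qed.

Lemma sum_rotate_sqr i j c s v : i != j -> c ^+ 2 + s ^+ 2 = 1 ->
  \sum_k rotate i j c s v k ^+ 2 = \sum_k v k ^+ 2.
Proof.
move=> ij cs1; under eq_bigr do rewrite expr2.
by rewrite sum_rotate// rotateK//; under eq_bigr do rewrite -expr2.
Qed.

(* When the pivot [v i0] vanishes, a rotation by [pi / 4] first makes it nonzero, so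
   rotations with positive cosine suffice. *)
Lemma givens_reduction (T : Type) (Phi : (I -> R) -> T) i0 :
  (forall i j c s v, i != j -> 0 < c -> c ^+ 2 + s ^+ 2 = 1 ->
     Phi (rotate i j c s v) = Phi v) ->
  forall v, exists2 t : R, t ^+ 2 = \sum_k v k ^+ 2 &
    Phi v = Phi (fun k => if k == i0 then t else 0).
Proof.
move=> PhiE v.
(* Induction on the number of nonzero entries off the pivot: each rotation clears one of them and
   keeps the pivot nonzero. *)
have main (n : nat) (w : I -> R) : (#|[pred k : I | (k != i0) && (w k != 0)%R]| <= n)%N -> w i0 != 0 ->
    exists2 t : R, t ^+ 2 = \sum_k w k ^+ 2 &
      Phi w = Phi (fun k => if k == i0 then t else 0).
  elim: n w => [|n IHn] w.
    rewrite leqn0 => /eqP/card0_eq w0 _.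
    have wk k : k != i0 -> w k = 0.
      by move=> ki; have := w0 k; rewrite !inE ki /= => /negbFE/eqP.
    exists (w i0).
      by rewrite (bigD1 i0)//= big1 ?addr0// => k /wk ->; rewrite expr0n.
    by congr Phi; apply/funext => k; case: (altP (k =P i0)) => [->//|/wk].
  move=> wn w0.
  case: (pickP [pred k | (k != i0) && (w k != 0)]) => [j /andP[ji wj]|E]; last first.
    by apply: IHn => //; rewrite (eq_card0 E).
  (* The angle of tangent [q]: the new [j]-th entry is [- q c w i0 + c w j = 0]. *)
  pose q := w j / w i0; pose c := (Num.sqrt (1 + q ^+ 2))^-1.
  have q1 : 0 < 1 + q ^+ 2 by rewrite ltr_wpDr ?sqr_ge0.
  have c0 : 0 < c by rewrite invr_gt0 sqrtr_gt0.
  have c2 : c ^+ 2 * (1 + q ^+ 2) = 1.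
    by rewrite exprVn sqr_sqrtr ?ltW// mulVf ?gt_eqF.
  have cs1 : c ^+ 2 + (q * c) ^+ 2 = 1 by rewrite -[RHS]c2; ring.
  have ij : i0 != j by rewrite eq_sym.
  rewrite -(PhiE i0 j c (q * c) w)// -(sum_rotate_sqr w ij cs1).
  have wi : rotate i0 j c (q * c) w i0 = c * w i0 * (1 + q ^+ 2).
    by rewrite /rotate eqxx /q; field.
  have wjE : rotate i0 j c (q * c) w j = 0.
    by rewrite /rotate (negbTE ji) eqxx /q; field.
  apply: IHn; last by rewrite wi !mulf_neq0// gt_eqF.
  rewrite -ltnS; apply: leq_trans wn; apply: proper_card; apply/properP; split.
    apply/fintype.subsetP => k; rewrite !inE => /andP[ki]; rewrite ki /=.
    case: (altP (k =P j)) => [->|kj]; first by rewrite wjE eqxx.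
    by rewrite /rotate (negbTE ki) (negbTE kj).
  by exists j; rewrite !inE ji //= wjE eqxx.
have [v0|v0] := eqVneq (v i0) 0; last exact: (main _ v (leqnn _)).
case: (pickP (fun k => (k != i0) && (v k != 0))) => [j /andP[ji vj]|v'].
  pose c : R := (Num.sqrt 2)^-1.
  have c2 : c ^+ 2 = 2^-1 by rewrite exprVn sqr_sqrtr.
  have c0 : 0 < c by rewrite invr_gt0 sqrtr_gt0.
  have cs1 : c ^+ 2 + c ^+ 2 = 1 by rewrite c2; lra.
  have ij : i0 != j by rewrite eq_sym.
  rewrite -(PhiE i0 j c c v)// -(sum_rotate_sqr v ij cs1).
  apply: (main _ _ (leqnn _)).
  by rewrite /rotate eqxx v0 mulr0 add0r mulf_neq0// gt_eqF.
have {}v' k : v k = 0.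
  have [->//|ki] := eqVneq k i0.
  by have := v' k; rewrite ki /= => /negbFE/eqP.
exists 0; first by rewrite big1 ?expr0n// => k _; rewrite v' expr0n.
by congr Phi; apply/funext => k; rewrite v'; case: ifP.
Qed.

Local Open Scope ereal_scope.

Lemma measurable_coord_dot v :
  measurable_fun setT (fun x : coord_space R I => \sum_k v k * x k)%R.
Proof.
apply: measurable_sum => k; apply: measurable_funM; first exact: measurable_cst.
exact: measurable_coord.
Qed.

(** Rotating [v] is the same as rotating [X] backwards, which keeps its law; so the integral is
    rotation invariant in [v], and [v] may be concentrated on the coordinate [i0]. *)
Lemma iid_normal_dot d (T : measurableType d) (P : probability T R)
    (X : I -> T -> R) (i0 : I) v (psi : R -> \bar R) :
  iid_normal P X -> measurable_fun setT psi -> (forall x, 0 <= psi x) ->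
  exists2 t : R, (t ^+ 2 = \sum_k v k ^+ 2)%R &
    \int[P]_w psi (\sum_k v k * X k w)%R = \int[normal_prob 0 1]_x psi (t * x)%R.
Proof.
move=> HX mpsi psi0.
pose F u (x : coord_space R I) := psi (\sum_k u k * x k)%R.
have mF u : measurable_fun setT (F u) by apply: measurableT_comp (measurable_coord_dot u).
pose Phi u := \int[P]_w F u (fun k => X k w).
have PhiE i j c s u : i != j -> (0 < c)%R -> (c ^+ 2 + s ^+ 2 = 1)%R ->
    Phi (rotate i j c s u) = Phi u.
  move=> ij c0 cs1.
  have cs1' : (c ^+ 2 + (- s) ^+ 2 = 1)%R by rewrite sqrrN.
  rewrite /Phi.
  rewrite [RHS](iid_normal_transfer HX (iid_normal_rotate ij c0 cs1' HX) (mF u)); last first.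
    by move=> x; exact: psi0.
  by apply: eq_integral => w _; rewrite /F sum_rotate.
have [t tE Phit] := givens_reduction i0 PhiE v.
exists t => //; rewrite -/(Phi v) Phit.
pose G (x : coord_space R unit) := psi (t * x tt)%R.
have mG : measurable_fun setT G.
  apply: (measurableT_comp mpsi); apply: measurable_funM; first exact: measurable_cst.
  exact: measurable_coord.
have H1 := iid_normal_comp (f := fun _ : unit => i0) _ HX.
have inj1 : injective (fun _ : unit => i0) by do 2 case.
rewrite -[RHS](iid_normal_transfer (H1 inj1) (@iid_normal_id R) mG); last first.
  by move=> x; exact: psi0.
apply: eq_integral => w _; rewrite /F /G; congr psi.
rewrite (bigD1 i0)//= eqxx big1 ?addr0// => k /negbTE ->.
by rewrite mul0r.
Qed.

End Givens.

(** * Gaussian matrices *)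

Section MatrixMeasurability.
Context {R : realType} {d : measure_display} {T : measurableType d}.

Lemma measurable_det n (A : T -> 'M[R]_n) :
  (forall i j, measurable_fun setT (fun w => A w i j)) ->
  measurable_fun setT (fun w => \det (A w)).
Proof.
move=> mA; apply: measurable_sum => s; apply: measurable_funM => //.
by apply: measurable_prod => i _; exact: mA.
Qed.

Lemma measurable_l2norm n (h : T -> 'cV[R]_n) :
  (forall i, measurable_fun setT (fun w => h w i 0)) ->
  measurable_fun setT (fun w => l2norm (h w)).
Proof.
move=> mh; apply: (measurableT_comp (f := @Num.sqrt R)).
  by apply: continuous_measurable_fun => x; exact: sqrt_continuous.
by apply: measurable_sum => i; apply: measurable_funX; exact: mh.
Qed.

Lemma measurable_inv_ge0 (f : T -> R) : measurable_fun setT f -> (forall x, 0 <= f x) ->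
  measurable_fun setT (fun x => (f x)^-1).
Proof.
move=> mf f0; under eq_fun do rewrite -powR_inv1//.
by apply: (measurableT_comp (f := fun x : R => x `^ (-1))) => //; exact: measurable_powR.
Qed.

End MatrixMeasurability.

Lemma l2norm_ge0 (R : realType) n (h : 'cV[R]_n) : 0 <= l2norm h.
Proof. exact: sqrtr_ge0. Qed.

Lemma l2norm_sqr (R : realType) n (h : 'cV[R]_n) : l2norm h ^+ 2 = \sum_i h i 0 ^+ 2.
Proof. by rewrite sqr_sqrtr// sumr_ge0// => i _; rewrite sqr_ge0. Qed.

Lemma l2normZ (R : realType) n (a : R) (h : 'cV[R]_n) : l2norm (a *: h) = `|a| * l2norm h.
Proof.
rewrite /l2norm; under eq_bigr do rewrite mxE exprMn.
by rewrite -mulr_sumr sqrtrM ?sqr_ge0// sqrtr_sqr.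
Qed.

(* [S^-1 h] has this norm when [S] is invertible, and the value is [0] otherwise. *)
Definition solve_norm (R : realType) n (S : 'M[R]_n) (h : 'cV[R]_n) : R :=
  l2norm (\adj S *m h) / `|\det S|.

Section SolveNorm.
Context {R : realType}.

Lemma solve_norm_unit n (S : 'M[R]_n) h : S \in unitmx ->
  solve_norm S h = l2norm (invmx S *m h).
Proof. by move=> uS; rewrite /invmx uS -scalemxAl l2normZ normrV// mulrC. Qed.

Lemma measurable_solve_norm d (T : measurableType d) n
    (S : T -> 'M[R]_n) (h : T -> 'cV[R]_n) :
  (forall i j, measurable_fun setT (fun w => S w i j)) ->
  (forall i, measurable_fun setT (fun w => h w i 0)) ->
  measurable_fun setT (fun w => solve_norm (S w) (h w)).
Proof.
move=> mS mh; apply: measurable_funM.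
  apply: measurable_l2norm => i; under eq_fun do rewrite mxE.
  apply: measurable_sum => j; apply: measurable_funM; last exact: mh.
  under eq_fun do rewrite mxE.
  apply: measurable_funM => //; apply: measurable_det => a b.
  by under eq_fun do rewrite !mxE; exact: mS.
apply: measurable_inv_ge0 => // .
by apply: (measurableT_comp (@normr_measurable R setT)) => //; exact: measurable_det.
Qed.

(** For invertible [S] this is [(G S)^-1 (G h) = S^-1 h]; for singular [S] both sides take the
    default value [0]. *)
Lemma solve_norm_mulmx n (G S : 'M[R]_n) h : G \in unitmx ->
  solve_norm (G *m S) (G *m h) = solve_norm S h.
Proof.
move=> uG; have dG : \det G != 0 by move: uG; rewrite unitmxE unitfE.
have [uS|nuS] := boolP (S \in unitmx).
  have uGS : G *m S \in unitmx by rewrite unitmx_mul uG.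
  rewrite !solve_norm_unit//; congr l2norm; apply: (can_inj (mulKmx uGS)).
  by rewrite mulKVmx// -mulmxA mulKVmx.
have S0 : \det S = 0 by apply/eqP; move: nuS; rewrite unitmxE unitfE negbK.
by rewrite /solve_norm det_mulmx S0 mulr0 normr0 invr0 !mulr0.
Qed.

End SolveNorm.

Section MatrixRotation.
Context {R : realType}.

Definition givens_mx n (i j : 'I_n) (c s : R) : 'M[R]_n :=
  \matrix_(a, l) rotate i j c s (fun k => (k == l)%:R) a.

Lemma mulmx_givens n p (i j : 'I_n) (c s : R) (S : 'M[R]_(n, p)) a b :
  (givens_mx i j c s *m S) a b = rotate i j c s (fun l => S l b) a.
Proof.
rewrite mxE; under eq_bigr do rewrite mxE.
have E k : \sum_l (k == l)%:R * S l b = S k b.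
  rewrite (bigD1 k)//= eqxx mul1r big1 ?addr0// => l /negbTE.
  by rewrite eq_sym => ->; rewrite mul0r.
rewrite /rotate; case: ifP => _.
  by under eq_bigr do rewrite mulrDl -!mulrA; rewrite big_split /= -!mulr_sumr !E.
case: ifP => _; last exact: E.
by under eq_bigr do rewrite mulrDl -!mulrA; rewrite big_split /= -!mulr_sumr !E.
Qed.

Lemma givens_mx_unit n (i j : 'I_n) (c s : R) : i != j -> c ^+ 2 + s ^+ 2 = 1 ->
  givens_mx i j c s \in unitmx.
Proof.
move=> ij cs1.
have : givens_mx i j c (- s) *m givens_mx i j c s = 1%:M.
  apply/matrixP => a b; rewrite mulmx_givens mxE.
  transitivity (rotate i j c (- s) (rotate i j c s (fun k => (k == b)%:R)) a).
    by congr rotate; apply/funext => l; rewrite mxE.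
  by rewrite rotateK.
by move=> /mulmx1_unit[].
Qed.

(** A rotation of two rows is a product of rotations of two entries, one for each column; the
    induction runs over the columns already treated. *)
Lemma iid_normal_rotate_rows d (T : measurableType d) (P : probability T R)
    (I J : finType) (X : I * J -> T -> R) (i j : I) (c s : R) : i != j ->
  0 < c -> c ^+ 2 + s ^+ 2 = 1 -> iid_normal P X ->
  iid_normal P (fun k w => rotate i j c s (fun l => X (l, k.2) w) k.1).
Proof.
move=> ij c0 cs1 HX.
have main (bs : seq J) : uniq bs -> iid_normal P (fun k w =>
    if k.2 \in bs then rotate i j c s (fun l => X (l, k.2) w) k.1 else X k w).
  elim: bs => [_|b bs IH /= /andP[bNbs ubs]].
    by rewrite (_ : (fun k w => _) = X)//.
  have H := @iid_normal_rotate R _ _ P _ _ (i, b) (j, b) c s _ c0 cs1 (IH ubs).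
  have ijb : (i, b) != (j, b) by rewrite xpair_eqE eqxx andbT.
  rewrite [X in iid_normal P X](_ : _ = (fun k w => rotate (i, b) (j, b) c s
    (fun l => if l.2 \in bs then rotate i j c s (fun a => X (a, l.2) w) l.1 else X l w) k)).
    exact: H.
  apply/funext => -[a b']; apply/funext => w; rewrite /rotate /= !xpair_eqE inE.
  have [->|_] /= := eqVneq b' b; last by rewrite !andbF.
  by rewrite !andbT (negbTE bNbs).
rewrite [X in iid_normal P X](_ : _ = (fun k w =>
  if k.2 \in enum J then rotate i j c s (fun l => X (l, k.2) w) k.1 else X k w)).
  exact/main/enum_uniq.
by apply/funext => k; apply/funext => w; rewrite mem_enum.
Qed.

End MatrixRotation.

Section Resampling.
Context {R : realType}.
Context {d : measure_display} {T : measurableType d}.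
Variable P : probability T R.
Local Open Scope ereal_scope.

(** This plays the role of conditioning on the coordinates outside [A]: the family is realized on a
    product, those in [A] coming from the second factor, and Tonelli integrates the latter first. *)
Lemma integral_resample (I : finType) (X : I -> T -> R) (A : pred I)
    (g : coord_space R I -> \bar R) : iid_normal P X ->
  measurable_fun setT g -> (forall x, 0 <= g x) ->
  \int[P]_w g (fun k => X k w) =
  \int[P]_w \int[P]_w' g (fun k => if A k then X k w' else X k w).
Proof.
move=> HX mg g0; have [mX _] := HX.
pose f k : I + I := if A k then inr k else inl k.
have f_inj : injective f.
  by move=> k l; rewrite /f; case: (A k); case: (A l) => // -[].
have HZ := iid_normal_comp f_inj (iid_normal_prod HX HX).
have [mZ _] := HZ.
rewrite (iid_normal_transfer HX HZ mg g0).
have mgZ := measurableT_comp mg (measurable_family mZ).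
transitivity (\int[prod_prob P P]_w g (fun k => if A k then X k w.2 else X k w.1)).
  by apply: eq_integral => w _; congr g; apply/funext => k; rewrite /f; case: (A k).
refine (@fubini_tonelli1 _ _ _ _ R P P _ _ _).
  move: mgZ; congr measurable_fun; apply/funext => w /=; congr g.
  by apply/funext => k; rewrite /f; case: (A k).
by move=> x; exact: g0.
Qed.

Lemma le_integral_cst_prob (f : T -> \bar R) (c : \bar R) :
  measurable_fun setT f -> (forall w, 0 <= f w) -> (forall w, f w <= c) ->
  \int[P]_w f w <= c.
Proof.
move=> mf f0 fc; apply: (@le_trans _ _ (\int[P]_w cst c w)).
  exact: ge0_le_integral.
rewrite integral_cst//.
by have -> : c * P setT = c by rewrite probability_setT mule1.
Qed.

End Resampling.

Section GaussianMatrix.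
Context {R : realType}.

Definition mx_of m n (x : 'I_m * 'I_n -> R) : 'M[R]_(m, n) := \matrix_(i, j) x (i, j).

Lemma cofactor_eq n (S S' : 'M[R]_n.+1) j :
  (forall i k, i != ord0 -> S i k = S' i k) -> cofactor S 0 j = cofactor S' 0 j.
Proof.
move=> SS'; congr (_ * \det _); apply/matrixP => a b; rewrite !mxE.
by apply: SS'; rewrite eq_sym neq_lift.
Qed.

(** The first column of the adjugate consists of the cofactors of the first row, along which the
    determinant is expanded as well. *)
Lemma solve_norm_delta n (S : 'M[R]_n.+1) (t : R) :
  solve_norm S (\col_i (if i == ord0 then t else 0)) =
  `|t| * l2norm (\col_j cofactor S 0 j) / `|\sum_j cofactor S 0 j * S 0 j|.
Proof.
rewrite /solve_norm (expand_det_row _ 0); under [in X in _ / X = _]eq_bigr do rewrite mulrC.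
rewrite -l2normZ; congr (_ / _); congr l2norm; apply/matrixP => i k; rewrite ord1 !mxE.
rewrite (bigD1 ord0)//= big1 ?addr0 => [|j /negbTE j0]; last by rewrite !mxE j0 mulr0.
by rewrite !mxE eqxx mulrC.
Qed.

Context {d : measure_display} {T : measurableType d}.
Variable P : probability T R.
Local Open Scope ereal_scope.

Lemma measurable_mx_of m n (i : 'I_m) (j : 'I_n) :
  measurable_fun setT (fun x : coord_space R ('I_m * 'I_n)%type => mx_of x i j).
Proof.
rewrite (_ : (fun x : coord_space _ _ => mx_of x i j) = (fun x => x (i, j))).
  exact: measurable_coord.
by apply/funext => x; rewrite mxE.
Qed.

(* After rotating [h] to [t e_0], [|S^-1 h| = |t| |u| / |u . S_0|] where the cofactor
   vector [u] does not depend on the first row [S_0], which is resampled. *)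
Lemma integral_solve_norm_le n (X : 'I_n.+1 * 'I_n.+1 -> T -> R) (h : 'cV[R]_n.+1)
    (psi : R -> \bar R) : iid_normal P X ->
  measurable_fun setT psi -> (forall x, 0 <= psi x) -> psi 0%R = 0 ->
  \int[P]_w psi (solve_norm (mx_of (fun k => X k w)) h) <=
  \int[normal_prob 0 1]_x psi (l2norm h / `|x|)%R.
Proof.
move=> HX mpsi psi0 psi00.
pose F (g : 'I_n.+1 -> R) (x : coord_space R ('I_n.+1 * 'I_n.+1)%type) :=
  psi (solve_norm (mx_of x) (\col_i g i)).
have mF g : measurable_fun setT (F g).
  apply: (measurableT_comp mpsi); apply: measurable_solve_norm => [i j|i].
    exact: measurable_mx_of.
  rewrite (_ : (fun w : coord_space _ _ => _) = cst (g i)); first exact: measurable_cst.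
  by apply/funext => x; rewrite mxE.
have F0 g x : 0 <= F g x by exact: psi0.
pose Phi g := \int[P]_w F g (fun k => X k w).
(* The matrix is replaced by its row-rotated version, which has the same law; the rotation [G] then
   cancels in [(G S)^-1 (G h)]. *)
have PhiE i j c s g : i != j -> (0 < c)%R -> (c ^+ 2 + s ^+ 2 = 1)%R ->
    Phi (rotate i j c s g) = Phi g.
  move=> ij c0 cs1; rewrite /Phi.
  rewrite (iid_normal_transfer HX (iid_normal_rotate_rows ij c0 cs1 HX) (mF _)); last exact: F0.
  apply: eq_integral => w _; rewrite /F; congr psi.
  rewrite -[RHS](solve_norm_mulmx (G := givens_mx i j c s)); last exact: givens_mx_unit.
  congr solve_norm; apply/matrixP => a b; rewrite mulmx_givens !mxE; congr rotate;
  by apply/funext => k; rewrite !mxE.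
have [t tE Phit] := givens_reduction ord0 PhiE (fun i => h i 0%R).
have absE (r r' : R) : (r ^+ 2 = r' ^+ 2 -> 0 <= r' -> `|r| = r')%R.
  by move=> /(congr1 Num.sqrt); rewrite !sqrtr_sqr => -> /ger0_norm.
have {}tE : (`|t| = l2norm h)%R by apply: absE; rewrite ?l2norm_ge0// l2norm_sqr.
rewrite [leLHS](_ : _ = Phi (fun i => h i 0%R)); last first.
  apply: eq_integral => w _; rewrite /F; congr (psi (solve_norm _ _)).
  by apply/matrixP => i j; rewrite ord1 !mxE.
pose gt (k : 'I_n.+1) := if k == ord0 then t else 0%R.
rewrite Phit -tE -[X in Phi X]/gt /Phi.
rewrite (integral_resample (fun k => k.1 == ord0) HX (mF gt) (F0 gt)).
pose u w : 'cV[R]_n.+1 := \col_j cofactor (mx_of (fun k => X k w)) ord0 j.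
have inner w : \int[P]_w' F gt (fun k => if k.1 == ord0 then X k w' else X k w) <=
    \int[normal_prob 0 1]_x psi (`|t| / `|x|)%R.
  pose psi' (y : R) := psi (`|t| * l2norm (u w) / `|y|)%R.
  have mpsi' : measurable_fun setT psi'.
    apply: (measurableT_comp mpsi); apply: measurable_funM; first exact: measurable_cst.
    by apply: measurable_inv_ge0 => //; exact: normr_measurable.
  have row_inj : injective (fun j : 'I_n.+1 => (ord0 : 'I_n.+1, j)) by move=> a b [].
  have [t' t'E H] := iid_normal_dot ord0 (fun j => u w j 0%R) (iid_normal_comp row_inj HX) mpsi'
    (fun _ => psi0 _).
  rewrite (_ : integral _ _ _ = \int[P]_w' psi' (\sum_k u w k 0%R * X (ord0, k) w')%R); last first.
    apply: eq_integral => w' _; rewrite /F /psi' solve_norm_delta.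
    rewrite (_ : (\col_j _) = u w); last first.
      apply/matrixP => j k; rewrite ord1 !mxE; apply: cofactor_eq => i l i0.
      by rewrite !mxE /= (negbTE i0).
    congr (psi (_ / `|_|)%R); apply: eq_bigr => j _; rewrite !mxE /=; congr (_ * _)%R.
    by apply: cofactor_eq => i l i0; rewrite !mxE /= (negbTE i0).
  rewrite H; have {}t'E : (`|t'| = l2norm (u w))%R by apply: absE; rewrite ?l2norm_ge0// l2norm_sqr.
  apply: ge0_le_integral => //.
  - by move=> x _; exact: psi0.
  - apply: (measurableT_comp mpsi'); apply: measurable_funM => //; exact: measurable_cst.
  - apply: (measurableT_comp mpsi); apply: measurable_funM; first exact: measurable_cst.
    by apply: measurable_inv_ge0 => //; exact: normr_measurable.
  - move=> x _; rewrite /psi' -t'E.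
    (* If the cofactor vector vanishes, the argument of [psi] is [0] and [psi 0 = 0] settles the
       case; otherwise [|u|] cancels. *)
    have [->|t'0] := eqVneq t' 0%R.
      by rewrite normr0 mulr0 mul0r psi00 psi0.
    by rewrite normrM invfM mulrA mulfK ?normr_eq0.
apply: le_integral_cst_prob => //; last first.
  by move=> w; apply: integral_ge0 => w' _; exact: F0.
(* The inner integral is measurable as a partial integral of a jointly measurable function, obtained
   by realizing both copies on the product space. *)
pose f k : ('I_n.+1 * 'I_n.+1) + ('I_n.+1 * 'I_n.+1) := if k.1 == ord0 then inr k else inl k.
have f_inj : injective f.
  by move=> k l; rewrite /f; case: (k.1 == _); case: (l.1 == _) => // -[].
have [mZ _] := iid_normal_comp f_inj (iid_normal_prod HX HX).
have mgZ := measurableT_comp (mF gt) (measurable_family mZ).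
apply: (measurable_fun_fubini_tonelli_F (m2 := P)
  (fun w => F gt (fun k => if k.1 == ord0 then X k w.2 else X k w.1))) => //.
move: mgZ; congr measurable_fun; apply/funext => w /=; congr (F gt).
by apply/funext => k; rewrite /f; case: ifP.
Qed.

End GaussianMatrix.

Section GaussianDeterminant.
Context {R : realType} {d : measure_display} {T : measurableType d}.
Variable P : probability T R.
Local Open Scope ereal_scope.

Lemma normal_prob_set1 (x : R) : normal_prob 0 1 [set x] = 0 :> \bar R.
Proof. exact: (@integral_Sset1 _ _ _ x). Qed.

Lemma integral_eq0_indic d' (T' : measurableType d') (Q : probability T' R) (f : T' -> R) :
  measurable_fun setT f ->
  \int[Q]_w (\1_[set 0%R] (f w))%:E = Q [set w | f w = 0%R].
Proof.
move=> mf.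
have mS : measurable (f @^-1` [set 0%R]) by rewrite -[X in measurable X]setTI; exact: mf.
transitivity (\int[Q]_w (\1_(f @^-1` [set 0%R]) w)%:E).
  by apply: eq_integral => w _.
by rewrite integral_indic ?setIT.
Qed.

(** By induction on the size, the first cofactor of the first row is almost surely nonzero. With the
    other rows fixed, the determinant is then a nonzero linear form in the Gaussian first row, and a
    nonzero multiple of a standard normal vanishes with probability [0]. *)
Lemma iid_normal_det n (X : 'I_n * 'I_n -> T -> R) : iid_normal P X ->
  P [set w | \det (mx_of (fun k => X k w)) = 0%R] = 0.
Proof.
elim: n X => [|n IHn] X HX.
  rewrite (_ : mkset _ = set0) ?measure0//; apply/seteqP; split=> // w /=.
  by rewrite det_mx00 => /eqP; rewrite oner_eq0.
pose g (x : coord_space R ('I_n.+1 * 'I_n.+1)%type) : \bar R :=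
  (\1_[set 0%R] (\det (mx_of x)))%:E.
have mdet : measurable_fun setT
    (fun x : coord_space R ('I_n.+1 * 'I_n.+1)%type => \det (mx_of x)).
  by apply: measurable_det => i j; exact: measurable_mx_of.
have mg : measurable_fun setT g.
  apply/measurable_EFinP; apply: (measurableT_comp _ mdet).
  exact: measurable_indic.
have g0 x : 0 <= g x by rewrite lee_fin.
have [mX _] := HX.
rewrite -(integral_eq0_indic P (measurableT_comp mdet (measurable_family mX))).
have -> := integral_resample (fun k => k.1 == ord0) HX mg g0.
have lift2_inj : injective
    (fun k : 'I_n * 'I_n => (lift ord0 k.1, lift ord0 k.2) : 'I_n.+1 * 'I_n.+1).
  move=> [i j] [i' j'] /= E.
  have /lift_inj -> : lift ord0 i = lift ord0 i' by exact: (congr1 fst E).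
  by have /lift_inj -> : lift ord0 j = lift ord0 j' by exact: (congr1 snd E).
have HX' := iid_normal_comp lift2_inj HX.
have [mX' _] := HX'.
pose u w : 'cV[R]_n.+1 := \col_j cofactor (mx_of (fun k => X k w)) ord0 j.
have u0E w : u w ord0 0%R = \det (mx_of (fun k => X (lift ord0 k.1, lift ord0 k.2) w)).
  rewrite mxE /cofactor addn0 expr0 mul1r; congr (\det _).
  by apply/matrixP => i j; rewrite !mxE.
have inner w : \int[P]_w' g (fun k => if k.1 == ord0 then X k w' else X k w) <=
    (\1_[set 0%R] (u w ord0 0%R))%:E.
  rewrite indicE; case: (boolP (_ \in _)) => [_|/negP u0].
    apply: le_integral_cst_prob => //; last first.
      by move=> w'; rewrite lee_fin indicE; case: (_ \in _).
    apply: (measurableT_comp mg); apply: measurable_family => k.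
    by case: (k.1 == _) => //; exact: measurable_cst.
  pose psi (y : R) : \bar R := (\1_[set 0%R] y)%:E.
  have mpsi : measurable_fun setT psi by apply/measurable_EFinP; exact: measurable_indic.
  have psi0 y : 0 <= psi y by rewrite lee_fin.
  have row_inj : injective (fun j : 'I_n.+1 => (ord0 : 'I_n.+1, j)) by move=> a b [].
  have [t tE H] := iid_normal_dot ord0 (fun j => u w j 0%R) (iid_normal_comp row_inj HX) mpsi psi0.
  rewrite (_ : integral _ _ _ = \int[P]_w' psi (\sum_k u w k 0%R * X (ord0, k) w')%R); last first.
    apply: eq_integral => w' _; rewrite /g /psi (expand_det_row _ ord0).
    congr (\1_[set 0%R] _)%:E; apply: eq_bigr => j _; rewrite !mxE /= mulrC; congr (_ * _)%R.
    by apply: cofactor_eq => i l i0; rewrite !mxE /= (negbTE i0).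
  have t0 : t != 0%R.
    apply/eqP => t0; apply: u0; rewrite inE /=; apply/eqP.
    rewrite -sqrf_eq0 eq_le sqr_ge0 andbT.
    have -> : 0%R = (\sum_k u w k 0%R ^+ 2)%R by rewrite -tE t0 expr0n.
    by rewrite (bigD1 ord0)//= lerDl sumr_ge0// => i _; rewrite sqr_ge0.
  rewrite H (_ : integral _ _ _ = normal_prob 0 1 [set 0%R])//.
    by rewrite normal_prob_set1.
  rewrite (integral_eq0_indic (normal_prob 0 1) (f := fun x => t * x)%R); last first.
    by apply: measurable_funM => //; exact: measurable_cst.
  congr (normal_prob 0 1 _); apply/seteqP; split=> x /= H'; last by rewrite H' mulr0.
  by apply/eqP; move/eqP: H'; rewrite mulf_eq0 (negbTE t0).
have mu0 : measurable_fun setT (fun w => u w ord0 0%R).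
  rewrite (_ : (fun w => _) = fun w => \det (mx_of (fun k => X (lift ord0 k.1, lift ord0 k.2) w))).
    apply: measurable_det => i j; rewrite (_ : (fun w => _) = X (lift ord0 i, lift ord0 j)).
      exact: mX.
    by apply/funext => w; rewrite mxE.
  by apply/funext => w; exact: u0E.
apply/eqP; rewrite eq_le; apply/andP; split; last first.
  by apply: integral_ge0 => w _; apply: integral_ge0 => w' _; exact: g0.
apply: (@le_trans _ _ (\int[P]_w (\1_[set 0%R] (u w ord0 0%R))%:E)).
  apply: ge0_le_integral => //.
  - by move=> w _; apply: integral_ge0 => w' _; exact: g0.
  - pose f k : ('I_n.+1 * 'I_n.+1) + ('I_n.+1 * 'I_n.+1) := if k.1 == ord0 then inr k else inl k.
    have f_inj : injective f.
      by move=> k l; rewrite /f; case: (k.1 == _); case: (l.1 == _) => // -[].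
    have [mZ _] := iid_normal_comp f_inj (iid_normal_prod HX HX).
    have mgZ := measurableT_comp mg (measurable_family mZ).
    apply: (measurable_fun_fubini_tonelli_F (m2 := P)
      (fun w => g (fun k => if k.1 == ord0 then X k w.2 else X k w.1))) => //.
    move: mgZ; congr measurable_fun; apply/funext => w /=; congr g.
    by apply/funext => k; rewrite /f; case: ifP.
  - apply/measurable_EFinP; apply: (measurableT_comp _ mu0); exact: measurable_indic.
rewrite (integral_eq0_indic P mu0) le_eqVlt; apply/orP; left; apply/eqP.
rewrite -[RHS](IHn _ HX'); congr (P _).
by apply/funext => w /=; rewrite u0E.
Qed.

End GaussianDeterminant.

(** * Moments of the normal distribution *)

Section Numerics.
Context {R : realType}.
Implicit Types x y : R.

Lemma is_derive_ge0_homo (f f' : R -> R) : (forall x, is_derive x 1 f (f' x)) ->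
  (forall x, 0 <= f' x) -> {homo f : x y / x <= y}.
Proof.
move=> df f'0 x y xy.
apply: (@ger0_derive1_le_cc R f x y) => //; rewrite ?in_itv/= ?lexx ?xy//.
- by move=> z _; rewrite derive1E; have [_ ->] := df z.
- apply: continuous_subspaceT => z; apply: differentiable_continuous.
  by apply/derivable1_diffP; have [] := df z.
Qed.

Lemma sin_le_id x : 0 <= x -> sin x <= x.
Proof.
move=> x0; rewrite -subr_ge0.
have -> : 0 = (id \- sin) 0 :> R by rewrite /= sin0 subr0.
by apply: (@is_derive_ge0_homo (id \- sin) (fun x => 1 - cos x)) => // z; rewrite subr_ge0 cos_le1.
Qed.

(** With [s = sin (pi / 6)], the triple angle formula for [sin (pi / 2) = 1] reads
    [(s + 1) (2 s - 1)^2 = 0]. So [s = 1/2], and [sin t <= t] gives the bound. *)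
Lemma pi_ge3 : 3 <= pi :> R.
Proof.
pose t : R := pi / 6; pose s := sin t.
have pi0 := pi_gt0 R.
have t0 : 0 < t by rewrite divr_gt0.
have s0 : 0 < s by apply: sin_gt0_pihalf; rewrite t0 /= /t; lra.
have cs := cos2Dsin2 t.
have : sin (t + (t + t)) = 1.
  by rewrite -(sin_pihalf R); congr sin; rewrite /t; field.
rewrite sinD sinD cosD -/s => E.
have {E} : (s + 1) * (2 * s - 1) ^+ 2 = 0.
  have c2 : s * cos t ^+ 2 = s * (1 - s ^+ 2) by rewrite -cs addrK.
  lra.
move=> /eqP; rewrite mulf_eq0 expf_eq0 /= subr_eq0 => /orP[|/eqP s2].
  by rewrite gt_eqF// addr_gt0.
have := sin_le_id (ltW t0); rewrite -/s /t; lra.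
Qed.

(** [exp (- 1/6) >= 5/6], hence [e <= (6/5)^6 <= 3]. *)
Lemma ln3_ge1 : 1 <= ln 3 :> R.
Proof.
rewrite -ler_expR lnK ?posrE//.
have := expR_ge1Dx (- 6^-1 : R); rewrite expRN => H.
have e0 := expR_gt0 (6^-1 : R).
have {H} H : expR 6^-1 <= 6 / 5 :> R.
  have := ler_wpM2l (ltW e0) H; rewrite divff ?gt_eqF//; lra.
have -> : 1 = 6%:R * 6^-1 :> R by rewrite divff.
rewrite expRM_natl; apply: (@le_trans _ _ ((6 / 5) ^+ 6)).
  by rewrite lerXn2r ?nnegrE// ltW.
by rewrite expr_div_n ler_pdivrMr; lra.
Qed.

(** The square of [exp (y/2) - exp (- y/2) >= y], for [y >= 0]. *)
Lemma expR_cosh_ge y : 2 + y ^+ 2 <= expR y + expR (- y).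
Proof.
wlog y0 : y / 0 <= y.
  move=> H; have [/H//|/ltW y0] := leP 0 y.
  by have := H (- y); rewrite oppr_ge0 => /(_ y0); rewrite sqrrN opprK [expR (- y) + _]addrC.
pose f u : R := expR u - expR (- u) - 2 * u.
have fge0 u : 0 <= u -> 0 <= f u.
  move=> u0; have -> : 0 = f 0 by rewrite /f oppr0 subrr mulr0 subrr.
  apply: (@is_derive_ge0_homo f (fun u => expR u + expR (- u) - 2)) => // z.
    by rewrite /f; apply: is_derive_eq; rewrite ?scaler1 ?scale0r; lra.
  have := sqr_ge0 (expR (z / 2) - expR (- (z / 2))).
  have -> : expR z = expR (z / 2) ^+ 2 by rewrite -expRM_natl; congr expR; lra.
  have -> : expR (- z) = expR (- (z / 2)) ^+ 2 by rewrite -expRM_natl; congr expR; lra.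
  have := expRxMexpNx_1 (z / 2); nra.
have := fge0 (y / 2); rewrite divr_ge0// => /(_ isT); rewrite /f => H.
have -> : expR y = expR (y / 2) ^+ 2 by rewrite -expRM_natl; congr expR; lra.
have -> : expR (- y) = expR (- (y / 2)) ^+ 2 by rewrite -expRM_natl; congr expR; lra.
have := expRxMexpNx_1 (y / 2); nra.
Qed.

End Numerics.

Section NormalBounds.
Context {R : realType}.
Local Notation TR := (measurableTypeR R).
Local Notation N := (@normal_prob R 0 1).
Local Notation beta := (@normal_peak R 1).
Local Open Scope ereal_scope.

Lemma normal_prob_ball (c : R) : (0 <= c)%R ->
  N [set x | `|x| < c]%R <= (2 * beta * c)%:E.
Proof.
move=> c0.
have -> : [set x : R | `|x| < c]%R = `]-c, c[%classic%R.
  by apply/seteqP; split=> x /=; rewrite in_itv /= ltr_norml.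
rewrite /normal_prob.
apply: (@le_trans _ _ (\int[lebesgue_measure]_(x in `](-c)%R, c[) cst beta%:E x)).
  apply: ge0_le_integral => //.
  - by move=> x _; exact: normal_pdf_EFin_ge0.
  - by apply: measurable_funTS; exact: measurable_normal_pdf_EFin.
  - by move=> x _; rewrite lee_fin; apply: normal_pdf_ub; exact: oner_neq0.
rewrite integral_cst//= lebesgue_measure_itv/= lte_fin.
case: ifPn => [_|_]; last by rewrite mule0 lee_fin !mulr_ge0// normal_peak_ge0.
by rewrite -EFinD -EFinM lee_fin; lra.
Qed.

(** The function [ln^+], monotone on the whole line because [ln] is [0] at nonpositive arguments. *)
Definition lnp (y : R) : R := Num.max 0%R (ln y).

Lemma lnp_ge0 y : (0 <= lnp y)%R.
Proof. by rewrite le_max lexx. Qed.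

Lemma ln_le_lnp y : (ln y <= lnp y)%R.
Proof. by rewrite le_max lexx orbT. Qed.

Lemma lnp0 : lnp 0 = 0%R.
Proof. by rewrite /lnp ln0// maxxx. Qed.

Lemma lnp_homo (x y : R) : (x <= y)%R -> (lnp x <= lnp y)%R.
Proof.
move=> xy; have [x0|x0] := leP x 0%R; first by rewrite {1}/lnp ln0// maxxx lnp_ge0.
rewrite /lnp ge_max le_max lexx /= le_max ler_ln ?posrE ?xy ?orbT//.
exact: lt_le_trans xy.
Qed.

Lemma measurable_lnp : measurable_fun setT lnp.
Proof. by apply: measurable_maxr => //; exact: measurable_ln. Qed.

Lemma measurable_inv_norm (c : R) : measurable_fun [set: TR] (fun x : R => c / `|x|)%R.
Proof.
apply: measurable_funM; first exact: measurable_cst.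
by apply: measurable_inv_ge0 => //; exact: normr_measurable.
Qed.

(** Layer-cake formula: the value exceeds [r] only if [|x| < y exp (- r)], which has probability at
    most [2 beta y exp (- r)]. The exponential density then integrates to at most [1]. *)
Lemma integral_lnp_normal (y : R) : (0 <= y)%R ->
  \int[N]_x (lnp (y / `|x|))%:E <= (2 * beta * y)%:E.
Proof.
move=> y0.
pose X (x : TR) : R := lnp (y / `|x|)%R.
have mX : measurable_fun setT X := measurableT_comp measurable_lnp (measurable_inv_norm y).
pose X_ : {RV N >-> R} := HB.pack X (isMeasurableFun.Build _ _ _ _ _ mX).
have E : \int[N]_x (lnp (y / `|x|)%R)%:E = 'E_N[X_] by rewrite expectation_def.
rewrite E ge0_expectation_ccdf; last by move=> x; exact: lnp_ge0.
have tail (r : R) : (0 <= r)%R -> ccdf X_ r <= (2 * beta * y)%:E * (exponential_pdf 1 r)%:E.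
  move=> r0; rewrite exponential_pdfE// mul1r mulN1r -EFinM.
  have e0 := expR_gt0 (- r).
  have ye0 : (0 <= y * expR (- r))%R by rewrite mulr_ge0// ltW.
  apply: (@le_trans _ _ (N [set x | `|x| < y * expR (- r)]%R)); last first.
    by have := normal_prob_ball ye0; rewrite !mulrA.
  rewrite /ccdf /distribution /pushforward; apply: le_measure.
  - by rewrite inE -[Z in measurable Z]setTI; apply: (mX measurableT); exact: measurable_itv.
  - rewrite inE (_ : mkset _ = `](- (y * expR (- r))), (y * expR (- r))[%classic%R)//.
    by apply/seteqP; split=> x /=; rewrite in_itv /= ltr_norml.
  move=> x /=; rewrite in_itv /= andbT /X /lnp lt_max (le_gtF r0) /= => rlt.
  have x0 : (0 < `|x|)%R.
    rewrite normr_gt0; apply/eqP => x0; move: rlt.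
    by rewrite x0 normr0 invr0 mulr0 ln0// ltNge r0.
  have yx0 : (0 < y / `|x|)%R.
    rewrite ltNge; apply/negP => yx; move: rlt; rewrite ln0//.
    by rewrite ltNge r0.
  move: rlt; rewrite -ltr_expR lnK ?posrE// ltr_pdivlMr// => H.
  by rewrite expRN ltr_pdivlMr ?expR_gt0// mulrC.
apply: (@le_trans _ _ (\int[lebesgue_measure]_(r in `[0%R, +oo[)
    ((2 * beta * y)%:E * (exponential_pdf 1 r)%:E))).
  apply: ge0_le_integral => //.
  - by apply: measurable_funTS; exact: ccdf_measurable.
  - apply: emeasurable_funM; first exact: measurable_cst.
    by apply/measurable_funTS/measurable_EFinP; exact: measurable_exponential_pdf.
  - by move=> r; rewrite /= in_itv /= andbT => /tail.
have b0 : (0 <= 2 * beta * y)%R by rewrite !mulr_ge0// normal_peak_ge0.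
rewrite ge0_integralZl//; first last.
- by move=> r _; rewrite lee_fin exponential_pdf_ge0.
- by apply/measurable_funTS/measurable_EFinP; exact: measurable_exponential_pdf.
rewrite -[leRHS]mule1; apply: lee_wpmul2l; first by rewrite lee_fin.
rewrite -(@integral_exponential_pdf R 1 ltr01).
apply: ge0_subset_integral => //.
- by apply/measurable_EFinP; exact: measurable_exponential_pdf.
- by move=> r _; rewrite lee_fin exponential_pdf_ge0.
Qed.

End NormalBounds.

Section NormalMoments.
Context {R : realType}.
Local Notation TR := (measurableTypeR R).
Local Notation N := (@normal_prob R 0 1).
Local Open Scope ereal_scope.

(** The weight turns the standard density into [s] times the centered normal density of standard
    deviation [s]. This is the moment generating function of [x^2], parametrized by its value. *)
Lemma integral_normal_expR_sqr (s : R) : (0 < s)%R ->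
  \int[N]_x (expR ((1 - s ^- 2) / 2 * x ^+ 2))%:E = s%:E.
Proof.
move=> s0; have sN0 : s != 0%R by rewrite gt_eqF.
rewrite integral_normal_prob; first last.
- by move=> x; rewrite lee_fin expR_ge0.
- apply/measurable_EFinP; apply: (measurableT_comp (f := @expR R)) => //.
  apply: measurable_funM; first exact: measurable_cst.
  exact: measurable_funX.
transitivity (\int[lebesgue_measure]_x (s%:E * (normal_pdf 0 s x)%:E)).
  apply: eq_integral => x _; rewrite -!EFinM; congr (_%:E).
  rewrite !normal_pdfE ?oner_neq0// mulrCA [RHS]mulrA; congr (_ * _)%R.
    rewrite /normal_peak expr1n mul1r -mulrnAr sqrtrM ?sqr_ge0// sqrtr_sqr gtr0_norm//.
    by rewrite invfM mulVKf.
  rewrite /normal_fun -expRD; congr expR; rewrite !subr0 expr1n.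
  by field.
rewrite ge0_integralZl.
- by rewrite [X in _ * X]integral_normal_pdf mule1.
- exact: measurableT.
- by apply/measurable_EFinP; exact: measurable_normal_pdf.
- by move=> x _; rewrite lee_fin normal_pdf_ge0.
- by rewrite lee_fin ltW.
Qed.

(** An infinite integral of [f] would make the left side of the hypothesis infinite; in the finite
    case one solves the linear inequality. *)
Lemma le_integral_affine (f : TR -> R) (a b K : R) : (0 < a)%R -> (0 <= b)%R ->
  measurable_fun setT f -> (forall x, 0 <= f x)%R ->
  \int[N]_x (a * f x + b)%:E <= K%:E -> \int[N]_x (f x)%:E <= ((K - b) / a)%:E.
Proof.
move=> a0 b0 mf f0.
have E : \int[N]_x (a * f x + b)%:E = a%:E * \int[N]_x (f x)%:E + b%:E.
  transitivity (\int[N]_x (a%:E * (f x)%:E) + \int[N]_x (cst b%:E x)).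
    rewrite -ge0_integralD.
    - by apply: eq_integral => x _; rewrite /cst -EFinM -EFinD.
    - exact: measurableT.
    - by move=> x _; rewrite -EFinM lee_fin mulr_ge0// ltW.
    - by apply/measurable_EFinP; apply: measurable_funM => //; exact: measurable_cst.
    - by move=> x _; rewrite lee_fin.
    - exact: measurable_cst.
  congr (_ + _).
    rewrite ge0_integralZl.
    - by [].
    - exact: measurableT.
    - exact/measurable_EFinP.
    - by move=> x _; rewrite lee_fin.
    - by rewrite lee_fin ltW.
  rewrite integral_cst; last exact: measurableT.
  have -> : b%:E * N setT = b%:E by rewrite probability_setT mule1.
  by [].
rewrite E; have : 0 <= \int[N]_x (f x)%:E by apply: integral_ge0 => x _; rewrite lee_fin.
case: (\int[N]_x (f x)%:E) => [r| |] //=.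
  by move=> _; rewrite -EFinM -EFinD !lee_fin ler_pdivlMr// lerBrDr mulrC.
by rewrite gt0_muley ?lte_fin// addye.
Qed.

(** Integrating [1 + a x^2 <= exp (a x^2)] bounds the moment by [(s - 1) / a], which is [121/105]
    for [s = 11/10]. *)
Lemma normal_moment2 : \int[N]_x (x ^+ 2)%:E <= (6 / 5)%:E.
Proof.
pose s : R := (11 / 10)%R; pose a : R := ((1 - s ^- 2) / 2)%R.
have aE : a = (21 / 242)%R by rewrite /a /s; field.
apply: (@le_trans _ _ ((s - 1) / a)%:E); last by rewrite lee_fin aE /s; lra.
apply: le_integral_affine => //.
- by rewrite aE; lra.
- by move=> x; exact: sqr_ge0.
rewrite -[leRHS](@integral_normal_expR_sqr s); last by rewrite /s; lra.
apply: ge0_le_integral => //.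
- by move=> x _; rewrite lee_fin addr_ge0// mulr_ge0 ?sqr_ge0// aE; lra.
- by apply/measurable_EFinP; apply: measurable_funD => //; apply: measurable_funM.
- apply/measurable_EFinP; apply: (measurableT_comp (f := @expR R)) => //.
  by apply: measurable_funM.
- by move=> x _; rewrite lee_fin addrC expR_ge1Dx.
Qed.

(* [(31/41)^2 + (49/41)^2 = 2], so the two Gaussian weights below are [exp (+- t x^2)] for one [t]. *)
Lemma normal_moment4 : \int[N]_x (x ^+ 4)%:E <= (7 / 2)%:E.
Proof.
pose s1 : R := (41 / 31)%R; pose s2 : R := (41 / 49)%R.
pose t : R := ((1 - s1 ^- 2) / 2)%R.
have tE : t = (360 / 1681)%R by rewrite /t /s1; field.
have tE2 : ((1 - s2 ^- 2) / 2 = - t)%R by rewrite tE /s2; field.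
(* Integrates [2 + t^2 x^4 <= exp (t x^2) + exp (- t x^2)]; the quotient is about [3.474]. *)
apply: (@le_trans _ _ ((s1 + s2 - 2) / t ^+ 2)%:E); last by rewrite lee_fin tE /s1 /s2; lra.
have mexp (c : R) : measurable_fun [set: TR] (fun x => (expR (c * x ^+ 2))%:E).
  apply/measurable_EFinP; apply: (measurableT_comp (f := @expR R)) => //.
  by apply: measurable_funM.
have mX4 : measurable_fun [set: TR] (fun x : R => x ^+ 4)%R by exact: measurable_funX.
have x4 (x : R) : (0 <= x ^+ 4)%R by rewrite (exprM x 2 2) sqr_ge0.
apply: le_integral_affine => //.
  by rewrite exprn_gt0// tE; lra.
rewrite EFinD -(@integral_normal_expR_sqr s1) ?/s1; last by lra.
rewrite -(@integral_normal_expR_sqr s2) ?/s2; last by lra.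
rewrite tE2 -/s1 -/t -ge0_integralD//.
- apply: ge0_le_integral => //.
  + by move=> x _; rewrite lee_fin addr_ge0// mulr_ge0// sqr_ge0.
  + by apply/measurable_EFinP; apply: measurable_funD => //; apply: measurable_funM.
  + by apply: emeasurable_funD.
  + move=> x _; rewrite -EFinD lee_fin mulNr addrC.
    apply: le_trans (expR_cosh_ge (t * x ^+ 2)); rewrite [((t * _) ^+ 2)%R]exprMn -(exprM x 2 2); lra.
Qed.

End NormalMoments.

(** * Expected logarithm of the norm of a Gaussian solution *)

Section ExpectedSolve.
Context {R : realType}.
Context {d : measure_display} {T : measurableType d}.
Context {d' : measure_display} {T' : measurableType d'}.
Variables (P : probability T R) (P' : probability T' R).
Local Notation beta := (@normal_peak R 1).
Local Open Scope ereal_scope.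

Lemma measurable_expected_lnp (tau : R) n (S : T -> 'M[R]_n) (Z : 'I_n -> T' -> R) :
  (forall i j, measurable_fun setT (fun w => S w i j)) ->
  (forall i, measurable_fun setT (Z i)) ->
  measurable_fun [set: T * T']
    (fun w => (lnp (tau * solve_norm (S w.1) (\col_i Z i w.2)))%:E).
Proof.
move=> mS mZ; apply/measurable_EFinP; apply: (measurableT_comp measurable_lnp).
apply: measurable_funM; first exact: measurable_cst.
apply: measurable_solve_norm => [i j|i].
  exact: (measurableT_comp (mS i j) measurable_fst).
rewrite (_ : (fun w : T * T' => _) = Z i \o snd); first exact: measurableT_comp.
by apply/funext => w; rewrite /= mxE.
Qed.

Lemma integral_sum_sqr_le (I : finType) (Z : I -> T' -> R) : iid_normal P' Z ->
  \int[P']_w (\sum_i Z i w ^+ 2)%:E <= (#|I|%:R * (6 / 5))%:E.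
Proof.
move=> HZ; have [mZ _] := HZ.
under eq_integral do rewrite -sumEFin.
rewrite ge0_integral_sum//; last 2 first.
- by move=> i; apply/measurable_EFinP; exact: measurable_funX.
- by move=> i w _; rewrite lee_fin sqr_ge0.
apply: (@le_trans _ _ (\sum_(i : I) (6 / 5)%:E)); last first.
  by rewrite sumEFin lee_fin sumr_const -(mulr_natl (6 / 5)%R).
apply: lee_sum => i _; apply: le_trans normal_moment2.
have Hi := iid_normal_comp (f := fun _ : unit => i) _ HZ.
have inj1 : injective (fun _ : unit => i) by do 2 case.
have mF : measurable_fun setT (fun x : coord_space R unit => (x tt ^+ 2)%:E).
  by apply/measurable_EFinP; apply: measurable_funX; exact: measurable_coord.
have F0 (x : coord_space R unit) : 0 <= (x tt ^+ 2)%:E by rewrite lee_fin sqr_ge0.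
by rewrite (iid_normal_transfer (Hi inj1) (@iid_normal_id R) mF F0).
Qed.

(** Jensen's inequality through a tangent: [l <= l^2 / (2 r) + r / 2], where [r^2] is the bound on
    the expectation of [l^2]. *)
Lemma integral_l2norm_le n (Z : 'I_n -> T' -> R) : (0 < n)%N -> iid_normal P' Z ->
  \int[P']_w (l2norm (\col_i Z i w))%:E <= (Num.sqrt (n%:R * (6 / 5)))%:E.
Proof.
move=> n0 HZ; have [mZ _] := HZ; set r := Num.sqrt _.
have n0' : (0 < n%:R * (6 / 5) :> R)%R by rewrite mulr_gt0 ?ltr0n//; lra.
have r0 : (0 < r)%R by rewrite sqrtr_gt0.
have r2 : (r ^+ 2 = n%:R * (6 / 5))%R by rewrite sqr_sqrtr// ltW.
have msum : measurable_fun setT (fun w => \sum_i Z i w ^+ 2)%R.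
  by apply: measurable_sum => i; exact: measurable_funX.
have sum0 w : (0 <= \sum_i Z i w ^+ 2)%R by apply: sumr_ge0 => i _; rewrite sqr_ge0.
apply: (@le_trans _ _ (\int[P']_w ((2 * r)^-1%:E * (\sum_i Z i w ^+ 2)%:E + (cst (r / 2)%:E w)))).
  apply: ge0_le_integral => //.
  - by move=> w _; rewrite lee_fin l2norm_ge0.
  - apply/measurable_EFinP; apply: measurable_l2norm => i.
    rewrite (_ : (fun w => _) = Z i)//; by apply/funext => w; rewrite mxE.
  - apply: emeasurable_funD => //; apply: emeasurable_funM => //.
    exact/measurable_EFinP.
  - move=> w _; rewrite -EFinM /cst -EFinD lee_fin.
    have -> : (\sum_i Z i w ^+ 2 = l2norm (\col_i Z i w) ^+ 2)%R.
      by rewrite l2norm_sqr; apply: eq_bigr => i _; rewrite mxE.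
    set l := l2norm _.
    rewrite -(ler_pM2l (_ : 0 < 2 * r)%R) ?mulr_gt0// mulrDr mulVKf ?gt_eqF ?mulr_gt0//.
    have := sqr_ge0 (l - r); lra.
rewrite ge0_integralD//; last 3 first.
- by move=> w _; rewrite mule_ge0// lee_fin ?invr_ge0 ?mulr_ge0// ltW.
- by apply: emeasurable_funM => //; exact/measurable_EFinP.
- by move=> w _; rewrite lee_fin divr_ge0// ltW.
rewrite ge0_integralZl//; last 3 first.
- exact/measurable_EFinP.
- by move=> w _; rewrite lee_fin.
- by rewrite lee_fin invr_ge0 mulr_ge0// ltW.
rewrite integral_cst//.
have -> : (r / 2)%:E * P' setT = (r / 2)%:E by rewrite probability_setT mule1.
apply: (@le_trans _ _ ((2 * r)^-1%:E * (r ^+ 2)%:E + (r / 2)%:E)).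
  rewrite leeD2r// lee_pmul2l ?lte_fin ?invr_gt0 ?mulr_gt0//.
  by have := integral_sum_sqr_le HZ; rewrite card_ord r2.
rewrite -EFinM -EFinD lee_fin le_eqVlt; apply/orP; left; apply/eqP.
by field; rewrite gt_eqF.
Qed.

(** Tonelli lets the matrix be integrated first, with [h] fixed. The result is at most linear in
    [|h|], so that only the mean of [|h|] enters. *)
Lemma expected_lnp_solve_norm n (X : 'I_n.+1 * 'I_n.+1 -> T -> R) (Z : 'I_n.+1 -> T' -> R)
    (tau : R) : (0 <= tau)%R -> iid_normal P X -> iid_normal P' Z ->
  \int[P]_w \int[P']_w' (lnp (tau * solve_norm (mx_of (fun k => X k w)) (\col_i Z i w')))%:E
  <= (2 * beta * tau * Num.sqrt (n.+1%:R * (6 / 5)))%:E.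
Proof.
move=> tau0 HX HZ; have [mX _] := HX; have [mZ _] := HZ.
have mmX (i j : 'I_n.+1) : measurable_fun setT (fun w => mx_of (fun k => X k w) i j).
  rewrite (_ : (fun w => _) = X (i, j)); first exact: mX.
  by apply/funext => w; rewrite mxE.
have mF := measurable_expected_lnp tau mmX mZ.
have F0 (w : T * T') : 0 <= (lnp (tau * solve_norm (mx_of (fun k => X k w.1)) (\col_i Z i w.2)))%:E.
  by rewrite lee_fin lnp_ge0.
have /= -> := fubini_tonelli (m1 := P) (m2 := P') _ mF F0.
pose psi (y : R) := (lnp (tau * y))%:E.
have mpsi : measurable_fun setT psi.
  apply/measurable_EFinP; apply: (measurableT_comp measurable_lnp).
  by apply: measurable_funM => //; exact: measurable_cst.
have b0 : (0 <= 2 * beta * tau)%R by rewrite !mulr_ge0// normal_peak_ge0.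
have ml2 : measurable_fun setT (fun w => l2norm (\col_i Z i w)).
  apply: measurable_l2norm => i.
  by rewrite (_ : (fun w => _) = Z i)//; apply/funext => w; rewrite mxE.
apply: (@le_trans _ _ (\int[P']_w ((2 * beta * tau)%:E * (l2norm (\col_i Z i w))%:E))).
  apply: ge0_le_integral => //.
  - by move=> w _; apply: integral_ge0 => w' _; rewrite lee_fin lnp_ge0.
  - exact: (measurable_fun_fubini_tonelli_G (m1 := P) _ mF F0).
  - by apply: emeasurable_funM => //; exact/measurable_EFinP.
  move=> w _; apply: le_trans (integral_solve_norm_le (\col_i Z i w) HX mpsi _ _) _.
  + by move=> y; rewrite lee_fin lnp_ge0.
  + by rewrite /psi mulr0 lnp0.
  have := @integral_lnp_normal R (tau * l2norm (\col_i Z i w)).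
  rewrite mulr_ge0 ?l2norm_ge0// => /(_ isT); rewrite -EFinM !mulrA; apply: le_trans.
  rewrite le_eqVlt; apply/orP; left; apply/eqP; apply: eq_integral => x _.
  by rewrite /psi !mulrA.
rewrite ge0_integralZl//; last 2 first.
- exact/measurable_EFinP.
- by move=> w _; rewrite lee_fin l2norm_ge0.
rewrite [leRHS]EFinM; apply: lee_wpmul2l; first by rewrite lee_fin.
exact: integral_l2norm_le.
Qed.

End ExpectedSolve.

(** * Distance to singularity *)

Section SingularPerturbation.
Context {R : realType}.

Lemma cauchy_schwarz (I : finType) (x y : I -> R) :
  (\sum_i x i * y i) ^+ 2 <= (\sum_i x i ^+ 2) * (\sum_i y i ^+ 2).
Proof.
set s := \sum_i x i * y i; set a := \sum_i x i ^+ 2; set b := \sum_i y i ^+ 2.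
have b0 : 0 <= b by rewrite sumr_ge0// => i _; rewrite sqr_ge0.
have [bE|bN0] := eqVneq b 0.
  have y0 i : y i = 0.
    apply/eqP; rewrite -sqrf_eq0; move/eqP: bE; rewrite psumr_eq0; last first.
      by move=> j _; rewrite sqr_ge0.
    by move=> /allP /(_ i (mem_index_enum _)).
  by rewrite bE mulr0 /s big1 ?expr0n// => i _; rewrite y0 mulr0.
have : 0 <= \sum_i (b * x i - s * y i) ^+ 2 by rewrite sumr_ge0// => i _; rewrite sqr_ge0.
have -> : \sum_i (b * x i - s * y i) ^+ 2 = b * (a * b - s ^+ 2).
  transitivity (\sum_i (b ^+ 2 * x i ^+ 2 - 2 * b * s * (x i * y i) + s ^+ 2 * y i ^+ 2)).
    by apply: eq_bigr => i _; ring.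
  by rewrite big_split/= sumrB -!mulr_sumr -/a -/b -/s; ring.
by rewrite pmulr_rge0 ?lt_neqAle 1?eq_sym ?bN0// subr_ge0.
Qed.

Lemma norm_dot_le n (x y : 'cV[R]_n) :
  `|\sum_i x i 0 * y i 0| <= l2norm x * l2norm y.
Proof.
rewrite -sqrtr_sqr -sqrtrM; last by rewrite sumr_ge0// => i _; rewrite sqr_ge0.
by rewrite ler_wsqrtr// cauchy_schwarz.
Qed.

Lemma sum_norm_le_l2norm n (x : 'cV[R]_n) : \sum_i `|x i 0| <= Num.sqrt n%:R * l2norm x.
Proof.
rewrite -sqrtrM// -[leLHS]ger0_norm ?sumr_ge0// -sqrtr_sqr ler_wsqrtr//.
have := cauchy_schwarz (fun=> 1) (fun i => `|x i 0|).
under eq_bigr do rewrite mul1r; under [in X in _ <= X * _]eq_bigr do rewrite expr1n.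
under [in X in _ <= _ * X]eq_bigr do rewrite real_normK ?num_real//.
by rewrite sumr_const card_ord.
Qed.

Lemma l2norm_eq0 n (x : 'cV[R]_n) : l2norm x = 0 -> x = 0.
Proof.
move=> x0; apply/matrixP => i j; rewrite ord1 mxE; apply/eqP; rewrite -sqrf_eq0.
have /eqP := l2norm_sqr x; rewrite x0 expr0n eq_sym psumr_eq0; last first.
  by move=> k _; rewrite sqr_ge0.
by move=> /allP /(_ i (mem_index_enum _)).
Qed.

(** Let [l] span a line in the kernel of [S + Delta], let [q = S^-T l] and [p = q / |q|]. Then
    [|l|^2 = q . S l = - q . Delta l <= |q| e sqrt n |l|], so [|l| / |q| <= e sqrt n], while
    [p . h = l . S^-1 h / |q|]. *)
Lemma singular_perturbation n (S Delta : 'M[R]_n) (e : R) :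
  S \in unitmx -> \det (S + Delta) = 0 -> (forall j, l2norm (col j Delta) <= e) ->
  exists2 p : 'cV[R]_n, l2norm p = 1 &
    forall h : 'cV[R]_n, `|\sum_i p i 0 * h i 0| <= e * Num.sqrt n%:R * l2norm (invmx S *m h).
Proof.
move=> uS /eqP; rewrite -det_tr => /det0P[v v0 vS] De.
pose l := v^T; have lS : (S + Delta) *m l = 0 by rewrite -[RHS]trmx0 -vS trmx_mul trmxK.
have l0 : 0 < l2norm l.
  rewrite lt_neqAle l2norm_ge0 andbT eq_sym; apply: contra v0 => /eqP/l2norm_eq0 l0.
  by rewrite -[v]trmxK -/l l0 trmx0.
pose q := (invmx S)^T *m l.
have dotE (x y : 'cV[R]_n) : \sum_i x i 0 * y i 0 = (x^T *m y) 0 0.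
  by rewrite mxE; apply: eq_bigr => i _; rewrite mxE.
have qh (h : 'cV[R]_n) : \sum_i q i 0 * h i 0 = \sum_i l i 0 * (invmx S *m h) i 0.
  by rewrite !dotE trmx_mul !trmxK mulmxA.
have ll : l2norm l ^+ 2 <= e * Num.sqrt n%:R * l2norm l * l2norm q.
  have -> : l2norm l ^+ 2 = - \sum_j l j 0 * \sum_i q i 0 * col j Delta i 0.
    transitivity (- (\sum_i q i 0 * (Delta *m l) i 0)).
      have -> : Delta *m l = - (S *m l) by apply/eqP; rewrite -addr_eq0 addrC -mulmxDl lS.
      rewrite l2norm_sqr -sumrN; transitivity (\sum_i q i 0 * (S *m l) i 0).
        by rewrite qh mulKmx//; apply: eq_bigr => i _; rewrite expr2.
      by apply: eq_bigr => i _; rewrite [(- (S *m l)) i 0]mxE mulrN opprK.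
    congr (- _).
    under eq_bigr => i _ do rewrite [(Delta *m l) i 0]mxE mulr_sumr.
    rewrite exchange_big /=; apply: eq_bigr => j _; rewrite mulr_sumr.
    by apply: eq_bigr => i _; rewrite [col _ _ _ _]mxE; ring.
  apply: le_trans (ler_norm _) _; rewrite normrN.
  apply: le_trans (ler_norm_sum _ _ _) _.
  apply: (@le_trans _ _ (\sum_j `|l j 0| * (l2norm q * e))).
    apply: ler_sum => j _; rewrite normrM ler_wpM2l//.
    by apply: le_trans (norm_dot_le _ _) _; rewrite ler_wpM2l ?l2norm_ge0.
  rewrite -mulr_suml.
  have e0 : 0 <= l2norm q * e.
    (* That [e] is nonnegative is read off a column of [Delta]; size [0] is excluded because [v] is
       nonzero. *)
    rewrite mulr_ge0 ?l2norm_ge0//; case: n S Delta uS v v0 vS De l lS l0 q dotE qh => [|n].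
      by move=> S Delta uS v; rewrite thinmx0 eqxx.
    by move=> S Delta _ _ _ _ /(_ ord0) De _ _ _ _ _ _; apply: le_trans De; rewrite l2norm_ge0.
  apply: le_trans (ler_wpM2r e0 (sum_norm_le_l2norm l)) _.
  by rewrite le_eqVlt; apply/orP; left; apply/eqP; ring.
have q0 : 0 < l2norm q.
  rewrite lt_neqAle l2norm_ge0 andbT eq_sym; apply/eqP => q0; move: ll.
  by rewrite q0 mulr0 leNgt exprn_gt0.
have lq : l2norm l <= e * Num.sqrt n%:R * l2norm q.
  by rewrite -(ler_pM2l l0) -expr2; apply: le_trans ll _; rewrite mulrAC mulrC mulrA.
exists ((l2norm q)^-1 *: q).
  by rewrite l2normZ ger0_norm ?invr_ge0 ?l2norm_ge0// mulVf ?gt_eqF.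
move=> h; have -> : \sum_i ((l2norm q)^-1 *: q) i 0 * h i 0 =
    (l2norm q)^-1 * \sum_i l i 0 * (invmx S *m h) i 0.
  by rewrite -qh mulr_sumr; apply: eq_bigr => i _; rewrite mxE mulrA.
rewrite normrM gtr0_norm ?invr_gt0// mulrC ler_pdivrMr//.
apply: le_trans (norm_dot_le _ _) _; rewrite mulrAC.
by rewrite ler_wpM2r ?l2norm_ge0.
Qed.

End SingularPerturbation.

Section ExpectedPerturbation.
Context {R : realType} {d : measure_display} {T : measurableType d}.
Variable P : probability T R.
Local Notation beta := (@normal_peak R 1).
Local Open Scope ereal_scope.

(* By rotation invariance [p . Z] is a standard normal, so it is at least
   [1 / (4 beta)] in absolute value with probability at least [1 / 2]. *)
Lemma lnp_le_expected_solve n (S Delta : 'M[R]_n.+1) (e A : R) (Z : 'I_n.+1 -> T -> R) :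
  S \in unitmx -> \det (S + Delta) = 0%R ->
  (forall j, l2norm (col j Delta) <= e)%R -> (0 < e)%R -> (0 < A)%R -> iid_normal P Z ->
  (lnp (A * e)^-1)%:E <= 2%:E * \int[P]_w
    (lnp (4 * beta * Num.sqrt n.+1%:R / A * solve_norm S (\col_i Z i w)))%:E.
Proof.
move=> uS SD De e0 A0 HZ; have [mZ _] := HZ.
have [p p1 ph] := singular_perturbation uS SD De.
have b0 : (0 < beta)%R by apply: normal_peak_gt0; exact: oner_neq0.
pose c : R := (4 * beta)^-1%R.
have c0 : (0 < c)%R by rewrite invr_gt0 mulr_gt0.
pose L := lnp (A * e)^-1%R.
have mdot : measurable_fun setT (fun w => \sum_i p i 0%R * Z i w)%R.
  by apply: measurable_sum => i; apply: measurable_funM => //; exact: measurable_cst.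
pose E := [set w | `|\sum_i p i 0 * Z i w| < c]%R.
pose ball := [set x : R | `|x| < c]%R.
have mball : measurable ball.
  rewrite (_ : ball = `](- c)%R, c[%classic)//.
  by apply/seteqP; split=> x; rewrite /ball /= in_itv /= ltr_norml.
have mE : measurable E.
  have := mdot measurableT _ mball; rewrite setTI; congr measurable.
have PE : P E <= (2^-1)%:E.
  pose psi (x : R) : \bar R := (\1_ball x)%:E.
  have mpsi : measurable_fun setT psi by apply/measurable_EFinP; exact: measurable_indic.
  have psi0 x : 0 <= psi x by rewrite lee_fin.
  have [t tE H] := iid_normal_dot ord0 (fun i => p i 0%R) HZ mpsi psi0.
  have t1 : (`|t| = 1)%R.
    by rewrite -sqrtr_sqr tE -l2norm_sqr p1 expr1n sqrtr1.
  have -> : P E = \int[P]_w psi (\sum_i p i 0%R * Z i w)%R.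
    transitivity (\int[P]_w (\1_E w)%:E); first by rewrite integral_indic ?setIT.
    by apply: eq_integral => w _.
  rewrite H; apply: (@le_trans _ _ (normal_prob 0 1 ball)); last first.
    apply: le_trans (normal_prob_ball (ltW c0)) _.
    by rewrite lee_fin /c le_eqVlt; apply/orP; left; apply/eqP; field; rewrite gt_eqF.
  rewrite le_eqVlt; apply/orP; left; apply/eqP.
  transitivity (\int[normal_prob 0 1]_x (\1_ball x)%:E); last by rewrite integral_indic ?setIT.
  apply: eq_integral => x _; rewrite /psi !indicE.
  by have -> : (t * x \in ball)%R = (x \in ball);
    [apply/idP/idP; rewrite !inE /ball /= normrM t1 mul1r|].
have mCE : measurable (~` E) by exact: measurableC.
have PCE : (2^-1)%:E <= P (~` E).
  rewrite probability_setC//; move: PE (fin_num_measure P _ mE).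
  by case: (P E) => // r; rewrite lee_fin => r2 _; rewrite -EFinB lee_fin; lra.
have L0 : (0 <= L)%R by exact: lnp_ge0.
have mF : measurable_fun setT (fun w =>
    (lnp (4 * beta * Num.sqrt n.+1%:R / A * solve_norm S (\col_i Z i w)))%:E).
  apply/measurable_EFinP; apply: (measurableT_comp measurable_lnp).
  apply: measurable_funM; first exact: measurable_cst.
  apply: measurable_solve_norm => [i j|i]; first exact: measurable_cst.
  by rewrite (_ : (fun w => _) = Z i)//; apply/funext => w; rewrite mxE.
(* Off [E], [1 / (4 beta) <= |p . Z| <= e sqrt (n + 1) |S^-1 Z|], so the argument of [lnp] in the
   integral is at least [1 / (A e)]. *)
have key : L%:E * P (~` E) <= \int[P]_w
    (lnp (4 * beta * Num.sqrt n.+1%:R / A * solve_norm S (\col_i Z i w)))%:E.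
  apply: (@le_trans _ _ (\int[P]_(w in ~` E) (cst L%:E w))).
    by rewrite integral_cst.
  apply: (@le_trans _ _ (\int[P]_(w in ~` E)
     (lnp (4 * beta * Num.sqrt n.+1%:R / A * solve_norm S (\col_i Z i w)))%:E)).
    apply: ge0_le_integral => //; first exact: measurable_funTS.
    move=> w /negP; rewrite -leNgt => cw; rewrite lee_fin; apply: lnp_homo.
    have := ph (\col_i Z i w); under eq_bigr do rewrite mxE.
    move=> /(le_trans cw); rewrite solve_norm_unit//; set l := l2norm _ => cl.
    have Ae : (0 < A * e)%R by rewrite mulr_gt0.
    have b4 : (0 < 4 * beta)%R by rewrite mulr_gt0.
    rewrite -(ler_pM2l Ae) mulfV ?(gt_eqF Ae)//.
    have -> : (A * e * (4 * beta * Num.sqrt n.+1%:R / A * l) =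
       4 * beta * (e * Num.sqrt n.+1%:R * l))%R by field; rewrite gt_eqF.
    by rewrite -(ler_pM2l b4) mulfV ?(gt_eqF b4) in cl.
  apply: ge0_subset_integral => //.
  by move=> w _; rewrite lee_fin lnp_ge0.
apply: (@le_trans _ _ (2%:E * (L%:E * P (~` E)))).
  apply: (@le_trans _ _ (2%:E * (L%:E * (2^-1)%:E))).
    by rewrite -!EFinM lee_fin; rewrite -/L; lra.
  by rewrite lee_pmul2l// lee_wpmul2l// lee_fin.
by rewrite lee_pmul2l.
Qed.

End ExpectedPerturbation.

(** * The operator norm from the 1-norm to the 2-norm *)

Section OperatorNorm.
Context {R : realType}.

(** With [u = M x], expand [|u|^2] as the sum of the [x_j (u . M_j)], bound each product by [|u| C],
    and divide by [|u|]. *)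
Lemma l2norm_mulmx_le p q (M : 'M[R]_(p, q)) (x : 'cV[R]_q) (C : R) :
  (forall j, l2norm (col j M) <= C) -> l2norm (M *m x) <= C * l1norm x.
Proof.
move=> MC; have [u uE] : exists u, u = M *m x by exists (M *m x).
rewrite -uE.
have [->|u0] := eqVneq (l2norm u) 0.
  rewrite /l1norm mulr_sumr sumr_ge0// => j _; rewrite mulr_ge0//.
  exact: le_trans (l2norm_ge0 _) (MC j).
have {}u0 : 0 < l2norm u by rewrite lt_neqAle eq_sym u0 l2norm_ge0.
rewrite -(ler_pM2l u0) -expr2 l2norm_sqr.
have -> : \sum_i u i 0 ^+ 2 = \sum_j x j 0 * \sum_i u i 0 * col j M i 0.
  transitivity (\sum_i u i 0 * (M *m x) i 0); first by apply: eq_bigr => i _; rewrite -uE expr2.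
  under eq_bigr => i _ do rewrite [(M *m x) i 0]mxE mulr_sumr.
  rewrite exchange_big /=; apply: eq_bigr => j _; rewrite mulr_sumr.
  by apply: eq_bigr => i _; rewrite [col _ _ _ _]mxE; ring.
apply: le_trans (ler_norm _) _; apply: le_trans (ler_norm_sum _ _ _) _.
rewrite /l1norm !mulr_sumr; apply: ler_sum => j _; rewrite normrM mulrA mulrC.
rewrite ler_wpM2r//; apply: le_trans (norm_dot_le _ _) _.
by rewrite ler_wpM2l ?l2norm_ge0.
Qed.

Lemma opnorm12_le p q (M : 'M[R]_(p, q)) (C : R) : 0 <= C ->
  (forall j, l2norm (col j M) <= C) -> opnorm12 M <= C.
Proof.
move=> C0 MC; apply: ge_sup.
  by exists (l2norm (M *m 0)); exists 0 => //=; rewrite /l1norm big1// => i _; rewrite mxE normr0.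
move=> _ [x /= x1 <-]; apply: le_trans (l2norm_mulmx_le x MC) _.
by rewrite -[leRHS]mulr1 ler_wpM2l.
Qed.

(** Attained at a basis vector; with [opnorm12_le], the operator norm is the largest column norm. *)
Lemma l2norm_col_le_opnorm12 p q (M : 'M[R]_(p, q)) j : l2norm (col j M) <= opnorm12 M.
Proof.
apply: ub_le_sup.
  exists (\sum_k l2norm (col k M)) => _ [x /= x1 <-].
  apply: le_trans (l2norm_mulmx_le (C := \sum_k l2norm (col k M)) x _) _.
    by move=> k; rewrite (bigD1 k)//= lerDl sumr_ge0// => i _; rewrite l2norm_ge0.
  rewrite -[leRHS]mulr1 ler_wpM2l// sumr_ge0// => i _; exact: l2norm_ge0.
exists (delta_mx j 0); last by rewrite colE.
rewrite /= /l1norm (bigD1 j)//= mxE !eqxx normr1 big1 ?addr0// => i /negbTE ij.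
by rewrite mxE ij normr0.
Qed.

Lemma opnorm12_ge0 p q (M : 'M[R]_(p, q.+1)) : 0 <= opnorm12 M.
Proof. exact: le_trans (l2norm_ge0 _) (l2norm_col_le_opnorm12 M ord0). Qed.

(** Cauchy-Schwarz bounds the fourth power of each column norm by [p] times the sum of its fourth
    powers; the sum over all columns dominates the maximum. *)
Lemma opnorm12_pow4_le p q (M : 'M[R]_(p, q.+1)) :
  opnorm12 M ^+ 4 <= p%:R * \sum_i \sum_j M i j ^+ 4.
Proof.
set K := p%:R * _.
have sum4 i : 0 <= \sum_j M i j ^+ 4.
  by rewrite sumr_ge0// => j _; rewrite (exprM _ 2 2) sqr_ge0.
have K0 : 0 <= K by rewrite mulr_ge0// sumr_ge0.
pose C := Num.sqrt (Num.sqrt K).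
have C4 : C ^+ 4 = K by rewrite (exprM _ 2 2) !sqr_sqrtr ?sqrtr_ge0.
rewrite -C4 lerXn2r ?nnegrE ?opnorm12_ge0 ?sqrtr_ge0//.
apply: opnorm12_le => [|j]; first exact: sqrtr_ge0.
rewrite -(@ler_pXn2r _ 4) ?nnegrE ?l2norm_ge0 ?sqrtr_ge0// C4.
rewrite (exprM _ 2 2) l2norm_sqr.
have := cauchy_schwarz (fun=> 1) (fun i => col j M i 0 ^+ 2).
under eq_bigr do rewrite mul1r; under [in X in _ <= X * _]eq_bigr do rewrite expr1n.
move=> /le_trans; apply; rewrite sumr_const card_ord ler_wpM2l//.
apply: ler_sum => i _; rewrite mxE -exprM (bigD1 j)//= lerDl sumr_ge0// => k _.
by rewrite (exprM _ 2 2) sqr_ge0.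
Qed.

End OperatorNorm.

(** * Optimal bases *)

Lemma inl_pair_inj (A B C : Type) (a a' : A) (b b' : B) :
  inl (a, b) = inl (a', b') :> A * B + C -> a = a' /\ b = b'.
Proof. by case. Qed.

Lemma inr_inl_inj (A B C : Type) (a a' : A) :
  inr (inl a) = inr (inl a') :> C + (A + B) -> a = a'.
Proof. by case. Qed.

Lemma inr_inr_inj (A B C : Type) (b b' : B) :
  inr (inr b) = inr (inr b') :> C + (A + B) -> b = b'.
Proof. by case. Qed.

Section BasisMinors.
Context {R : realType} {m n : nat}.
Implicit Types (d : lp_data R m n) (B : {set 'I_n}).

Definition entry_idx := (('I_m * 'I_n) + ('I_m + 'I_n))%type.

(** Minors are encoded by index maps: when [f] is injective the matrix consists of distinct data
    entries, hence is Gaussian by [iid_normal_comp]. *)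
Definition entry_mx k d (f : 'I_k * 'I_k -> entry_idx) : 'M[R]_k :=
  \matrix_(i, j) lp_entry d (f (i, j)).

Section FixedBasis.
Context {B : {set 'I_n}} (hB : #|B| = m).
Local Notation idx := (basis_idx hB).

Lemma basis_idx_inj : injective idx.
Proof. by move=> k l /enum_val_inj/cast_ord_inj. Qed.

Lemma basis_idx_in k : idx k \in B.
Proof. exact: enum_valP. Qed.

Lemma basis_idx_surj j : j \in B -> exists l, j = idx l.
Proof.
move=> jB; exists (cast_ord hB (enum_rank_in jB j)).
by rewrite /basis_idx cast_ordK enum_rankK_in.
Qed.

Definition basis_map (p : 'I_m * 'I_m) : entry_idx := inl (p.1, idx p.2).

(** The Cramer numerator: [A_B] with its column [l] replaced by [b]. *)
Definition primal_map (l : 'I_m) (p : 'I_m * 'I_m) : entry_idx :=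
  if p.2 == l then inr (inl p.1) else inl (p.1, idx p.2).

Definition dual_col (j : 'I_n) (k : 'I_(1 + m)) : 'I_n :=
  match fintype.split k with inl _ => j | inr k' => idx k' end.

(* The matrix with rows [(c_j, c_B)] and [(a_j, A_B)]. *)
Definition dual_map (j : 'I_n) (p : 'I_(1 + m) * 'I_(1 + m)) : entry_idx :=
  match fintype.split p.1 with
  | inl _ => inr (inr (dual_col j p.2))
  | inr i => inl (i, dual_col j p.2)
  end.

Lemma basis_map_inj : injective basis_map.
Proof.
move=> [i k] [i' k'] E; have [/= -> kk'] := inl_pair_inj E.
by rewrite (basis_idx_inj kk').
Qed.

Lemma primal_map_inj l : injective (primal_map l).
Proof.
move=> [i k] [i' k']; rewrite /primal_map /=.
case: (k =P l) => [->|_]; case: (k' =P l) => [->|_] //; first by move=> E; rewrite (inr_inl_inj E).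
by move=> E; have [/= -> kk'] := inl_pair_inj E; rewrite (basis_idx_inj kk').
Qed.

Lemma dual_col_inj j : j \notin B -> injective (dual_col j).
Proof.
move=> jB k k'; rewrite /dual_col => E; apply: (can_inj splitK); move: E.
case: (fintype.split k) => a; case: (fintype.split k') => b.
- by rewrite (ord1 a) (ord1 b).
- by move=> jE; move: jB; rewrite jE basis_idx_in.
- by move=> jE; move: jB; rewrite -jE basis_idx_in.
- by move/basis_idx_inj => ->.
Qed.

Lemma dual_map_inj j : j \notin B -> injective (dual_map j).
Proof.
move=> jB [i k] [i' k']; rewrite /dual_map /= => E.
have [ii' kk'] : i = i' /\ dual_col j k = dual_col j k'.
  have : (fintype.split i = fintype.split i') /\ dual_col j k = dual_col j k'.
    move: E; case: (fintype.split i) => a; case: (fintype.split i') => b //.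
      by rewrite (ord1 a) (ord1 b) => E; have := inr_inr_inj E.
    by move=> E; have [-> ->] := inl_pair_inj E.
  by move=> [ss ?]; split => //; apply: (can_inj splitK).
by rewrite ii' (dual_col_inj jB kk').
Qed.

Variable d : lp_data R m n.
Local Notation AB := (basis_mx (lpA d) hB).

Lemma entry_basis_mx : entry_mx d basis_map = AB.
Proof. by apply/matrixP => i j; rewrite !mxE. Qed.

Definition basic_x : 'cV[R]_m := invmx AB *m lpb d.

(** The reduced cost [c_j - c_B^T A_B^-1 a_j]. *)
Definition basic_slack (j : 'I_n) : R :=
  lpc d j 0 - ((basis_cV (lpc d) hB)^T *m invmx AB *m col j (lpA d)) 0 0.

Lemma det_primal_mx l : AB \in unitmx ->
  \det (entry_mx d (primal_map l)) = \det AB * basic_x l 0.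
Proof.
move=> uA; have dA : \det AB != 0 by move: uA; rewrite unitmxE unitfE.
rewrite /basic_x /invmx uA -scalemxAl [in RHS]mxE mulVKf// mxE (expand_det_col _ l).
apply: eq_bigr => i _; rewrite [in RHS]mxE mulrC; congr (_ * _).
  congr (_ * \det _); apply/matrixP => a b; rewrite !mxE /primal_map /=.
  by rewrite eq_sym (negbTE (neq_lift _ _)).
by rewrite mxE /primal_map /= eqxx.
Qed.

(** The reduced cost is the Schur complement of [A_B] in the bordered matrix: a column operation
    clears [a_j]. *)
Lemma det_dual_mx j : AB \in unitmx ->
  \det (entry_mx d (dual_map j)) = \det AB * basic_slack j.
Proof.
move=> uA; pose cB : 'rV[R]_m := (basis_cV (lpc d) hB)^T.
pose aj : 'cV[R]_m := col j (lpA d).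
have -> : entry_mx d (dual_map j) = block_mx (lpc d j 0)%:M cB aj AB.
  apply/matrixP => i k; rewrite !mxE /dual_map /dual_col /=.
  case: (fintype.split i) => i'; rewrite mxE; case: (fintype.split k) => k'; rewrite !mxE //.
    by rewrite (ord1 i') (ord1 k') eqxx.
  by rewrite (ord1 i').
have E : block_mx (lpc d j 0)%:M cB aj AB *m
    block_mx 1%:M 0 (- (invmx AB *m aj)) 1%:M =
    block_mx (basic_slack j)%:M cB 0 AB.
  rewrite mulmx_block !mulmx1 !mulmx0 !add0r; congr block_mx.
    rewrite mulmxN mulmxA; apply/matrixP => a b; rewrite !ord1 [RHS]mxE eqxx /basic_slack.
    by rewrite 2![in LHS]mxE eqxx [X in _ + X]mxE.
  by rewrite mulmxN mulKVmx// subrr.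
have := congr1 determinant E; rewrite det_mulmx det_lblock det_ublock !det1 !mulr1 => H.
by apply: etrans H _; rewrite det_scalar1 mulrC.
Qed.

End FixedBasis.

End BasisMinors.

Section OptimalBasis.
Context {R : realType} {m n : nat}.
Implicit Types (d : lp_data R m n) (B : {set 'I_n}).

Definition basic_y B (hB : #|B| = m) d : 'cV[R]_m :=
  (invmx (basis_mx (lpA d) hB))^T *m basis_cV (lpc d) hB.

Lemma basic_slackE B (hB : #|B| = m) d j :
  basic_slack hB d j = lpc d j 0 - ((lpA d)^T *m basic_y hB d) j 0.
Proof.
rewrite /basic_slack; congr (_ - _).
transitivity ((((basis_cV (lpc d) hB)^T *m invmx (basis_mx (lpA d) hB) *m col j (lpA d))^T) 0 0).
  by rewrite [RHS]mxE.
rewrite !trmx_mul trmxK tr_col -/(basic_y hB d) !mxE.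
by apply: eq_bigr => i _; rewrite [in LHS]mxE.
Qed.

Lemma dual_basic_solutionP B (hB : #|B| = m) d y : basis_mx (lpA d) hB \in unitmx ->
  dual_basic_solution d hB y <-> y = basic_y hB d.
Proof.
move=> uA; rewrite /dual_basic_solution /basic_y trmx_inv.
have uAT : (basis_mx (lpA d) hB)^T \in unitmx by rewrite unitmx_tr.
by split=> [<-|->]; rewrite ?mulKmx ?mulKVmx.
Qed.

Lemma mulmx_supp B (hB : #|B| = m) d (x : 'cV[R]_n) : (forall j, j \notin B -> x j 0 = 0) ->
  lpA d *m x = basis_mx (lpA d) hB *m basis_cV x hB.
Proof.
move=> xN; apply/matrixP => i k; rewrite ord1 !mxE.
rewrite (bigID (mem B)) /= [X in _ + X]big1 ?addr0 => [|j jB]; last by rewrite xN// mulr0.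
rewrite (reindex_omap (basis_idx hB) (fun j => [pick l | basis_idx hB l == j])) /=.
  apply: eq_big => [l|l _]; last by rewrite !mxE.
  rewrite basis_idx_in /=; case: pickP => [l' /eqP/basis_idx_inj ->|/(_ l)]; first exact: eqxx.
  by rewrite eqxx.
move=> j /(basis_idx_surj hB)[l ->]; case: pickP => [l' /eqP/= -> //|/(_ l)].
by rewrite eqxx.
Qed.

Lemma primal_basic_solution_mulmx B (hB : #|B| = m) d x : basis_mx (lpA d) hB \in unitmx ->
  primal_basic_solution d hB x -> lpA d *m x = lpb d.
Proof. by move=> uA [xN xB]; rewrite (mulmx_supp hB)// xB mulKVmx. Qed.

Definition basic_cV B (hB : #|B| = m) d : 'cV[R]_n :=
  \col_j if [pick l | basis_idx hB l == j] is Some l then basic_x hB d l 0 else 0.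

Lemma basic_cV_idx B (hB : #|B| = m) d l : basic_cV hB d (basis_idx hB l) 0 = basic_x hB d l 0.
Proof.
rewrite mxE; case: pickP => [l' /eqP/basis_idx_inj -> //|/(_ l)].
by rewrite eqxx.
Qed.

Lemma basic_cV_sol B (hB : #|B| = m) d : primal_basic_solution d hB (basic_cV hB d).
Proof.
split=> [j jB|]; last by apply/matrixP => l k; rewrite ord1 mxE basic_cV_idx.
rewrite mxE; case: pickP => // l /eqP jE; move: jB.
by rewrite -jE basis_idx_in.
Qed.

(** On [B] the reduced costs vanish by the equations of the dual basic solution, so dual feasibility
    is a condition off [B] only. *)
Lemma optimal_basisP d B : optimal_basis d B <-> exists hB : #|B| = m,
  [/\ basis_mx (lpA d) hB \in unitmx, forall l, 0 <= basic_x hB d l 0 &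
      forall j, j \notin B -> 0 <= basic_slack hB d j].
Proof.
split=> -[hB []] uA.
  move=> [x [xN xB] x0] [y /(dual_basic_solutionP _ uA) -> yc]; exists hB; split=> // [l|j _].
    by rewrite /basic_x -xB mxE x0.
  by rewrite basic_slackE subr_ge0.
move=> x0 s0; exists hB; split=> //.
  exists (basic_cV hB d); first exact: basic_cV_sol.
  by move=> j; rewrite mxE; case: pickP.
exists (basic_y hB d); first exact/dual_basic_solutionP.
move=> j; rewrite -subr_ge0 -basic_slackE.
have [/(basis_idx_surj hB)[l ->]|/s0//] := boolP (j \in B).
rewrite basic_slackE subr_ge0 le_eqVlt; apply/orP; left; apply/eqP.
have /(dual_basic_solutionP _ uA) : basic_y hB d = basic_y hB d by [].
by move=> /matrixP /(_ l 0); rewrite !mxE => <-; apply: eq_bigr => i _; rewrite !mxE.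
Qed.

Lemma sum_trmx_mul p q (A : 'M[R]_(p, q)) (y : 'cV[R]_p) (x : 'cV[R]_q) :
  \sum_j (A^T *m y) j 0 * x j 0 = \sum_i y i 0 * (A *m x) i 0.
Proof.
under eq_bigr => j _ do rewrite mxE mulr_suml.
under [RHS]eq_bigr => i _ do rewrite mxE mulr_sumr.
rewrite exchange_big /=; apply: eq_bigr => i _; apply: eq_bigr => j _.
by rewrite mxE; ring.
Qed.

Definition strictly_optimal B (hB : #|B| = m) d : Prop :=
  [/\ basis_mx (lpA d) hB \in unitmx, forall l, 0 < basic_x hB d l 0 &
      forall j, j \notin B -> 0 < basic_slack hB d j].

(** Complementary slackness: a second optimal [x'] satisfies [c . x' = y' . b <= c . x = y . b], so
    [x'] vanishes where the reduced cost is positive, that is off [B]. Then [x'] is the basic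
    solution of [B], positive on [B], which forces [B] into the support set [B']. *)
Lemma strictly_optimal_unique B (hB : #|B| = m) d :
  strictly_optimal hB d -> has_unique_optimal_basis d.
Proof.
move=> [uA x0 s0]; exists B; split.
  by apply/optimal_basisP; exists hB; split=> // [l|j /s0]; apply: ltW.
move=> B' [hB' [uA' [x' px' x'0] [y' dy' y'c]]].
have Ax' := primal_basic_solution_mulmx uA' px'.
have Ax := primal_basic_solution_mulmx uA (basic_cV_sol hB d).
have [xN _] := basic_cV_sol hB d.
set x := basic_cV hB d in Ax xN; set y := basic_y hB d.
have dy : dual_basic_solution d hB y by apply/dual_basic_solutionP.
have slackB k (B1 : {set 'I_n}) (hB1 : #|B1| = m) y1 : dual_basic_solution d hB1 y1 ->
    k \in B1 -> ((lpA d)^T *m y1) k 0 = lpc d k 0.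
  move=> dy1 /(basis_idx_surj hB1)[l ->]; move/matrixP/(_ l 0) : dy1.
  by rewrite !mxE => <-; apply: eq_bigr => i _; rewrite !mxE.
have xge0 j : 0 <= x j 0.
  have [/(basis_idx_surj hB)[l ->]|/xN ->//] := boolP (j \in B).
  by rewrite basic_cV_idx ltW.
have slack_ge0 j : 0 <= (lpc d j 0 - ((lpA d)^T *m y) j 0) * x' j 0.
  rewrite mulr_ge0// subr_ge0.
  have [jB|/s0] := boolP (j \in B); first by rewrite (slackB _ _ _ _ dy jB).
  by rewrite basic_slackE subr_gt0 => /ltW.
have x'slack j : (lpc d j 0 - ((lpA d)^T *m y) j 0) * x' j 0 = 0.
  have : \sum_j (lpc d j 0 - ((lpA d)^T *m y) j 0) * x' j 0 <= 0.
    under eq_bigr do rewrite mulrBl; rewrite sumrB subr_le0.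
    rewrite [leRHS]sum_trmx_mul Ax' -Ax -sum_trmx_mul.
    have -> : \sum_i ((lpA d)^T *m y) i 0 * x i 0 = \sum_i lpc d i 0 * x i 0.
      apply: eq_bigr => i _; have [iB|/xN ->] := boolP (i \in B); last by rewrite !mulr0.
      by rewrite (slackB _ _ _ _ dy iB).
    have -> : \sum_i lpc d i 0 * x' i 0 = \sum_i ((lpA d)^T *m y') i 0 * x' i 0.
      apply: eq_bigr => i _; have [iB|iB] := boolP (i \in B').
        by rewrite (slackB _ _ _ _ dy' iB).
      by case: px' => xN' _; rewrite xN'// !mulr0.
    rewrite sum_trmx_mul Ax' -Ax -sum_trmx_mul.
    by apply: ler_sum => i _; rewrite ler_wpM2r.
  move=> le0; apply/eqP; move: le0; rewrite le_eqVlt ltNge sumr_ge0// orbF.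
  by rewrite psumr_eq0// => /allP /(_ j (mem_index_enum _)).
have x'N j : j \notin B -> x' j 0 = 0.
  move=> /s0; rewrite basic_slackE => sj; apply/eqP; move/eqP: (x'slack j).
  by rewrite mulf_eq0 gt_eqF.
have x'B : basis_cV x' hB = basic_x hB d.
  by rewrite /basic_x -Ax' (mulmx_supp hB)// mulKmx.
apply/eqP; rewrite eqEcard hB hB' leqnn andbT; apply/fintype.subsetP => j jB.
have [l jE] := basis_idx_surj hB jB.
apply: contraT => jB'; have := x0 l; rewrite -x'B mxE -jE.
by case: px' => xN' _; rewrite xN'// ltxx.
Qed.

End OptimalBasis.

Lemma lp_entryD (R : realType) m n (d e : lp_data R m n) k :
  lp_entry (d + e) k = lp_entry d k + lp_entry e k.
Proof. by case: k => [[i j]|[i|j]] /=; rewrite /lpA /lpb /lpc /= mxE. Qed.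

Lemma lp_entryZ (R : realType) m n t (d : lp_data R m n) k :
  lp_entry (t *: d) k = t * lp_entry d k.
Proof. by case: k => [[i j]|[i|j]] /=; rewrite /lpA /lpb /lpc /= mxE. Qed.

Lemma lp_entry_continuous (R : realType) m n k :
  continuous (fun d : lp_data R m n => lp_entry d k).
Proof.
case: k => [[i j]|[i|j]] d /=; rewrite /lpA /lpb /lpc.
- apply: (cvg_comp (fun d : lp_data R m n => d.1.1) (fun M => M i j)); last exact: coord_continuous.
  by apply: (cvg_comp fst fst); exact: cvg_fst.
- apply: (cvg_comp (fun d : lp_data R m n => d.1.2) (fun M => M i 0)); last exact: coord_continuous.
  by apply: (cvg_comp fst snd); [exact: cvg_fst|exact: cvg_snd].
- apply: (cvg_comp (fun d : lp_data R m n => d.2) (fun M => M j 0)); last exact: coord_continuous.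
  exact: cvg_snd.
Qed.

Lemma big_fun_continuous (R : realType) (T : topologicalType) (I : Type) (r : seq I)
    (op : R -> R -> R) (idx : R) (F : I -> T -> R) :
  (forall f g : T -> R, continuous f -> continuous g -> continuous (fun x => op (f x) (g x))) ->
  (forall i, continuous (F i)) ->
  continuous (fun x => \big[op/idx]_(i <- r) F i x).
Proof.
move=> cop cF; elim: r => [|i r IH].
  rewrite (_ : (fun x => _) = cst idx); first by move=> x; exact: cvg_cst.
  by apply/funext => x; rewrite big_nil.
rewrite (_ : (fun x => _) = fun x => op (F i x) (\big[op/idx]_(i <- r) F i x)).
  exact: cop.
by apply/funext => x; rewrite big_cons.
Qed.

Lemma det_continuous (R : realType) (T : topologicalType) n (M : T -> 'M[R]_n) :
  (forall i j, continuous (fun x => M x i j)) -> continuous (fun x => \det (M x)).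
Proof.
move=> cM; rewrite /determinant.
apply: (big_fun_continuous (op := +%R)) => [f g cf cg x|s].
  by apply: cvgD; [exact: cf|exact: cg].
move=> x; apply: cvgM; first exact: cvg_cst.
apply: (big_fun_continuous (op := *%R)) => [f g cf cg y|i]; last exact: cM.
by apply: cvgM; [exact: cf|exact: cg].
Qed.

(** Lets the intermediate value theorem for polynomials be applied along a segment of data. *)
Lemma det_add_scale_poly (R : realType) n (S Delta : 'M[R]_n) :
  exists p : {poly R}, forall t, p.[t] = \det (S + t *: Delta).
Proof.
exists (\det (map_mx polyC S + 'X *: map_mx polyC Delta)) => t.
rewrite -horner_evalE -det_map_mx; congr (\det _); apply/matrixP => i j.
by rewrite !mxE /= horner_evalE hornerD hornerM !hornerC hornerX.
Qed.

Section Minors.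
Context {R : realType} {m n : nat}.
Implicit Types (d : lp_data R m.+1 n).
Context {B : {set 'I_n}} (hB : #|B| = m.+1).

(* [minor None] is [det A_B], and [minor (Some j)] is [det A_B] times the [j]-th basic
   variable if [j] is in [B] and times the [j]-th reduced cost otherwise. *)
Definition minor_map (j : option 'I_n) :
    {k : nat & 'I_k.+1 * 'I_k.+1 -> @entry_idx m.+1 n} :=
  if j is Some j then
    if [pick l | basis_idx hB l == j] is Some l then existT _ m (primal_map hB l)
    else existT _ m.+1 (dual_map hB j)
  else existT _ m (basis_map hB).

Definition minor_mx d j := entry_mx d (projT2 (minor_map j)).

Definition minor d j := \det (minor_mx d j).

Lemma basis_idxP j : (exists l, j = basis_idx hB l) \/ j \notin B.
Proof.
by have [/(basis_idx_surj hB)|] := boolP (j \in B); [left|right].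
Qed.

Lemma minor_map_idx l : minor_map (Some (basis_idx hB l)) = existT _ m (primal_map hB l).
Proof.
rewrite /minor_map; case: pickP => [l' /eqP/basis_idx_inj -> //|/(_ l)].
by rewrite eqxx.
Qed.

Lemma minor_map_notin j : j \notin B -> minor_map (Some j) = existT _ m.+1 (dual_map hB j).
Proof.
rewrite /minor_map; case: pickP => // l /eqP <-.
by rewrite basis_idx_in.
Qed.

Lemma minor_map_inj j : injective (projT2 (minor_map j)).
Proof.
case: j => [j|]; last exact: basis_map_inj.
have [[l ->]|jB] := basis_idxP j.
  by rewrite minor_map_idx; exact: primal_map_inj.
by rewrite minor_map_notin//; exact: dual_map_inj.
Qed.

Lemma minor_map_size j : (projT1 (minor_map j) <= m.+1)%N.
Proof. by case: j => [j|] //=; case: pickP => /=. Qed.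

Lemma minor_None d : minor d None = \det (basis_mx (lpA d) hB).
Proof. by rewrite -entry_basis_mx. Qed.

Lemma minor_idx d l : basis_mx (lpA d) hB \in unitmx ->
  minor d (Some (basis_idx hB l)) = minor d None * basic_x hB d l 0.
Proof. by move=> uA; rewrite minor_None -det_primal_mx// /minor /minor_mx minor_map_idx. Qed.

Lemma minor_notin d j : basis_mx (lpA d) hB \in unitmx -> j \notin B ->
  minor d (Some j) = minor d None * basic_slack hB d j.
Proof.
by move=> uA jB; rewrite minor_None -det_dual_mx// /minor /minor_mx minor_map_notin.
Qed.

(** Multiplying a basic variable or reduced cost by the square of [det A_B] keeps its sign and makes
    it a product of two minors, a polynomial in the data. *)
Lemma strictly_optimalP d : strictly_optimal hB d <->
  minor d None != 0 /\ forall j, 0 < minor d None * minor d (Some j).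
Proof.
split=> [[uA x0 s0]|[dA H]].
  have dA : minor d None != 0 by move: uA; rewrite unitmxE unitfE minor_None.
  have d2 : 0 < minor d None * minor d None by rewrite -expr2 exprn_even_gt0.
  split=> // j; have [[l ->]|jB] := basis_idxP j.
    by rewrite minor_idx// mulrA mulr_gt0.
  by rewrite minor_notin// mulrA mulr_gt0// s0.
have uA : basis_mx (lpA d) hB \in unitmx by rewrite unitmxE unitfE -minor_None.
have d2 : 0 < minor d None * minor d None by rewrite -expr2 exprn_even_gt0.
split=> // [l|j jB].
  by have := H (basis_idx hB l); rewrite minor_idx// mulrA pmulr_rgt0.
by have := H j; rewrite minor_notin// mulrA pmulr_rgt0.
Qed.

Lemma optimal_basis_minorP d : optimal_basis d B <->
  minor d None != 0 /\ forall j, 0 <= minor d None * minor d (Some j).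
Proof.
split=> [/optimal_basisP[hB' []]|[dA H]].
  rewrite (eq_irrelevance hB' hB) => uA x0 s0.
  have dA : minor d None != 0 by move: uA; rewrite unitmxE unitfE minor_None.
  have d2 : 0 <= minor d None * minor d None by rewrite -expr2 sqr_ge0.
  split=> // j; have [[l ->]|jB] := basis_idxP j.
    by rewrite minor_idx// mulrA mulr_ge0.
  by rewrite minor_notin// mulrA mulr_ge0// s0.
apply/optimal_basisP; exists hB.
have uA : basis_mx (lpA d) hB \in unitmx by rewrite unitmxE unitfE -minor_None.
have d2 : 0 < minor d None * minor d None by rewrite -expr2 exprn_even_gt0.
split=> // [l|j jB].
  by have := H (basis_idx hB l); rewrite minor_idx// mulrA pmulr_rge0.
by have := H j; rewrite minor_notin// mulrA pmulr_rge0.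
Qed.

Lemma minor_mxD d e t j : minor_mx (d + t *: e) j = minor_mx d j + t *: minor_mx e j.
Proof. by apply/matrixP => a b; rewrite !mxE lp_entryD lp_entryZ. Qed.

(** Unless [det A_B] vanishes at the end point, some product of minors is positive at [t = 0] and at
    most [0] at [t = 1]; at a root in between, one of its two factors vanishes. *)
Lemma leave_strictly_optimal d e : strictly_optimal hB d -> ~ strictly_optimal hB (d + e) ->
  exists j, exists2 t, 0 <= t <= 1 & \det (minor_mx d j + t *: minor_mx e j) = 0.
Proof.
move=> /strictly_optimalP[d0 dj] ne.
have minorDE j : minor (d + e) j = \det (minor_mx d j + 1 *: minor_mx e j).
  by rewrite -minor_mxD scale1r.
have [z|nz] := eqVneq (minor (d + e) None) 0.
  by exists None, 1; rewrite ?ler01 ?lexx// -minorDE.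
have [j ej] : exists j, minor (d + e) None * minor (d + e) (Some j) <= 0.
  apply: contrapT => H; apply: ne; apply/strictly_optimalP; split=> // j.
  by rewrite ltNge; apply/negP => Hj; apply: H; exists j.
have [p pE] := det_add_scale_poly (minor_mx d None) (minor_mx e None).
have [q qE] := det_add_scale_poly (minor_mx d (Some j)) (minor_mx e (Some j)).
have [t t01] : exists2 t, 0 <= t <= 1 & root (- (p * q)) t.
  apply: poly_ivt => //; rewrite !hornerE !pE !qE -!minorDE !scale0r !addr0 oppr_le0 oppr_ge0 ej.
  by rewrite ltW// dj.
rewrite rootN rootM => /orP[] /rootP r0; [exists None|exists (Some j)]; exists t => //.
  by rewrite -pE.
by rewrite -qE.
Qed.

Lemma minor_continuous j : continuous (fun d => minor d j).
Proof.
apply: det_continuous => a b.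
rewrite (_ : (fun d => _) = (fun d => lp_entry d (projT2 (minor_map j) (a, b)))).
  exact: lp_entry_continuous.
by apply/funext => d; rewrite mxE.
Qed.

Lemma strictly_optimal_nbhs d : strictly_optimal hB d -> \forall e \near d, strictly_optimal hB e.
Proof.
move=> /strictly_optimalP[d0 dj].
have H0 : \forall e \near d, minor e None != 0.
  have c := @minor_continuous None d.
  by apply: (c [set x | x != 0]); apply: open_nbhs_nbhs; split; [exact: open_neq|].
have Hj j : \forall e \near d, 0 < minor e None * minor e (Some j).
  have c : continuous (fun e => minor e None * minor e (Some j)).
    by move=> e; apply: cvgM; exact: minor_continuous.
  apply: (c d [set x | 0 < x]); apply: open_nbhs_nbhs; split; first exact: open_gt.
  exact: dj.
have : \forall e \near d, forall j, 0 < minor e None * minor e (Some j).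
  exact: filter_forall Hj.
by apply: filterS2 H0 => e e0 ej; apply/strictly_optimalP.
Qed.

End Minors.

(** * The condition number *)

(** Through the injection [g], the column is part of a column of [lp_mx d], whose 2-norm is at most
    the operator norm. This is how the norm of the data controls the columns of all minors. *)
Lemma entry_mx_col_le (R : realType) m n (d : lp_data R m n) k (f : 'I_k * 'I_k -> entry_idx)
    (c : 'I_k) : (exists2 g : 'I_k -> 'I_(1 + m), injective g &
      exists j, forall i, lp_entry d (f (i, c)) = lp_mx d (g i) j) ->
  l2norm (col c (entry_mx d f)) <= lp_norm d.
Proof.
move=> [g g_inj [j gE]]; apply: le_trans (l2norm_col_le_opnorm12 (lp_mx d) j).
rewrite ler_wsqrtr//.
have -> : \sum_i col c (entry_mx d f) i 0 ^+ 2 = \sum_i col j (lp_mx d) (g i) 0 ^+ 2.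
  apply: eq_bigr => i _; have colME p q (M : 'M[R]_(p, q)) a b : col b M a 0 = M a b.
    by rewrite mxE.
  by rewrite !colME -gE [entry_mx _ _ _ _]mxE.
rewrite [leRHS](bigID (mem (codom g)))/= -[leLHS]addr0 lerD//; last first.
  by rewrite sumr_ge0// => i _; rewrite sqr_ge0.
rewrite -big_uniq /=; last by rewrite map_inj_uniq// enum_uniq.
by rewrite big_image.
Qed.

Section ConditionBound.
Context {R : realType} {m n : nat}.
Implicit Types (d e : lp_data R m.+1 n).
Context {B : {set 'I_n}} (hB : #|B| = m.+1).

Lemma minor_mx_col_le d j c : l2norm (col c (minor_mx hB d j)) <= lp_norm d.
Proof.
have colA (k : 'I_n) i : lpA d i k = lp_mx d (rshift 1 i) (lshift 1 k).
  by rewrite /lp_mx block_mxEdl.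
have colb i : lpb d i 0 = lp_mx d (rshift 1 i) (rshift n 0).
  by rewrite /lp_mx block_mxEdr.
have colc (k : 'I_n) : lpc d k 0 = lp_mx d (lshift m.+1 0) (lshift 1 k).
  by rewrite /lp_mx block_mxEul mxE.
apply: entry_mx_col_le; move: c; rewrite /minor_map.
case: j => [j|].
  case: pickP => [l _|_] c /=.
    exists (@rshift 1 m.+1); first exact: rshift_inj.
    have [cl|cl] := eqVneq c l.
      by exists (rshift n 0) => i; rewrite /primal_map /= cl eqxx /= colb.
    by exists (lshift 1 (basis_idx hB c)) => i; rewrite /primal_map /= (negbTE cl) /= colA.
  exists (fun i : 'I_(1 + m.+1) => i); first by [].
  exists (lshift 1 (dual_col hB j c)) => i; rewrite /dual_map /=.
  rewrite -[X in _ = lp_mx d X _](@splitK 1 m.+1 i); case: (@fintype.split 1 m.+1 i) => i' /=; last by rewrite colA.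
  by rewrite (ord1 i') colc.
move=> c /=; exists (@rshift 1 m.+1); first exact: rshift_inj.
by exists (lshift 1 (basis_idx hB c)) => i; rewrite /basis_map /= colA.
Qed.

(** Strict optimality is an open condition inside [U], so such points are interior to [U]. *)
Lemma Sigma_U_not_strictly_optimal e : Sigma_U e -> ~ strictly_optimal hB e.
Proof.
move=> [_ ni] se; apply: ni; apply: filterS (strictly_optimal_nbhs se) => e'.
exact: strictly_optimal_unique.
Qed.

Lemma minorZ t d j : minor hB (t *: d) j = t ^+ (projT1 (minor_map hB j)).+1 * minor hB d j.
Proof.
rewrite /minor -detZ; congr (\det _); apply/matrixP => a b.
by rewrite !mxE lp_entryZ.
Qed.

Lemma strictly_optimalZ t d : 0 < t -> strictly_optimal hB d -> strictly_optimal hB (t *: d).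
Proof.
move=> t0 /strictly_optimalP[d0 dj]; apply/strictly_optimalP.
have tn0 k : 0 < t ^+ k by rewrite exprn_gt0.
split=> [|j]; rewrite minorZ; first by rewrite mulf_neq0// gt_eqF.
by rewrite minorZ mulrACA mulr_gt0// mulr_gt0.
Qed.

(** The points [t d] with small [t > 0] are in [U] and tend to [0], where no [A_B] is invertible. It
    makes the set defining [rho d] nonempty. *)
Lemma Sigma_U0 d : strictly_optimal hB d -> Sigma_U (0 : lp_data R m.+1 n).
Proof.
move=> sd; split.
  have c : (fun t : R => t *: d) @ nbhs (0 : R) --> (0 : R) *: d by exact: scalel_continuous.
  rewrite scale0r in c => V /c V0.
  have [t [t0 Vt]] : exists t : R, 0 < t /\ V (t *: d).
    have H : \forall t \near (0 : R)^'+, V (t *: d) by exact: cvg_at_right_filter V0.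
    have H' : \forall t \near (0 : R)^'+, 0 < t by exact: nbhs_right_gt.
    by have [t] := filter_ex (filterI H' H); exists t.
  exists (t *: d); split => //.
  exact: strictly_optimal_unique (strictly_optimalZ t0 sd).
move=> /interior_subset [B' [[hB' [+ _ _]] _]].
rewrite unitmxE unitfE (_ : basis_mx _ _ = 0) ?det0 ?eqxx//.
by apply/matrixP => a b; rewrite !mxE.
Qed.

End ConditionBound.

Section PointwiseBound.
Context {R : realType} {m n : nat}.
Implicit Types (d e : lp_data R m.+1 n).
Context {B : {set 'I_n}} (hB : #|B| = m.+1).
Context {dsp : measure_display} {T : measurableType dsp}.
Variables (P : probability T R) (Z : @entry_idx m.+1 n -> T -> R) (A : R).
Hypothesis HZ : iid_normal P Z.
Hypothesis A0 : 0 < A.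
Local Open Scope ereal_scope.

(* The auxiliary Gaussian vector is read off the diagonal entries of [Z], an
   independent copy of the data. *)
Definition solve_term d j : \bar R :=
  2%:E * \int[P]_w (lnp (4 * @normal_peak R 1 * Num.sqrt (projT1 (minor_map hB j)).+1%:R / A *
    solve_norm (minor_mx hB d j) (\col_r Z (projT2 (minor_map hB j) (r, r)) w)))%:E.

Definition total_solve_term d := \sum_(j : option 'I_n) solve_term d j.

Lemma solve_term_ge0 d j : 0 <= solve_term d j.
Proof. by rewrite mule_ge0// integral_ge0// => w _; rewrite lee_fin lnp_ge0. Qed.

Lemma iid_normal_diag j : iid_normal P (fun r => Z (projT2 (minor_map hB j) (r, r))).
Proof. by apply: iid_normal_comp HZ => r r' /minor_map_inj[]. Qed.

(** The perturbation is shortened by a factor [t <= 1] until some minor is singular. Summing over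
    all minors makes the right side independent of [delta]. *)
Lemma lnp_le_total_solve_term d (delta : lp_data R m.+1 n) (e : R) : strictly_optimal hB d ->
  Sigma_U (d + delta)%R -> (lp_norm delta <= e)%R -> (0 < e)%R ->
  (lnp (A * e)^-1)%:E <= total_solve_term d.
Proof.
move=> sd sig de e0.
have [j [t /andP[t0 t1] tdet]] := leave_strictly_optimal sd (@Sigma_U_not_strictly_optimal _ _ _ _ hB _ sig).
have uj : minor_mx hB d j \in unitmx.
  rewrite unitmxE unitfE -/(minor hB d j); have /strictly_optimalP[d0 dj] := sd.
  case: j {tdet} => [j|] //; apply: contraTneq (dj j) => ->.
  by rewrite mulr0 ltxx.
apply: (@le_trans _ _ (solve_term d j)); last first.
  by rewrite /total_solve_term (bigD1 j)//= leeDl// sume_ge0// => i _; exact: solve_term_ge0.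
apply: (lnp_le_expected_solve uj tdet _ e0 A0 (iid_normal_diag j)) => c.
have -> : col c (t *: minor_mx hB delta j)%R = (t *: col c (minor_mx hB delta j))%R.
  by apply/matrixP => a b; rewrite !mxE.
rewrite l2normZ ger0_norm//; apply: le_trans de.
have := @minor_mx_col_le _ _ _ _ hB delta j c; apply: le_trans.
by rewrite ler_piMl ?l2norm_ge0.
Qed.

(** If the total is a finite [r], every [delta] reaching [Sigma_U] has norm at least
    [1 / (A exp r)], hence so does [rho d]; an infinite total leaves nothing to prove. *)
Lemma lne_cond_number_le d : strictly_optimal hB d ->
  lne (cond_number d) <= (ln (lp_norm d) + ln A)%:E + total_solve_term d.
Proof.
move=> sd; have key := lnp_le_total_solve_term sd.
have tot0 : 0 <= total_solve_term d by apply: sume_ge0 => j _; exact: solve_term_ge0.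
case: (total_solve_term d) tot0 key => [r| |] //; last by move=> _ _; rewrite addey// leey.
rewrite lee_fin => r0 key; rewrite -EFinD.
pose e0 : R := (A * expR r)^-1%R.
have e00 : (0 < e0)%R by rewrite invr_gt0 mulr_gt0 ?expR_gt0.
have lb (delta : lp_data R m.+1 n) : Sigma_U (d + delta)%R -> (e0 <= lp_norm delta)%R.
  move=> sig; rewrite leNgt; apply/negP => de0.
  (* The maximum provides a positive [e < e0] even when [delta] has norm [0]. *)
  pose e := Num.max (lp_norm delta) (e0 / 2)%R.
  have ee0 : (e < e0)%R by rewrite gt_max de0 /=; lra.
  have egt0 : (0 < e)%R by rewrite lt_max; apply/orP; right; lra.
  have := key delta e sig; rewrite le_max lexx /= => /(_ isT egt0).
  rewrite lee_fin leNgt => /negP; apply; apply: lt_le_trans (ln_le_lnp _).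
  rewrite -ltr_expR lnK ?posrE ?invr_gt0 ?mulr_gt0//.
  rewrite -[ltLHS]invrK ltf_pV2 ?posrE ?invr_gt0 ?mulr_gt0 ?expR_gt0//.
  by rewrite -ltr_pdivlMl// -invfM mulrC mulrC.
have rho_ge : (e0 <= rho d)%R.
  apply: lb_le_inf.
    by exists (lp_norm (- d)%R), (- d)%R => //=; rewrite subrr; exact: Sigma_U0 sd.
  by move=> _ [delta /= sig <-]; exact: lb.
have rho0 : (0 < rho d)%R by exact: lt_le_trans rho_ge.
rewrite /cond_number inver gt_eqF// -EFinM.
have [N0|N0] := leP (lp_norm d / rho d)%R 0%R; first by rewrite le0_lneNy// leNye.
rewrite lne_EFin// lee_fin.
have N00 : (0 < lp_norm d)%R by move: N0; rewrite pmulr_lgt0// invr_gt0.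
rewrite ln_div ?posrE// -addrA lerD2l lerNl opprD.
apply: (@le_trans _ _ (ln e0)); last by rewrite ler_ln ?posrE.
by rewrite /e0 lnV ?posrE ?mulr_gt0 ?expR_gt0// lnM ?posrE ?expR_gt0// expRK opprD.
Qed.

End PointwiseBound.

(** * Sign symmetry *)

Definition lp_of (R : realType) m n (x : @entry_idx m n -> R) : lp_data R m n :=
  (\matrix_(i, j) x (inl (i, j)), \col_i x (inr (inl i)), \col_j x (inr (inr j))).

Lemma lp_entry_lp_of (R : realType) m n (x : @entry_idx m n -> R) k :
  lp_entry (lp_of x) k = x k.
Proof. by case: k => [[i j]|[i|j]] /=; rewrite /lpA /lpb /lpc /= mxE. Qed.

Lemma lp_ofK (R : realType) m n (d : lp_data R m n) : lp_of (lp_entry d) = d.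
Proof.
case: d => [[A b] c]; congr (_, _, _); apply/matrixP => i j; rewrite ?ord1 mxE //.
Qed.

Lemma det_mul_diag (R : realType) k (S : 'M[R]_k) (a : 'I_k -> R) :
  \det (S *m diag_mx (\row_c a c)) = \prod_c a c * \det S.
Proof.
rewrite det_mulmx det_diag mulrC; congr (_ * _).
by apply: eq_bigr => c _; rewrite mxE.
Qed.

(** [(S D)^-1 = D S^-1] for a diagonal sign matrix [D], which preserves the 2-norm. *)
Lemma solve_norm_sign (R : realType) k (S : 'M[R]_k) (s : 'I_k -> bool) h :
  solve_norm (S *m diag_mx (\row_c (-1) ^+ s c)) h = solve_norm S h.
Proof.
pose D : 'M[R]_k := diag_mx (\row_c (-1) ^+ s c); rewrite -/D.
have DD : D *m D = 1%:M.
  apply/matrixP => i j; rewrite mul_diag_mx !mxE.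
  case: (i =P j) => [->|_]; last by rewrite !mulr0n mulr0.
  by rewrite mulr1n -signr_addb addbb.
have uD : D \in unitmx by case: (mulmx1_unit DD).
have [uS|nuS] := boolP (S \in unitmx).
  have uSD : S *m D \in unitmx by rewrite unitmx_mul uS.
  rewrite !solve_norm_unit//.
  have -> : invmx (S *m D) *m h = D *m (invmx S *m h).
    apply: (can_inj (mulKmx uSD)); rewrite mulKVmx// -mulmxA (mulmxA D) DD mul1mx.
    by rewrite mulKVmx.
  rewrite /l2norm; congr Num.sqrt; apply: eq_bigr => i _.
  by rewrite mul_diag_mx !mxE exprMn sqrr_sign mul1r.
have S0 : \det S = 0 by apply/eqP; move: nuS; rewrite unitmxE unitfE negbK.
by rewrite /solve_norm det_mulmx S0 mul0r normr0 invr0 !mulr0.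
Qed.

Section Flips.
Context {R : realType} {m n : nat}.
Implicit Types (s : 'I_n -> bool) (d : lp_data R m.+1 n).

Definition entry_sign s (k : @entry_idx m.+1 n) : bool :=
  match k with inl (_, j) => s j | inr (inl _) => false | inr (inr j) => s j end.

Definition flip s (x : @entry_idx m.+1 n -> R) : @entry_idx m.+1 n -> R :=
  fun k => (-1) ^+ entry_sign s k * x k.

Context {B : {set 'I_n}} (hB : #|B| = m.+1).

(** The sign depends only on the column of the minor, so a flip multiplies the minor on the right by
    a diagonal sign matrix. *)
Lemma entry_sign_minor_map s j i c :
  entry_sign s (projT2 (minor_map hB j) (i, c)) =
  entry_sign s (projT2 (minor_map hB j) (ord0, c)).
Proof.
move: i c; rewrite /minor_map; case: j => [j|] //; case: pickP => [l _|_] i c /=.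
  by rewrite /primal_map /=; case: eqP.
by rewrite /dual_map /=; case: fintype.split; case: fintype.split.
Qed.

Definition minor_sign s j c := entry_sign s (projT2 (minor_map hB j) (ord0, c)).

Lemma minor_mx_flip s x j : minor_mx hB (lp_of (flip s x)) j =
  minor_mx hB (lp_of x) j *m diag_mx (\row_c (-1) ^+ @minor_sign s j c).
Proof.
apply/matrixP => i c; rewrite mul_mx_diag !mxE !lp_entry_lp_of /flip mulrC.
by rewrite entry_sign_minor_map.
Qed.

Definition sign_minor (x : @entry_idx m.+1 n -> R) (j : 'I_n) : R :=
  minor hB (lp_of x) None * minor hB (lp_of x) (Some j).

Lemma minor_flip s x j : minor hB (lp_of (flip s x)) j =
  \prod_c (-1) ^+ @minor_sign s j c * minor hB (lp_of x) j.
Proof. by rewrite /minor minor_mx_flip (@det_mul_diag _ _ _ (fun c => (-1) ^+ @minor_sign s j c)). Qed.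

(** The signs of the columns of [A_B] occur in both minors and cancel, except one: if [j] is in [B],
    its column is replaced by the unsigned [b] in the second minor; otherwise the second minor has
    the extra column [(c_j, a_j)]. *)
Lemma sign_minor_flip s x j : sign_minor (flip s x) j = (-1) ^+ s j * sign_minor x j.
Proof.
rewrite /sign_minor !minor_flip mulrACA; congr (_ * _).
have sq (e : bool) (a b : R) : (-1) ^+ e * a * ((-1) ^+ e * b) = a * b.
  by rewrite mulrACA -signr_addb addbb mul1r.
rewrite /minor_sign; have [[l ->]|jB] := basis_idxP hB j.
  rewrite minor_map_idx /= /basis_map /primal_map /= (bigD1 l)//= [X in _ * X](bigD1 l)//=.
  rewrite eqxx /= expr0 mul1r -mulrA -[RHS]mulr1; congr (_ * _).
  rewrite -big_split /= big1// => c /negbTE cl; rewrite cl /=.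
  by rewrite -signr_addb addbb.
rewrite minor_map_notin//= /basis_map /dual_map /= (@big_split_ord _ _ _ 1 m.+1) /= big_ord1.
rewrite mulrCA -[RHS]mulr1; congr (_ * _).
  by case: fintype.split => a /=; rewrite /dual_col (unsplitK (inl _)).
rewrite -big_split /= big1// => c _.
set e := entry_sign _ _; have -> : e = s (basis_idx hB c); last by rewrite -signr_addb addbb.
by rewrite /e; case: fintype.split => a /=; rewrite /dual_col (unsplitK (inr c)).
Qed.

End Flips.

Lemma measure_exists_null d (T : measurableType d) (R : realType)
    (P : {measure set T -> \bar R}) (I : finType) (F : I -> set T) :
  (forall i, measurable (F i)) -> (forall i, P (F i) = 0%E) ->
  measurable [set w | exists i, F i w] /\ P [set w | exists i, F i w] = 0%E.
Proof.
move=> mF F0.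
rewrite (_ : mkset _ = \big[setU/set0]_(i : I) F i); last first.
  rewrite -classical_sets.bigcup_seq; apply/seteqP; split=> w /=.
    by move=> [i Fw]; exists i => //=; rewrite mem_index_enum.
  by move=> [i _ Fw]; exists i.
elim: (index_enum I) => [|i r [mr r0]].
  by rewrite big_nil; split; [exact: measurable0|exact: measure0].
rewrite big_cons; split; first exact: measurableU.
by rewrite measureU0.
Qed.

Section Orthants.
Context {R : realType} {m n : nat}.
Context {B : {set 'I_n}} (hB : #|B| = m.+1).
Local Notation K := (@entry_idx m.+1 n).
Local Open Scope ereal_scope.

Lemma measurable_minor_mx j a c :
  measurable_fun setT (fun x : coord_space R K => minor_mx hB (lp_of x) j a c).
Proof.
rewrite (_ : (fun x : coord_space R K => _) = (fun x => x (projT2 (minor_map hB j) (a, c)))).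
  exact: measurable_coord.
by apply/funext => x; rewrite mxE lp_entry_lp_of.
Qed.

Lemma measurable_minor j :
  measurable_fun setT (fun x : coord_space R K => minor hB (lp_of x) j).
Proof. by apply: measurable_det => a c; exact: measurable_minor_mx. Qed.

Lemma measurable_sign_minor j :
  measurable_fun setT (fun x : coord_space R K => sign_minor hB x j).
Proof. by apply: measurable_funM; exact: measurable_minor. Qed.

Definition strict_set : set (coord_space R K) :=
  [set x | minor hB (lp_of x) None != 0%R /\ forall j, (0 < sign_minor hB x j)%R].

Definition degenerate_set : set (coord_space R K) :=
  [set x | exists j, minor hB (lp_of x) j = 0%R].

Lemma strict_setP x : strict_set x <-> strictly_optimal hB (lp_of x).
Proof. by rewrite strictly_optimalP. Qed.

Lemma measurable_strict_set : measurable strict_set.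
Proof.
apply: measurableI.
  rewrite -[X in measurable X]setTI.
  apply: (@measurable_minor None measurableT [set x | x != 0%R]).
  rewrite (_ : mkset _ = ~` [set 0%R]); first exact: measurableC.
  by apply/seteqP; split=> x /= => [/eqP|/eqP].
apply: (@measurable_forall _ _ (coord_space R K) (fun j x => 0 < sign_minor hB x j)%R) => j.
rewrite -[X in measurable X]setTI.
apply: (@measurable_sign_minor j measurableT [set x | 0 < x]%R).
rewrite (_ : mkset _ = `]0%R, +oo[%classic) //.
by apply/seteqP; split=> x /=; rewrite in_itv /= andbT.
Qed.

Lemma measurable_degenerate_set : measurable degenerate_set.
Proof.
rewrite -[X in measurable X]setCK; apply: measurableC.
rewrite (_ : ~` _ = [set x | forall j, minor hB (lp_of x) j != 0%R]).
  apply: (@measurable_forall _ _ (coord_space R K) (fun j x => minor hB (lp_of x) j != 0)%R) => j.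
  rewrite -[X in measurable X]setTI.
  apply: (@measurable_minor j measurableT [set x | x != 0%R]).
  rewrite (_ : mkset _ = ~` [set 0%R]); first exact: measurableC.
  by apply/seteqP; split=> x /= => [/eqP|/eqP].
apply/seteqP; split=> x /= H.
  by move=> j; apply/eqP => j0; apply: H; exists j.
by move=> [j /eqP]; apply/negP; exact: H.
Qed.

(* Flipping by it makes all the [sign_minor]s positive. *)
Definition sign_pattern (x : coord_space R K) : {ffun 'I_n -> bool} :=
  [ffun j => sign_minor hB x j < 0]%R.

Lemma strict_set_flip (x : coord_space R K) (s : {ffun 'I_n -> bool}) :
  ~ degenerate_set x -> strict_set (flip s x) <-> s = sign_pattern x.
Proof.
move=> ndx.
have m0 j : minor hB (lp_of x) j != 0%R by apply/eqP => j0; apply: ndx; exists j.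
have q0 j : sign_minor hB x j != 0%R by rewrite mulf_neq0.
split=> [[_ H]|->].
  apply/ffunP => j; rewrite ffunE; have := H j; rewrite sign_minor_flip.
  case: (s j); rewrite ?expr1 ?expr0 ?mulN1r ?mul1r ?oppr_gt0.
    by move=> ->.
  by move=> /ltW; rewrite leNgt => /negbTE.
split=> [|j].
  rewrite minor_flip mulf_neq0//; apply/prodf_neq0 => c _.
  by rewrite signr_eq0.
rewrite sign_minor_flip ffunE; case: (ltP (sign_minor hB x j) 0%R) => [|le0q]; first by rewrite expr1 mulN1r oppr_gt0.
by rewrite expr0 mul1r lt_neqAle eq_sym q0.
Qed.

(** Covers degenerate points too, so the sum of indicators over all flips is at most [1]
    everywhere. *)
Lemma strict_set_flip_unique (x : coord_space R K) (s s' : {ffun 'I_n -> bool}) :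
  strict_set (flip s x) -> strict_set (flip s' x) -> s = s'.
Proof.
move=> [_ H] [_ H']; apply/ffunP => j.
have := H j; have := H' j; rewrite !sign_minor_flip.
case: (s j); case: (s' j) => //; rewrite ?expr1 ?expr0 ?mulN1r ?mul1r ?oppr_gt0.
  by move=> /ltW; rewrite leNgt => /negbTE ->.
by move=> qj /ltW; rewrite leNgt qj.
Qed.

Context {d : measure_display} {T : measurableType d}.
Variables (P : probability T R) (X : K -> T -> R).
Hypothesis HX : iid_normal P X.
Local Notation XX w := ((fun k => X k w) : coord_space R K).

Lemma measurable_pullback (A : set (coord_space R K)) : measurable A ->
  measurable [set w | A (XX w)].
Proof.
move=> mA; have [mX _] := HX; rewrite -[Y in measurable Y]setTI.
exact: (measurable_family mX).
Qed.

Lemma degenerate_null : P [set w | degenerate_set (XX w)] = 0.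
Proof.
have E j : P [set w | minor hB (lp_of (XX w)) j = 0%R] = 0.
  have := iid_normal_det (iid_normal_comp (@minor_map_inj m n B hB j) HX).
  congr (P _ = 0); apply/seteqP; split=> w /= <-; congr (\det _);
  by apply/matrixP => a c; rewrite !mxE lp_entry_lp_of.
have mE j : measurable [set w | minor hB (lp_of (XX w)) j = 0%R].
  apply: (@measurable_pullback [set x | minor hB (lp_of x) j = 0%R]).
  rewrite -[Y in measurable Y]setTI.
  exact: (@measurable_minor j measurableT [set 0%R]).
by have [_] := measure_exists_null mE E.
Qed.

Lemma integral_strict_set_flip (G : coord_space R K -> \bar R) (s : 'I_n -> bool) :
  measurable_fun setT G -> (forall x, 0 <= G x) -> (forall x, G (flip s x) = G x) ->
  \int[P]_w ((\1_strict_set (flip s (XX w)))%:E * G (XX w)) =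
  \int[P]_w ((\1_strict_set (XX w))%:E * G (XX w)).
Proof.
move=> mG G0 Gs.
pose F (x : coord_space R K) := (\1_strict_set x)%:E * G x.
have mF : measurable_fun setT F.
  by apply: emeasurable_funM => //; apply/measurable_EFinP; apply: measurable_indic; exact: measurable_strict_set.
have F0 x : 0 <= F x by rewrite mule_ge0// lee_fin.
have := iid_normal_transfer (iid_normal_sign (entry_sign s) HX) HX mF F0.
move=> <-; apply: eq_integral => w _; rewrite /F.
by rewrite [X in _ = _ * X](Gs (XX w)).
Qed.

End Orthants.

Section OrthantBound.
Context {R : realType} {m n : nat}.
Context {B : {set 'I_n}} (hB : #|B| = m.+1).
Local Notation K := (@entry_idx m.+1 n).
Context {d : measure_display} {T : measurableType d}.
Variables (P : probability T R) (X : K -> T -> R).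
Hypothesis HX : iid_normal P X.
Local Notation XX w := ((fun k => X k w) : coord_space R K).
Local Notation pattern := ({ffun 'I_n -> bool} : finType).
Local Open Scope ereal_scope.

Lemma measurable_flip (s : 'I_n -> bool) :
  measurable_fun setT (flip s : coord_space R K -> coord_space R K).
Proof.
apply: measurable_family => k; apply: measurable_funM; first exact: measurable_cst.
exact: measurable_coord.
Qed.

Lemma measurable_strict_indic_flip (s : 'I_n -> bool) :
  measurable_fun setT (fun w => (\1_(strict_set hB) (flip s (XX w)))%:E : \bar R).
Proof.
have [mX _] := HX; apply/measurable_EFinP.
have mI : measurable_fun setT (\1_(strict_set hB) : coord_space R K -> R).
  by apply: measurable_indic; exact: measurable_strict_set.
exact: (measurableT_comp mI (measurableT_comp (measurable_flip s) (measurable_family mX))).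
Qed.

Lemma sum_strict_indic_flip_le1 (x : coord_space R K) :
  (\sum_(s : pattern) (\1_(strict_set hB) (flip s x)) <= 1 :> R)%R.
Proof.
have [[s Hs]|H] := pselect (exists s : pattern, strict_set hB (flip s x)).
  rewrite (bigD1 s)//= big1 ?addr0; first by rewrite indicE; case: (_ \in _).
  move=> s' ss'; rewrite indicE memNset// => Hs'.
  by move/eqP: ss'; apply; exact: strict_set_flip_unique Hs' Hs.
rewrite big1 ?ler01// => s _; rewrite indicE memNset// => Hs.
by apply: H; exists s.
Qed.

(** All [C] flips of the integrand have the same integral [I]. At most one flip of a point lies in
    [strict_set], so [C I] is at most the integral of [G]; almost every point has such a flip, so
    [C] times the probability of [strict_set] is at least [1]. Multiply the two. *)
Lemma integral_strict_set_le (G : coord_space R K -> \bar R) :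
  measurable_fun setT G -> (forall x, 0 <= G x) ->
  (forall s x, G (flip s x) = G x) ->
  \int[P]_w ((\1_(strict_set hB) (XX w))%:E * G (XX w)) <=
  P [set w | strict_set hB (XX w)] * \int[P]_w G (XX w).
Proof.
move=> mG G0 Gs; have [mX _] := HX.
have ind0 (x : coord_space R K) : 0 <= (\1_(strict_set hB) x)%:E :> \bar R by rewrite lee_fin.
(* The number [2^n] of sign patterns, kept as a sum of ones. *)
pose C : \bar R := \sum_(s : pattern) 1.
have Csum (a : \bar R) : 0 <= a -> \sum_(s : pattern) a = C * a.
  by move=> a0; rewrite ge0_sume_distrl//; apply: eq_bigr => s _; rewrite mul1e.
have mGX : measurable_fun setT (fun w => G (XX w)) by exact: measurableT_comp mG (measurable_family mX).
have sum_le (H : coord_space R K -> \bar R) : measurable_fun setT H -> (forall x, 0 <= H x) -> (forall s (x : coord_space R K), H (flip s x) = H x) ->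
    C * \int[P]_w ((\1_(strict_set hB) (XX w))%:E * H (XX w)) =
    \int[P]_w (\sum_(s : pattern) (\1_(strict_set hB) (flip s (XX w)))%:E * H (XX w)).
  move=> mH H0 Hs; rewrite -Csum; last by apply: integral_ge0 => w _; rewrite mule_ge0.
  have mHX : measurable_fun setT (fun w => H (XX w)) by exact: measurableT_comp mH (measurable_family mX).
  rewrite ge0_integral_sum; first last.
  - by move=> s w _; apply: mule_ge0; [exact: ind0|exact: H0].
  - move=> s; apply: emeasurable_funM; last exact: mHX.
    exact: measurable_strict_indic_flip.
  - exact: measurableT.
  by apply: eq_bigr => s _; symmetry; apply: integral_strict_set_flip.
have H1 : C * \int[P]_w ((\1_(strict_set hB) (XX w))%:E * G (XX w)) <= \int[P]_w G (XX w).
  rewrite sum_le//; apply: ge0_le_integral => //.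
  - by move=> w _; apply: sume_ge0 => s _; rewrite mule_ge0.
  - apply: emeasurable_sum => s; apply: emeasurable_funM => //.
    exact: measurable_strict_indic_flip.
  - move=> w _; rewrite -ge0_sume_distrl// sumEFin -[leRHS]mul1e lee_wpmul2r//.
    by rewrite lee_fin sum_strict_indic_flip_le1.
have mS := measurable_pullback HX (measurable_strict_set hB).
have mD := measurable_pullback HX (measurable_degenerate_set hB).
have mDC := measurableC mD.
have H2 : 1 <= C * P [set w | strict_set hB (XX w)].
  have -> : P [set w | strict_set hB (XX w)] =
      \int[P]_w ((\1_(strict_set hB) (XX w))%:E * cst 1 (XX w)).
    transitivity (\int[P]_w (\1_[set w | strict_set hB (XX w)] w)%:E).
      by rewrite integral_indic ?setIT.
    by apply: eq_integral => w _; rewrite mule1.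
  rewrite sum_le//.
  apply: (@le_trans _ _ (\int[P]_w (\1_(~` [set w | degenerate_set hB (XX w)]) w)%:E)).
    have PD : P (~` [set w | degenerate_set hB (XX w)]) = 1.
      by rewrite probability_setC// (degenerate_null hB HX) sube0.
    by rewrite integral_indic ?setIT// [leRHS]PD.
  apply: ge0_le_integral => //.
  - by apply/measurable_EFinP; exact: measurable_indic.
  - apply: emeasurable_sum => s; apply: emeasurable_funM => //.
    exact: measurable_strict_indic_flip.
  - move=> w _; rewrite indicE; case: (boolP (_ \in _)) => [|_]; last first.
      by apply: sume_ge0 => s _; rewrite mule_ge0.
    rewrite inE /= => nd.
    rewrite (bigD1 (sign_pattern hB (XX w)))//= mule1 indicE mem_set; last first.
      by apply/(strict_set_flip (sign_pattern hB (XX w)) nd).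
    by rewrite leeDl// sume_ge0// => s _; rewrite mule_ge0.
have a0 : 0 <= \int[P]_w ((\1_(strict_set hB) (XX w))%:E * G (XX w)).
  by apply: integral_ge0 => w _; rewrite mule_ge0.
rewrite -[leLHS]mul1e; apply: le_trans (lee_wpmul2r a0 H2) _.
by rewrite [X in X * _]muleC -muleA; apply: lee_wpmul2l.
Qed.

End OrthantBound.

(** * Expectation of the condition number *)

Lemma gaussian_data_iid_normal d (T : measurableType d) (R : realType) (P : probability T R)
    m n (D : T -> lp_data R m n) :
  gaussian_data P D -> iid_normal P (fun k w => lp_entry (D w) k).
Proof.
move=> [ind std]; split=> [k|E mE]; first by have [] := std k.
have := ind [set: _]%SET E mE.
rewrite (_ : \bigcap_(i in _) _ = [set w | forall k, E k (lp_entry (D w) k)]); last first.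
  apply/seteqP; split=> w /= H k; first by apply: H; rewrite /= inE.
  by move=> _; exact: H.
move=> ->; apply: eq_big => [k|k _]; first by rewrite inE.
by have [_ ->] := std k.
Qed.

(** Simple functions below [f^+] on [D] are below [g], so [f] may be arbitrary; this is how
    [lne (cond_number _)] enters. *)
Lemma le_integral_set d (T : measurableType d) (R : realType) (mu : {measure set T -> \bar R})
    (D : set T) (f g : T -> \bar R) : (forall x, 0 <= g x)%E -> (forall x, D x -> f x <= g x)%E ->
  (\int[mu]_(x in D) f x <= \int[mu]_x g x)%E.
Proof.
move=> g0 fg; rewrite integralE.
apply: (@le_trans _ _ (\int[mu]_(x in D) (f^\+ x))%E).
  by rewrite geeDl// oppe_le0; apply: integral_ge0.
rewrite !ge0_integralE//; apply: le_ereal_sup => _ [h hf <-]; exists h => // x.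
apply: le_trans (hf x) _; rewrite patch_setT patchE; case: ifP => [|_]; last exact: g0.
by rewrite inE => Dx; rewrite funeposE ge_max g0 andbT; exact: fg.
Qed.

Lemma eq_lee (R : realType) (x y : \bar R) : x = y -> (x <= y)%E.
Proof. by move=> ->. Qed.

Section BoundFunction.
Context {R : realType} {m n : nat}.
Context {B : {set 'I_n}} (hB : #|B| = m.+1).
Local Notation K := (@entry_idx m.+1 n).
Context {d : measure_display} {T : measurableType d}.
Variables (P : probability T R) (X : K -> T -> R).
Hypothesis HX : iid_normal P X.
Local Notation XX w := ((fun k => X k w) : coord_space R K).
Local Notation beta := (@normal_peak R 1).
Local Open Scope ereal_scope.

(** The expectation of the term of a minor of size [k <= m + 2] is at most [16 beta^2 k sqrt (6/5)]
    divided by this scale, that is at most [1 / (n + 1)]. *)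
Definition solve_scale : R := n.+1%:R * m.+2%:R * (16 * beta ^+ 2 * Num.sqrt (6 / 5)).

Lemma solve_scale_gt0 : (0 < solve_scale)%R.
Proof.
have b0 : (0 < beta)%R by apply: normal_peak_gt0; exact: oner_neq0.
by rewrite !mulr_gt0 ?ltr0n// ?exprn_gt0// sqrtr_gt0; lra.
Qed.

Local Notation term := (total_solve_term hB P X solve_scale).

Lemma measurable_solve_term j :
  measurable_fun setT (fun x : coord_space R K => solve_term hB P X solve_scale (lp_of x) j).
Proof.
have [mX _] := HX.
apply: emeasurable_funM; first exact: measurable_cst.
have mF := @measurable_expected_lnp R _ (coord_space R K) _ T
  (4 * beta * Num.sqrt (projT1 (minor_map hB j)).+1%:R / solve_scale) _
  (fun x => minor_mx hB (lp_of x) j) (fun r => X (projT2 (minor_map hB j) (r, r)))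
  (@measurable_minor_mx R m n B hB j) (fun r => mX _).
apply: (measurable_fun_fubini_tonelli_F (m2 := P) _ mF) => x.
by rewrite lee_fin lnp_ge0.
Qed.

Lemma solve_term_flip s x j :
  solve_term hB P X solve_scale (lp_of (flip s x)) j = solve_term hB P X solve_scale (lp_of x) j.
Proof.
congr (_ * _); apply: eq_integral => w _.
by rewrite minor_mx_flip solve_norm_sign.
Qed.

Lemma integral_solve_term_le j :
  \int[P]_w solve_term hB P X solve_scale (lp_of (XX w)) j <= (n.+1%:R^-1)%:E.
Proof.
have [mX _] := HX; have A0 := solve_scale_gt0.
set k := projT1 (minor_map hB j); set f := projT2 (minor_map hB j).
pose tau : R := (4 * beta * Num.sqrt k.+1%:R / solve_scale)%R.
have b0 : (0 < beta)%R by apply: normal_peak_gt0; exact: oner_neq0.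
have tau0 : (0 <= tau)%R by rewrite divr_ge0 ?(ltW A0)// !mulr_ge0 ?sqrtr_ge0 ?(ltW b0).
have HS := iid_normal_comp (@minor_map_inj m n B hB j) HX.
have HZ := iid_normal_diag hB HX j.
have H := expected_lnp_solve_norm tau0 HS HZ.
rewrite ge0_integralZl.
- apply: (@le_trans _ _ (2%:E * (2 * beta * tau * Num.sqrt (k.+1%:R * (6 / 5)))%:E)).
    apply: lee_wpmul2l; first by rewrite lee_fin.
    refine (le_trans (eq_lee _) H).
    apply: eq_integral => w _; apply: eq_integral => w' _.
    have -> : minor_mx hB (lp_of (XX w)) j = mx_of (fun k => X (f k) w).
      by apply/matrixP => a c; rewrite !mxE lp_entry_lp_of.
    by [].
  rewrite -EFinM lee_fin sqrtrM// /tau.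
  have k0 : (k.+1%:R <= m.+2%:R :> R)%R by rewrite ler_nat ltnS; exact: minor_map_size.
  have s2 : (Num.sqrt k.+1%:R * Num.sqrt k.+1%:R = k.+1%:R :> R)%R by rewrite -expr2 sqr_sqrtr.
  have aux (r q S : R) : (S != 0 -> 2 * (2 * beta * (4 * beta * r / S) * (r * q)) =
      r * r * (16 * beta ^+ 2 * q) / S)%R by move=> S0; field.
  rewrite aux ?gt_eqF// s2.
  rewrite ler_pdivrMr// /solve_scale -!mulrA mulKf ?pnatr_eq0// ler_wpM2r//.
  by rewrite !mulr_ge0 ?sqrtr_ge0// ltW.
- exact: measurableT.
- have mF := @measurable_expected_lnp R _ T _ T tau _
    (fun w => minor_mx hB (lp_of (XX w)) j) (fun r => X (f (r, r))) _ (fun r => mX _).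
  apply: (measurable_fun_fubini_tonelli_F (m2 := P) _ (mF _)) => [a c|x]; last by rewrite lee_fin lnp_ge0.
  exact: (measurableT_comp (@measurable_minor_mx R m n B hB j a c) (measurable_family mX)).
- by move=> w _; apply: integral_ge0 => w' _; rewrite lee_fin lnp_ge0.
- by rewrite lee_fin.
Qed.

End BoundFunction.

Lemma lp_norm_pow4_le (R : realType) m n (d : lp_data R m n) :
  lp_norm d ^+ 4 <= (1 + m)%:R * \sum_k lp_entry d k ^+ 4.
Proof.
have -> : \sum_k lp_entry d k ^+ 4 = \sum_i \sum_j lp_mx d i j ^+ 4.
  rewrite big_sumType big_sumType /= [RHS]big_split_ord big_ord1 /= big_split_ord big_ord1 /=.
  under [X in _ = X + _ + _]eq_bigr do rewrite /lp_mx block_mxEul mxE.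
  rewrite [lp_mx _ _ _]block_mxEur mxE expr0n addr0.
  under [X in _ = _ + X]eq_bigr => i _.
    rewrite big_split_ord big_ord1 /=.
    under eq_bigr do rewrite /lp_mx block_mxEdl.
    rewrite [lp_mx _ _ _]block_mxEdr; over.
  rewrite big_split /= addrA [LHS]addrC; congr (_ + (_ + _)).
  by rewrite pair_big /=; apply: eq_bigr => -[i j] _.
rewrite /lp_norm; move: (lp_mx d); rewrite addn1 => M; exact: opnorm12_pow4_le.
Qed.

Section Expectation.
Context {R : realType} {m n : nat}.
Context {B : {set 'I_n}} (hB : #|B| = m.+1).
Local Notation K := (@entry_idx m.+1 n).
Context {d : measure_display} {T : measurableType d}.
Variables (P : probability T R) (X : K -> T -> R).
Hypothesis HX : iid_normal P X.
Local Notation XX w := ((fun k => X k w) : coord_space R K).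

Definition quartic (x : coord_space R K) : R := \sum_k x k ^+ 4.

Lemma quartic_ge0 x : 0 <= quartic x.
Proof. by apply: sumr_ge0 => k _; rewrite (exprM _ 2 2) sqr_ge0. Qed.

Lemma measurable_quartic : measurable_fun setT quartic.
Proof. by apply: measurable_sum => k; apply: measurable_funX; exact: measurable_coord. Qed.

Lemma quartic_flip s x : quartic (flip s x) = quartic x.
Proof.
apply: eq_bigr => k _; rewrite /flip exprMn (exprM _ 2 2) sqrr_sign expr1n.
by rewrite mul1r.
Qed.

(** An upper bound for the expectation of [|d|^4]: the factor [m + 2] of [lp_norm_pow4_le], fewer
    than [(m + 2) (n + 1)] entries, and [7/2] for each fourth moment. *)
Definition norm_scale : R := 7 / 2 * m.+2%:R ^+ 2 * n.+1%:R.

Lemma norm_scale_ge3 : 3 <= norm_scale.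
Proof.
have m2 : 2 <= m.+2%:R :> R by rewrite ler_nat.
have n1 : 1 <= n.+1%:R :> R by rewrite ler1n.
have : 4 * 1 <= m.+2%:R ^+ 2 * n.+1%:R :> R by apply: ler_pM => //; nra.
rewrite /norm_scale -mulrA; lra.
Qed.

Definition bound_fun (x : coord_space R K) : \bar R :=
  ((m.+2%:R / (4 * norm_scale) * quartic x)%:E +
   total_solve_term hB P X (@solve_scale R m n) (lp_of x))%E.

(** The constant part of the bound; [bound_fun] is its random part, of expectation at most [5/4]. *)
Definition bound_const : R := ln norm_scale / 4 - 1 / 4 + ln (@solve_scale R m n).

(** A quarter of [ln y <= y - 1] at [y = |d|^4 / norm_scale]. *)
Lemma ln_lp_norm_le (e : lp_data R m.+1 n) :
  ln (lp_norm e) <= ln norm_scale / 4 - 1 / 4 + m.+2%:R / (4 * norm_scale) * quartic (lp_entry e).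
Proof.
have s3 := norm_scale_ge3; have s0 : 0 < norm_scale by lra.
have c0 : 0 < m.+2%:R / (4 * norm_scale) by rewrite divr_gt0 ?mulr_gt0// ltr0n.
have ln1 : 1 <= ln norm_scale.
  apply: le_trans (@ln3_ge1 R) _; rewrite ler_ln ?posrE//.
(* Here [ln] takes its default value [0], and [1 <= ln norm_scale] makes the right side
   nonnegative. *)
have [N0|N0] := leP (lp_norm e) 0.
  rewrite ln0//; have := mulr_ge0 (ltW c0) (quartic_ge0 (lp_entry e)); lra.
have N4 : 0 < lp_norm e ^+ 4 / norm_scale by rewrite divr_gt0 ?exprn_gt0.
have H : ln (lp_norm e ^+ 4 / norm_scale) <= lp_norm e ^+ 4 / norm_scale - 1.
  have -> : lp_norm e ^+ 4 / norm_scale = 1 + (lp_norm e ^+ 4 / norm_scale - 1) by ring.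
  apply: (le_trans (le_ln1Dx _)); lra.
rewrite ln_div ?posrE ?exprn_gt0// lnXn// in H.
have H4 : lp_norm e ^+ 4 / norm_scale <= m.+2%:R / norm_scale * quartic (lp_entry e).
  rewrite [leRHS]mulrAC ler_pM2r ?invr_gt0//; exact: lp_norm_pow4_le.
have E4 : m.+2%:R / (4 * norm_scale) * quartic (lp_entry e) =
    (m.+2%:R / norm_scale * quartic (lp_entry e)) / 4 by field; rewrite gt_eqF.
rewrite E4; move: H; rewrite -mulr_natl; lra.
Qed.

Local Open Scope ereal_scope.

Lemma lne_cond_number_bound x : strict_set hB x ->
  lne (cond_number (lp_of x)) <= bound_const%:E + bound_fun x.
Proof.
move=> /strict_setP sx.
apply: le_trans (lne_cond_number_le HX (@solve_scale_gt0 R m n) sx) _.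
rewrite addeA leeD2r// -EFinD lee_fin.
have := ln_lp_norm_le (lp_of x); rewrite /bound_const.
have -> : quartic (lp_entry (lp_of x)) = quartic x.
  by apply: eq_bigr => k _; rewrite lp_entry_lp_of.
lra.
Qed.

Lemma bound_fun_ge0 x : 0 <= bound_fun x.
Proof.
have s3 := norm_scale_ge3.
apply: adde_ge0; last by apply: sume_ge0 => j _; exact: solve_term_ge0.
by rewrite lee_fin mulr_ge0 ?quartic_ge0// divr_ge0// mulr_ge0//; lra.
Qed.

Lemma measurable_bound_fun : measurable_fun setT bound_fun.
Proof.
apply: emeasurable_funD.
  apply/measurable_EFinP; apply: measurable_funM; first exact: measurable_cst.
  exact: measurable_quartic.
by apply: emeasurable_sum => j; exact: measurable_solve_term.
Qed.

Lemma bound_fun_flip s x : bound_fun (flip s x) = bound_fun x.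
Proof.
congr (_ + _); first by rewrite quartic_flip.
by apply: eq_bigr => j _; exact: solve_term_flip.
Qed.

Lemma integral_quartic_le : \int[P]_w (quartic (XX w))%:E <= (#|{: K}|%:R * (7 / 2))%:E.
Proof.
have [mX _] := HX; under eq_integral do rewrite /quartic -sumEFin.
have x4 (y : R) : (0 <= y ^+ 4)%R by rewrite (exprM _ 2 2) sqr_ge0.
rewrite ge0_integral_sum; first last.
- by move=> k w _; rewrite lee_fin.
- by move=> k; apply/measurable_EFinP; exact: measurable_funX.
- exact: measurableT.
apply: (@le_trans _ _ (\sum_(k : K) (7 / 2)%:E)); last first.
  by rewrite sumEFin lee_fin sumr_const -(mulr_natl (7 / 2)%R).
apply: lee_sum => k _; apply: le_trans normal_moment4.
have Hk := iid_normal_comp (f := fun _ : unit => k) _ HX.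
have inj1 : injective (fun _ : unit => k) by do 2 case.
have mF : measurable_fun setT (fun x : coord_space R unit => (x tt ^+ 4)%:E).
  by apply/measurable_EFinP; apply: measurable_funX; exact: measurable_coord.
have F0 (x : coord_space R unit) : 0 <= (x tt ^+ 4)%:E by rewrite lee_fin.
by rewrite (iid_normal_transfer (Hk inj1) (@iid_normal_id R) mF F0).
Qed.

(** The quartic part contributes [1/4] and the [n + 1] minors at most [1 / (n + 1)] each. *)
Lemma integral_bound_fun_le : \int[P]_w bound_fun (XX w) <= (5 / 4)%:E.
Proof.
have [mX _] := HX; have mXX := measurable_family mX.
have s3 := norm_scale_ge3; have s0 : (0 < norm_scale)%R by lra.
have c0 : (0 <= m.+2%:R / (4 * norm_scale))%R by rewrite divr_ge0// mulr_ge0// ltW.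
have mQ : measurable_fun setT (fun w => quartic (XX w)) by exact: measurableT_comp measurable_quartic mXX.
have mS j : measurable_fun setT (fun w => solve_term hB P X (@solve_scale R m n) (lp_of (XX w)) j).
  exact: (measurableT_comp (measurable_solve_term hB HX j) mXX).
have S0 j w : 0 <= solve_term hB P X (@solve_scale R m n) (lp_of (XX w)) j by exact: solve_term_ge0.
rewrite /bound_fun ge0_integralD; first last.
- by apply: emeasurable_sum => j; exact: mS.
- by move=> w _; apply: sume_ge0 => j _; exact: S0.
- by apply/measurable_EFinP; apply: measurable_funM => //; exact: measurable_cst.
- by move=> w _; rewrite lee_fin mulr_ge0// quartic_ge0.
- exact: measurableT.
have -> : ((5 / 4)%:E = (4^-1)%:E + 1 :> \bar R) by rewrite -EFinD; congr EFin; lra.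
apply: leeD.
  under eq_integral do rewrite EFinM.
  rewrite ge0_integralZl; first last.
  - by rewrite lee_fin.
  - by move=> w _; rewrite lee_fin quartic_ge0.
  - exact/measurable_EFinP.
  - exact: measurableT.
  apply: (@le_trans _ _ ((m.+2%:R / (4 * norm_scale))%:E * (#|{: K}|%:R * (7 / 2))%:E)).
    apply: lee_wpmul2l; first by rewrite lee_fin.
    exact: integral_quartic_le.
  rewrite -EFinM lee_fin.
  have cardK : (#|{: K}|%:R <= m.+2%:R * n.+1%:R :> R)%R.
    rewrite !card_sum card_prod !card_ord -natrM ler_nat; lia.
  have -> : (m.+2%:R / (4 * norm_scale) * (#|{: K}|%:R * (7 / 2)) =
     m.+2%:R * (7 / 2) * #|{: K}|%:R / (4 * norm_scale) :> R)%R by ring.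
  rewrite ler_pdivrMr ?mulr_gt0// /norm_scale.
  have : (m.+2%:R * #|{: K}|%:R <= m.+2%:R * (m.+2%:R * n.+1%:R) :> R)%R by rewrite ler_wpM2l.
  lra.
rewrite /total_solve_term ge0_integral_sum; first last.
- by move=> j w _; exact: S0.
- exact: mS.
- exact: measurableT.
apply: (@le_trans _ _ (\sum_(j : option 'I_n) (n.+1%:R^-1)%:E)).
  by apply: lee_sum => j _; exact: integral_solve_term_le.
by rewrite sumEFin lee_fin sumr_const card_option card_ord -(mulr_natl (n.+1%:R^-1)%R) mulfV// pnatr_eq0.
Qed.

End Expectation.

(** * Numerical constants *)

Section Constants.
Context {R : realType}.
Local Notation beta := (@normal_peak R 1).

Lemma normal_peak1_sqr : beta ^+ 2 = (2 * pi)^-1.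
Proof.
rewrite /normal_peak exprVn sqr_sqrtr; last by rewrite mulrn_wge0// mulr_ge0 ?sqr_ge0// pi_ge0.
by rewrite expr1n mul1r mulr_natl.
Qed.

(** [16 beta^2 = 8 / pi]: the lower bound comes from [pi < 4], the upper one from [3 <= pi]. *)
Lemma peak_factor_bounds : 1 <= 16 * beta ^+ 2 * Num.sqrt (6 / 5) :> R /\
  (16 * beta ^+ 2 * Num.sqrt (6 / 5)) ^+ 4 <= (8 / 3) ^+ 4 * (6 / 5) ^+ 2 :> R.
Proof.
have p3 := @pi_ge3 R; have p4 := @pihalf_lt2 R.
have -> : 16 * beta ^+ 2 = 8 / pi :> R by rewrite normal_peak1_sqr; field; rewrite gt_eqF; lra.
have s1 : 1 <= Num.sqrt (6 / 5) :> R by rewrite -[leLHS]sqrtr1 ler_wsqrtr//; lra.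
have b1 : 1 <= 8 / pi :> R by rewrite ler_pdivlMr; lra.
split; first by rewrite -[leLHS]mulr1; apply: ler_pM.
rewrite exprMn (exprM (Num.sqrt _) 2 2) sqr_sqrtr; last by lra.
rewrite ler_wpM2r ?sqr_ge0// lerXn2r ?nnegrE//.
- by rewrite (le_trans _ b1).
- by rewrite ler_pdivrMr; lra.
Qed.

Lemma ln_solve_scale m n : ln (@solve_scale R m n) =
  ln n.+1%:R + ln m.+2%:R + ln (16 * beta ^+ 2 * Num.sqrt (6 / 5)).
Proof.
have [+ _] := peak_factor_bounds; rewrite /solve_scale.
move: (16 * _ * _) => q q1; have q0 : 0 < q by exact: lt_le_trans q1.
by rewrite !lnM ?posrE ?mulr_gt0 ?ltr0n.
Qed.

Lemma ln_norm_scale m n : ln (@norm_scale R m n) = ln (7 / 2) + 2 * ln m.+2%:R + ln n.+1%:R.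
Proof.
have h7 : 0 < 7 / 2 :> R by lra.
rewrite /norm_scale; move: (7 / 2) h7 => c c0.
rewrite !lnM ?posrE ?mulr_gt0 ?exprn_gt0 ?ltr0n//; ring.
Qed.

Lemma bound_const_ge0 m n : 0 <= @bound_const R m n.
Proof.
have [q1 _] := peak_factor_bounds.
have l1 : 1 <= ln (@norm_scale R m n).
  have s3 := @norm_scale_ge3 R m n.
  by apply: le_trans (@ln3_ge1 R) _; rewrite ler_ln ?posrE//; lra.
have := ln_ge0 q1; rewrite /bound_const ln_solve_scale.
have : 0 <= ln (n.+1%:R : R) by rewrite ln_ge0// ler1n.
have : 0 <= ln (m.+2%:R : R) by rewrite ln_ge0// ler1n.
lra.
Qed.

(** In this indexing [m.+2] is the [m + 1] of the theorem. The logarithms have coefficients [3/2]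
    for [m.+2] and [5/4] for [n.+1]; [m < n] moves a quarter from the first to the second. The
    remaining [1] is absorbed by [1 <= ln 3]. *)
Lemma bound_const_le m n : (m < n)%N ->
  @bound_const R m n + 5 / 4 <= 5 / 4 * ln m.+2%:R + 3 / 2 * ln n.+1%:R + ln 12.
Proof.
move=> mn; have [+ +] := peak_factor_bounds.
rewrite /bound_const ln_solve_scale ln_norm_scale; move: (16 * _ * _) => q q1 q4.
have q0 : 0 < q by exact: lt_le_trans q1.
have lmn : ln (m.+2%:R : R) <= ln n.+1%:R by rewrite ler_ln ?posrE ?ltr0n// ler_nat.
(* Amounts to [7/2 q^4 <= 4^4 = 256], and the bound on [q] gives about [254.9]. *)
have key : ln (7 / 2) + 4 * ln q + 4 * ln 3 <= 4 * ln 12 :> R.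
  have h7 : 0 < 7 / 2 :> R by lra.
  have [q4p t4p] : 0 < q ^+ 4 /\ 0 < 3 ^+ 4 :> R by rewrite !exprn_gt0.
  have l4 (x : R) : 0 < x -> 4 * ln x = ln (x ^+ 4) by move=> x0; rewrite lnXn// mulr_natl.
  rewrite !l4// -(lnM h7 q4p) -(lnM (mulr_gt0 h7 q4p) t4p).
  rewrite ler_ln ?posrE ?exprn_gt0// ?(mulr_gt0 (mulr_gt0 h7 q4p) t4p)//.
  lra.
have l3 := @ln3_ge1 R; lra.
Qed.

End Constants.

(** * Measurability of the event of a unique optimal basis *)

Section UniqueBasisMeasurable.
Context {R : realType} {m n : nat}.
Local Notation K := (@entry_idx m.+1 n).

Lemma measurable_exists d (T : measurableType d) (I : finType) (F : I -> set T) :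
  (forall i, measurable (F i)) -> measurable [set w | exists i, F i w].
Proof.
move=> mF; rewrite -[X in measurable X]setCK; apply: measurableC.
rewrite (_ : ~` _ = [set w | forall i, (~` F i) w]).
  by apply: (@measurable_forall _ _ _ (fun i => ~` F i)) => i; exact: measurableC.
apply/seteqP; split=> w /= H; first by move=> i Fi; apply: H; exists i.
by move=> [i]; exact: H.
Qed.

Lemma measurable_optimal_basis (B : {set 'I_n}) :
  measurable [set x : coord_space R K | optimal_basis (lp_of x) B].
Proof.
have [hB|hB] := eqVneq #|B| m.+1; last first.
  rewrite (_ : mkset _ = set0)//; apply/seteqP; split=> // x [hB' _].
  by rewrite hB' eqxx in hB.
rewrite (_ : mkset _ = [set x | minor hB (lp_of x) None != 0] `&`
    [set x | forall j, 0 <= sign_minor hB x j]); last first.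
  apply/seteqP; split=> x; first by move=> /(optimal_basis_minorP hB)[].
  by move=> [x0 xj]; apply/(optimal_basis_minorP hB).
apply: measurableI.
  rewrite -[X in measurable X]setTI.
  apply: (@measurable_minor R m n B hB None measurableT [set x | x != 0%R]).
  rewrite (_ : mkset _ = ~` [set 0%R]); first exact: measurableC.
  by apply/seteqP; split=> x /= => [/eqP|/eqP].
apply: (@measurable_forall _ _ (coord_space R K) (fun j x => 0 <= sign_minor hB x j)) => j.
rewrite -[X in measurable X]setTI.
apply: (@measurable_sign_minor R m n B hB j measurableT [set x | 0 <= x]).
rewrite (_ : mkset _ = `[0%R, +oo[%classic) //.
by apply/seteqP; split=> x /=; rewrite in_itv /= andbT.
Qed.

Lemma measurable_unique_optimal_basis :
  measurable [set x : coord_space R K | has_unique_optimal_basis (lp_of x)].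
Proof.
pose O (B : {set 'I_n}) := [set x : coord_space R K | optimal_basis (lp_of x) B].
have mO B : measurable (O B) by exact: measurable_optimal_basis.
rewrite (_ : mkset _ = [set x | exists B : {set 'I_n}, (O B `&`
   [set x | forall B' : {set 'I_n}, (if B == B' then setT else ~` O B') x]) x]).
  apply: measurable_exists => B; apply: measurableI => //.
  apply: (@measurable_forall _ _ (coord_space R K)
    (fun B' x => (if B == B' then setT else ~` O B') x)) => B'.
  by case: ifP => _ //; exact: measurableC.
apply/seteqP; split=> x /= [B [OB H]]; exists B; split=> // B'.
  by case: eqP => // BB' /= OB'; apply: BB'; exact: H.
by move=> OB'; have := H B'; case: eqP => // _ /(_ OB').
Qed.

End UniqueBasisMeasurable.

(** * Summation over all bases *)

Section Assembly.
Context {R : realType} {m n : nat}.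
Hypothesis mn : (m < n)%N.
Local Notation K := (@entry_idx m.+1 n).
Context {d : measure_display} {T : measurableType d}.
Variables (P : probability T R) (D : T -> lp_data R m.+1 n).
Hypothesis gD : gaussian_data P D.
Local Notation XX w := (lp_entry (D w) : coord_space R K).
Local Notation basis := ({B : {set 'I_n} | #|B| == m.+1} : finType).
Local Notation card B := (eqP (valP B) : #|val B| = m.+1).
Local Open Scope ereal_scope.

Let HX : iid_normal P (fun k w => lp_entry (D w) k) := gaussian_data_iid_normal gD.

Let bound : R := (@bound_const R m n + 5 / 4)%R.

Let strict (B : basis) : set T := [set w | strict_set (card B) (XX w)].

Let degen : set T := [set w | exists B : basis, degenerate_set (card B) (XX w)].

Let weight (B : basis) (x : coord_space R K) : \bar R :=
  (@bound_const R m n)%:E + bound_fun (card B) P (fun k w => lp_entry (D w) k) x.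

(* Infinite on the null set of degenerate data, where [lne (cond_number _)] is not controlled. *)
Let dominating (w : T) : \bar R :=
  \sum_(B : basis) ((\1_(strict_set (card B)) (XX w))%:E * weight B (XX w)) +
  (cst +oo \_ degen) w.

Let weight_ge0 B x : 0 <= weight B x.
Proof. by rewrite adde_ge0 ?bound_fun_ge0// lee_fin bound_const_ge0. Qed.

Let measurable_weight B : measurable_fun setT (weight B).
Proof.
apply: emeasurable_funD; first exact: measurable_cst.
exact: (measurable_bound_fun (card B) HX).
Qed.

Let degen_null : measurable degen /\ P degen = 0.
Proof.
apply: measure_exists_null => B.
  exact: (measurable_pullback HX (measurable_degenerate_set (card B))).
exact: (degenerate_null (card B) HX).
Qed.

Let mXX : measurable_fun setT (fun w => XX w).
Proof. by have [mX _] := HX; exact: measurable_family. Qed.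

Let measurable_indic_weight (B : basis) :
  measurable_fun setT (fun w => (\1_(strict_set (card B)) (XX w))%:E * weight B (XX w)).
Proof.
apply: emeasurable_funM; last exact: measurableT_comp (measurable_weight B) mXX.
apply/measurable_EFinP.
have mI : measurable_fun setT (\1_(strict_set (card B)) : coord_space R K -> R).
  by apply: measurable_indic; exact: measurable_strict_set.
exact: (measurableT_comp mI mXX).
Qed.

Let indic_weight_ge0 (B : basis) w : 0 <= (\1_(strict_set (card B)) (XX w))%:E * weight B (XX w).
Proof. by rewrite mule_ge0 ?weight_ge0// lee_fin. Qed.

Let infty_degen_ge0 w : 0 <= (cst (+oo : \bar R) \_ degen) w.
Proof. by apply: erestrict_ge0 => x _; exact: leey. Qed.

Let dominating_ge0 w : 0 <= dominating w.
Proof.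
apply: adde_ge0; last exact: infty_degen_ge0.
by apply: sume_ge0 => B _; exact: indic_weight_ge0.
Qed.

(** Off the degenerate set no minor vanishes, so the optimal basis is strictly optimal and its
    summand applies; on it the right side is infinite. *)
Let lne_cond_number_le_dominating w : has_unique_optimal_basis (D w) ->
  lne (cond_number (D w)) <= dominating w.
Proof.
move=> [B [oB _]].
have [ndeg|dw] := pselect (~ degen w); last first.
  rewrite /dominating patchE mem_set; last exact: contrapT dw.
  have s0 : 0 <= \sum_(B : basis) ((\1_(strict_set (card B)) (XX w))%:E * weight B (XX w)).
    by apply: sume_ge0 => B' _; exact: indic_weight_ge0.
  by rewrite addey ?leey//; apply: contraTneq s0 => ->.
have [hB _] := oB; have hB' : #|B| == m.+1 by apply/eqP.
pose B1 : basis := exist _ B hB'.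
have sw : strict_set (card B1) (XX w).
  have /(optimal_basis_minorP (card B1)) : optimal_basis (lp_of (XX w)) (val B1) by rewrite lp_ofK.
  move=> [m0 mj]; split=> // j; rewrite lt_neqAle eq_sym mj andbT mulf_neq0//.
  by apply/eqP => mj0; apply: ndeg; exists B1; exists (Some j).
have := lne_cond_number_bound HX sw; rewrite lp_ofK => H.
rewrite /dominating; apply: le_trans H _.
apply: (@le_trans _ _ (\sum_(B : basis) ((\1_(strict_set (card B)) (XX w))%:E * weight B (XX w)))).
  rewrite (bigD1 B1)//= indicE mem_set// mul1e leeDl// sume_ge0// => B' _.
  exact: indic_weight_ge0.
by rewrite leeDl.
Qed.

Lemma measurable_preimage_unique : measurable (D @^-1` has_unique_optimal_basis).
Proof.
have := measurable_pullback HX (@measurable_unique_optimal_basis R m n).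
by congr measurable; apply/seteqP; split=> w /=; rewrite lp_ofK.
Qed.

(** The events of strict optimality lie in [U] and are disjoint for distinct bases, since both bases
    would be optimal. *)
Let sum_strict_le : \sum_(B : basis) P (strict B) <=
  P (D @^-1` has_unique_optimal_basis).
Proof.
have mU := measurable_preimage_unique.
have mS B : measurable (strict B).
  exact: (measurable_pullback HX (measurable_strict_set (card B))).
have -> : \sum_(B : basis) P (strict B) = \int[P]_w (\sum_(B : basis) (\1_(strict B) w)%:E).
  rewrite ge0_integral_sum.
  - by apply: eq_bigr => B _; rewrite integral_indic ?setIT.
  - exact: measurableT.
  - by move=> B; apply/measurable_EFinP; exact: measurable_indic.
  - by move=> B w _; rewrite lee_fin.
have -> : P (D @^-1` has_unique_optimal_basis) =
    \int[P]_w (\1_(D @^-1` has_unique_optimal_basis) w)%:E by rewrite integral_indic ?setIT.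
apply: ge0_le_integral.
- exact: measurableT.
- by move=> w _; apply: sume_ge0 => B _; rewrite lee_fin.
- by apply: emeasurable_sum => B; apply/measurable_EFinP; exact: measurable_indic.
- by apply/measurable_EFinP; exact: measurable_indic.
move=> w _.
have unique B : strict B w -> has_unique_optimal_basis (D w).
  by move=> /strict_setP; rewrite lp_ofK; exact: strictly_optimal_unique.
have [[B Bw]|noB] := pselect (exists B, strict B w); last first.
  rewrite big1 ?lee_fin// => B _; rewrite indicE memNset//= => Bw.
  by apply: noB; exists B.
rewrite (bigD1 B)//= big1 ?adde0; last first.
  move=> B' BB'; rewrite indicE memNset// => B'w; move/eqP: BB'; apply.
  have [B0 [_ B0E]] := unique B Bw.
  have opt B1 : strict B1 w -> optimal_basis (D w) (val B1).
    move=> [m0 mj]; have : optimal_basis (lp_of (XX w)) (val B1).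
      by apply/(optimal_basis_minorP (card B1)); split=> // j; apply: ltW; exact: mj.
    by rewrite lp_ofK.
  by apply: val_inj; rewrite -(B0E _ (opt _ Bw)) -(B0E _ (opt _ B'w)).
rewrite !indicE (mem_set Bw) mem_set//.
exact: unique Bw.
Qed.

(** For each basis, [integral_strict_set_le] separates the probability of strict optimality from the
    expected weight, which is at most [bound]; the probabilities then sum to at most that of [U]. *)
Lemma integral_lne_cond_number_le :
  \int[P]_(w in D @^-1` has_unique_optimal_basis) lne (cond_number (D w)) <=
  P (D @^-1` has_unique_optimal_basis) * bound%:E.
Proof.
have [mdegen degen0] := degen_null.
have bc0 := @bound_const_ge0 R m n.
have b0 : (0 <= bound)%R by rewrite /bound; lra.
apply: le_trans (le_integral_set P (f := fun w => lne (cond_number (D w))) dominating_ge0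
  lne_cond_number_le_dominating) _.
rewrite /dominating ge0_integralD; first last.
- by apply/(measurable_restrictT _ _).1 => //; exact: measurable_cst.
- by move=> w _; exact: infty_degen_ge0.
- by apply: emeasurable_sum => B; exact: measurable_indic_weight.
- by move=> w _; apply: sume_ge0 => B _; exact: indic_weight_ge0.
- exact: measurableT.
rewrite -(integral_mkcond degen) integral_cst// [X in +oo * X]degen0 mule0 adde0.
rewrite ge0_integral_sum; first last.
- by move=> B w _; exact: indic_weight_ge0.
- by move=> B; exact: measurable_indic_weight.
- exact: measurableT.
apply: (@le_trans _ _ ((\sum_(B : basis) P (strict B)) * bound%:E)); last first.
  by apply: lee_wpmul2r; [rewrite lee_fin|exact: sum_strict_le].
rewrite ge0_sume_distrl//; apply: lee_sum => B _.
have wflip s x : weight B (flip s x) = weight B x by rewrite /weight bound_fun_flip.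
have := integral_strict_set_le (card B) HX (measurable_weight B) (weight_ge0 B) wflip.
move=> /le_trans; apply; apply: lee_wpmul2l; first exact: measure_ge0.
rewrite /weight ge0_integralD; first last.
- exact: (measurableT_comp (measurable_bound_fun (card B) HX) mXX).
- by move=> w _; exact: bound_fun_ge0.
- exact: measurable_cst.
- by move=> w _; rewrite lee_fin.
- exact: measurableT.
rewrite integral_cst; last exact: measurableT.
have -> : (@bound_const R m n)%:E * P setT = (@bound_const R m n)%:E.
  by rewrite probability_setT mule1.
rewrite /bound (EFinD (@bound_const R m n)); apply: leeD; first by [].
exact: (integral_bound_fun_le (card B) HX).
Qed.

End Assembly.

Theorem theorem1 (R : realType) (m n : nat) (m_ge1 : (1 <= m)%N)
  (n_gem : (m <= n)%N) (dsp : measure_display) (Omega : measurableType dsp)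
  (P : probability Omega R) (D : Omega -> lp_data R m n)
  (gaussD : gaussian_data P D) :
  (cond_expectation P (fun w => lne (cond_number (D w)))
     (D @^-1` has_unique_optimal_basis)
   <= (5 / 4 * ln (m.+1)%:R + 3 / 2 * ln (n.+1)%:R + ln 12)%:E)%E.
Proof.
case: m m_ge1 n_gem D gaussD => // m _ mn D gaussD.
have H := integral_lne_cond_number_le gaussD.
have bc0 := @bound_const_ge0 R m n.
apply: (@le_trans _ _ (@bound_const R m n + 5 / 4)%:E); last by rewrite lee_fin bound_const_le.
rewrite /cond_expectation; set U := D @^-1` _ in H *; set c := (_ + 5 / 4) in H *.
have c0 : 0 <= c by rewrite /c; lra.
have : P U \is a fin_num.
  rewrite ge0_fin_numE ?measure_ge0//; apply: le_lt_trans (ltry 1).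
  by apply: probability_le1; exact: measurable_preimage_unique gaussD.
have PU0 : (0 <= P U)%E by exact: measure_ge0.
move: H PU0; move: (integral _ _ _) (P U) => I [p| |] // IpU p0 _.
(* If [U] had probability [0], the quotient would be [I * +oo] with [I <= 0], still below the
   nonnegative bound. *)
rewrite inver; case: eqP => [pE|/eqP pN0].
  move: IpU; rewrite pE mul0e => I0; apply: (@le_trans _ _ 0%E); last by rewrite lee_fin.
  by rewrite mule_le0_ge0.
have pgt0 : 0 < p.
  by move: p0; rewrite lee_fin le_eqVlt eq_sym (negbTE pN0).
have -> : c%:E = (p%:E * c%:E * (p^-1)%:E)%E by rewrite -!EFinM mulrAC divff// mul1r.
by apply: lee_wpmul2r => //; rewrite lee_fin invr_ge0 ltW.
Qed.
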